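(* Let $T\in(0,\infty]$, let $V:(0,T)\times\mathbb{R}\to\mathbb{C}$ be measurable, and let $G:(0,T)\times\mathbb{R}\times\mathbb{R}\to\mathbb{C}$ satisfy the Green's function assumption (stated in the context) with parameters $\alpha\geq 0$, $n\in\mathbb{N}$, $n>\alpha+3$. Then for every $F\in C^n(\mathbb{R},r^\beta)$ with $0\leq\beta<n-\alpha-3$, the limit $$\Psi(t,x):=\lim_{\varepsilon\to 0^+}\int_\mathbb{R}e^{-\varepsilon y^2}G(t,x,y)F(y)\,dy,\qquad t\in(0,T),\,x\in\mathbb{R},$$ exists, and $\Psi\in\operatorname{AC}_{1,2}((0,T)\times\mathbb{R})$ is a solution of the Schrödinger equation $$i\frac{\partial}{\partial t}\Psi(t,x)=\Big(-\frac{\partial^2}{\partial x^2}+V(t,x)\Big)\Psi(t,x)\qquad\text{for almost every } t\in(0,T),\,x\in\mathbb{R},$$ with initial condition $\Psi(0,x)=F(x)$, $x\in\mathbb{R}$, in the sense that $\lim_{t\to 0^+}\Psi(t,x)=F(x)$ for every $x\in\mathbb{R}$.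
   Context: All functions are complex-valued. For an open interval $I\subseteq\mathbb{R}$, $\operatorname{AC}(I)$ denotes the functions $f:I\to\mathbb{C}$ for which there is $g\in L^1_{\mathrm{loc}}(I)$ with $f(s_2)-f(s_1)=\int_{s_1}^{s_2}g(s)\,ds$ for all $s_1<s_2$ in $I$ (then $f'=g$ almost everywhere). $\operatorname{AC}_{1,2}((0,T)\times\mathbb{R})$ is the set of $\Psi:(0,T)\times\mathbb{R}\to\mathbb{C}$ such that $\Psi(\cdot,x)\in\operatorname{AC}((0,T))$ for all $x\in\mathbb{R}$ and $\Psi(t,\cdot),\frac{\partial\Psi}{\partial x}(t,\cdot)\in\operatorname{AC}(\mathbb{R})$ for all $t\in(0,T)$. With $r(y):=1+|y|$, for $n\in\mathbb{N}_0$ and $\alpha\ge 0$ let $C^n(\mathbb{R},r^\alpha)$ be the space of $f\in C^n(\mathbb{R})$ for which there is $M\geq 0$ with $|f^{(k)}(y)|\leq Mr(y)^\alpha$ for all $y\in\mathbb{R}$, $k\in\{0,\dots,n\}$, with norm $\Vert f\Vert_{C^n(\mathbb{R},r^\alpha)}:=\max_{k\in\{0,\dots,n\}}\sup_{y\in\mathbb{R}}\frac{|f^{(k)}(y)|}{r(y)^\alpha}$. Green's function assumption (for $G:(0,T)\times\mathbb{R}\times\mathbb{R}\to\mathbb{C}$, with parameters $\alpha\geq 0$, $n\in\mathbb{N}$, $n>\alpha+3$): (i) For every $y\in\mathbb{R}$ the function $G(\cdot,\cdot,y)\in\operatorname{AC}_{1,2}((0,T)\times\mathbb{R})$ is a solution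 of $i\frac{\partial}{\partial t}G(t,x,y)=\big(-\frac{\partial^2}{\partial x^2}+V(t,x)\big)G(t,x,y)$ for almost every $t\in(0,T)$, $x\in\mathbb{R}$. (ii) For every $x_0>0$ and $\varphi\in C^1([-x_0,x_0])$ one has $\lim_{t\to 0^+}\int_{-x_0}^{x_0}G(t,x,y)\varphi(y)\,dy=\varphi(x)$ for all $x\in(-x_0,x_0)$. (iii) For some $a\in\operatorname{AC}((0,T))$ with $a(t)>0$ for $t\in(0,T)$ and $\lim_{t\to 0^+}a(t)=\infty$ one has $G(t,x,y)=e^{ia(t)(y-x)^2}\widetilde{G}(t,x,y)$ for $t\in(0,T)$, $x,y\in\mathbb{R}$, with a function $\widetilde{G}$ satisfying $\widetilde{G}(t,x,\cdot)\in C^n(\mathbb{R},r^\alpha)$, $\widetilde{G}_x(t,x,\cdot)\in C^n(\mathbb{R},r^{\alpha+1})$, and $\widetilde{G}_{xx}(t,x,\cdot),\widetilde{G}_t(t,x,\cdot)\in C^n(\mathbb{R},r^{\alpha+2})$ (subscripts denote partial derivatives). Moreover, the norms $\Vert\widetilde{G}(t,x,\cdot)\Vert_{C^n(\mathbb{R},r^\alpha)}$, $\Vert\widetilde{G}_x(t,x,\cdot)\Vert_{C^n(\mathbb{R},r^{\alpha+1})}$, $\Vert\widetilde{G}_{xx}(t,x,\cdot)\Vert_{C^n(\mathbb{R},r^{\alpha+2})}$, $\Vert\widetilde{G}_t(t,x,\cdot)\Vert_{C^n(\mathbb{R},r^{\alpha+2})}$ are locally bounded on $(0,T)\times\mathbb{R}$,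 and $\lim_{t\to 0^+}\frac{\Vert\widetilde{G}(t,x,\cdot)\Vert_{C^n(\mathbb{R},r^\alpha)}}{a(t)}=0$ for every $x\in\mathbb{R}$. *)

(* Defs.v *)
From HB Require Import structures.
From mathcomp Require Import all_boot all_order all_algebra.
From mathcomp Require Import complex.
From mathcomp Require Import all_classical all_reals all_analysis.

Set Implicit Arguments.
Unset Strict Implicit.
Unset Printing Implicit Defensive.

Import Order.TTheory GRing.Theory Num.Theory.
Import numFieldNormedType.Exports.

Local Open Scope classical_set_scope.
Local Open Scope ring_scope.
Local Open Scope complex_scope.

(* R[i] carries no topology in the libraries; give it the one of its modulus,
   which is what the numFieldType structure of R[i] induces on R[i]^o. *)
HB.instance Definition _ (R : rcfType) := NormedModule.copy R[i] R[i]^o.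

(* The real-valued modulus; the library's `|z| takes values in R[i]. *)
Definition modulus (R : realType) (z : R[i]) : R :=
  complex.ComplexField.Normc.normc z.

Definition expi (R : realType) (theta : R) : R[i] := cos theta +i* sin theta.

Definition difference_quotient (R : realType) (f : R -> R[i]) (x z : R) : R[i] :=
  (f z - f x) / (z - x)%:C.

Definition cderivable (R : realType) (f : R -> R[i]) (x : R) : Prop :=
  cvg (difference_quotient f x z @[z --> x^']).

(* Meaningful only where cderivable holds. *)
Definition cderive (R : realType) (f : R -> R[i]) (x : R) : R[i] :=
  lim (difference_quotient f x z @[z --> x^']).

Definition cderiven (R : realType) (k : nat) (f : R -> R[i]) : R -> R[i] :=
  iter k (@cderive R) f.

Definition Cn (R : realType) (n : nat) (f : R -> R[i]) : Prop :=
  (forall k y, (k < n)%N -> cderivable (cderiven k f) y) /\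
  continuous (cderiven n f).

(* One-sided derivatives at the two end points. *)
Definition C1_segment (R : realType) (a b : R) (phi : R -> R[i]) : Prop :=
  exists dphi : R -> R[i],
    (forall y, `[a, b]%classic y ->
       difference_quotient phi y z @[z --> within `[a, b] y^'] --> dphi y) /\
    {within `[a, b], continuous dphi}.

Definition cintegrable (R : realType) (D : set R) (f : R -> R[i]) : Prop :=
  (@lebesgue_measure R).-integrable D (fun y => (complex.Re (f y))%:E) /\
  (@lebesgue_measure R).-integrable D (fun y => (complex.Im (f y))%:E).

Definition cintegral (R : realType) (D : set R) (f : R -> R[i]) : R[i] :=
  (\int[@lebesgue_measure R]_(y in D) complex.Re (f y)) +i*
  (\int[@lebesgue_measure R]_(y in D) complex.Im (f y)).

Definition L1loc (R : realType) (I : set R) (g : R -> R[i]) : Prop :=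
  locally_integrable I (fun s => complex.Re (g s)) /\
  locally_integrable I (fun s => complex.Im (g s)).

(* Functions on an open subset of R, or on (0,T) x R, are total functions of
   which only the values on that subset are ever constrained or used. *)

Definition loc_AC (R : realType) (I : set R) (f : R -> R[i]) : Prop :=
  exists g : R -> R[i], L1loc I g /\
    forall s1 s2, I s1 -> I s2 -> s1 < s2 ->
      f s2 - f s1 = cintegral `[s1, s2] g.

Definition times (R : realType) (T : \bar R) : set R :=
  [set t | 0 < t /\ (t%:E < T)%E].

Definition deriv_t (R : realType) (Psi : R -> R -> R[i]) : R -> R -> R[i] :=
  fun t x => cderive (fun s => Psi s x) t.

Definition deriv_x (R : realType) (Psi : R -> R -> R[i]) : R -> R -> R[i] :=
  fun t x => cderive (Psi t) x.

Definition AC12 (R : realType) (T : \bar R) (Psi : R -> R -> R[i]) : Prop :=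
  (forall x, loc_AC (times T) (fun t => Psi t x)) /\
  (forall t, times T t ->
    [/\ loc_AC setT (Psi t),
        forall x, cderivable (Psi t) x
      & loc_AC setT (deriv_x Psi t)]).

Definition lebesgue2 (R : realType) : {measure set _ -> \bar R} :=
  (@lebesgue_measure R \x @lebesgue_measure R)%E.

(* Lebesgue (and not only Borel) measurability: the Lebesgue sigma-algebra of
   the plane is that of the Caratheodory-measurable sets of the outer measure
   induced by lebesgue2. *)
Definition measurable_potential (R : realType) (T : \bar R)
    (V : R -> R -> R[i]) : Prop :=
  forall B : set R, measurable B ->
    (lebesgue2 R)^*%mu.-caratheodory
      [set p | times T p.1 /\ B (complex.Re (V p.1 p.2))] /\
    (lebesgue2 R)^*%mu.-caratheodory
      [set p | times T p.1 /\ B (complex.Im (V p.1 p.2))].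

(* "Almost every t, x" refers to Lebesgue measure on (0,T) x R; that the
   derivatives occurring in the equation exist there is part of the claim. *)
Definition schrodinger_solution (R : realType) (T : \bar R)
    (V Psi : R -> R -> R[i]) : Prop :=
  {ae lebesgue2 R, forall p, times T p.1 ->
    let: (t, x) := p in
    [/\ cderivable (fun s => Psi s x) t,
        cderivable (deriv_x Psi t) x
      & 'i%C * deriv_t Psi t x =
        - deriv_x (deriv_x Psi) t x + V t x * Psi t x]}.

Definition weight (R : realType) (y : R) : R := 1 + `|y|.

Definition Cn_weighted (R : realType) (n : nat) (alpha : R) (f : R -> R[i]) :
    Prop :=
  Cn n f /\
  exists M : R, 0 <= M /\
    forall k y, (k <= n)%N -> modulus (cderiven k f y) <= M * weight y `^ alpha.

Definition Cn_norm (R : realType) (n : nat) (alpha : R) (f : R -> R[i]) : R :=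
  \big[Num.max/0]_(k < n.+1)
    sup [set modulus (cderiven k f y) / weight y `^ alpha | y in [set: R]].

Definition locally_bounded (R : realType) (T : \bar R) (N : R -> R -> R) :
    Prop :=
  forall t x : R, times T t ->
    exists M : R, \forall p \near (t, x), `|N p.1 p.2| <= M.

Definition green_equation (R : realType) (T : \bar R) (V : R -> R -> R[i])
    (G : R -> R -> R -> R[i]) : Prop :=
  forall y, AC12 T (fun t x => G t x y) /\
            schrodinger_solution T V (fun t x => G t x y).

Definition green_initial (R : realType) (G : R -> R -> R -> R[i]) : Prop :=
  forall (x0 : R) (phi : R -> R[i]), 0 < x0 -> C1_segment (- x0) x0 phi ->
  forall x, - x0 < x < x0 ->
    cintegral `[- x0, x0] (fun y => G t x y * phi y) @[t --> 0^'+] --> phi x.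

Definition green_factor (R : realType) (T : \bar R) (alpha : R) (n : nat)
    (G : R -> R -> R -> R[i]) : Prop :=
  exists (a : R -> R) (Gt : R -> R -> R -> R[i]),
  let Gt_x t x y := deriv_x (fun t x => Gt t x y) t x in
  let Gt_xx t x y := deriv_x (deriv_x (fun t x => Gt t x y)) t x in
  let Gt_t t x y := deriv_t (fun t x => Gt t x y) t x in
  (loc_AC (times T) (fun t => (a t)%:C) /\
   (forall t, times T t -> 0 < a t) /\
   a t @[t --> 0^'+] --> +oo) /\
  (forall t x y, times T t ->
     G t x y = expi (a t * (y - x) ^+ 2) * Gt t x y) /\
  (forall t x y, times T t ->
    [/\ cderivable (fun x' => Gt t x' y) x,
        cderivable (fun x' => Gt_x t x' y) x
      & cderivable (fun t' => Gt t' x y) t]) /\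
  (forall t x, times T t ->
    [/\ Cn_weighted n alpha (Gt t x),
        Cn_weighted n (alpha + 1) (Gt_x t x),
        Cn_weighted n (alpha + 2) (Gt_xx t x)
      & Cn_weighted n (alpha + 2) (Gt_t t x)]) /\
  [/\ locally_bounded T (fun t x => Cn_norm n alpha (Gt t x)),
      locally_bounded T (fun t x => Cn_norm n (alpha + 1) (Gt_x t x)),
      locally_bounded T (fun t x => Cn_norm n (alpha + 2) (Gt_xx t x))
    & locally_bounded T (fun t x => Cn_norm n (alpha + 2) (Gt_t t x))] /\
  (forall x, Cn_norm n alpha (Gt t x) / a t @[t --> 0^'+] --> (0 : R)).

Definition green_assumption (R : realType) (T : \bar R) (V : R -> R -> R[i])
    (alpha : R) (n : nat) (G : R -> R -> R -> R[i]) : Prop :=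
  [/\ green_equation T V G, green_initial G & green_factor T alpha n G].

Definition regularized_integrand (R : realType) (G : R -> R -> R -> R[i])
    (F : R -> R[i]) (t x eps : R) : R -> R[i] :=
  fun y => (expR (- eps * y ^+ 2))%:C * G t x y * F y.

Definition regularized_integral (R : realType) (G : R -> R -> R -> R[i])
    (F : R -> R[i]) (t x eps : R) : R[i] :=
  cintegral setT (regularized_integrand G F t x eps).

(* Meaningful only where the limit exists. *)
Definition wave_function (R : realType) (G : R -> R -> R -> R[i])
    (F : R -> R[i]) : R -> R -> R[i] :=
  fun t x => lim (regularized_integral G F t x eps @[eps --> 0^'+]).

(* Main.v *)
Require Import Defs.
From HB Require Import structures.
From mathcomp Require Import all_boot all_order all_algebra.
From mathcomp Require Import ring lra.
From mathcomp Require Import complex.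
From mathcomp Require Import all_classical all_reals all_analysis.
From mathcomp Require Import measurable_realfun.
Set Implicit Arguments.
Unset Strict Implicit.
Unset Printing Implicit Defensive.
Import Order.TTheory GRing.Theory Num.Theory.
Import numFieldNormedType.Exports.
Local Open Scope classical_set_scope.
Local Open Scope ring_scope.
Local Open Scope complex_scope.

(** The Green function is a quadratic phase [expi (a t * (y - x) ^+ 2)] times an
    amplitude of class [C^n] and of polynomial growth.  Away from the stationary
    point [y = x], an integration by parts against this phase divides the
    amplitude by [2 * a t * (y - x)] up to a unit, at the price of one
    derivative ([tail_estimate]).  Amplitudes of growth [g] with [g < n - 1]
    thus have an absolutely convergent remainder after [n] steps, and the
    bounds do not see the Gaussian cut-off, because all its derivatives are
    bounded by a Gaussian with constants independent of its strength
    ([Cbound_gauss]).  Two cut-offs differ, in the same sense, by a small power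
    of the larger strength ([Cbound_gauss_diff]).  Hence the regularized
    integrals converge, at a rate that is uniform in the phase parameter, in
    [x] and in the amplitude ([osc0_rate]).  The limit is the oscillatory
    integral [osc0].

    Differentiating the integrand yields again the phase times an amplitude,
    whose growth has increased by one for each derivative in [x] and by two for
    a derivative in the phase parameter or in time.  Since
    [alpha + beta + 2 < n - 1], the uniform rate allows to differentiate the
    limit twice in [x] and once in time ([is_cderive_osc0]).  In [x] the
    derivatives are locally bounded, so that [Psi] and its first derivative are
    locally Lipschitz.  In time the phase parameter [a] is only absolutely
    continuous: [Psi] is differentiable where [a] is, hence almost everywhere
    ([is_cderive_osc0_time]), and the increments of [Psi] are bounded by a
    multiple of those of [a] and of time.  Together these facts imply absolute
    continuity; the argument, from Fatou's lemma, is in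
    [dominated_increments].

    For the equation, fix [(t, x)] outside a null set such that the equation of
    the Green function holds at [(t, x, y)] for all rational [y].  Divided by
    the phase it is an equation between amplitudes, which are continuous in
    [y], so it holds for every [y]; multiplying by [F y] and applying [osc0],
    which is linear, gives the equation of [Psi].

    For the initial condition, the part of the integral outside of
    [[- (`|x| + 1), `|x| + 1]] is bounded by the norm of the amplitude over
    [a t] ([osc0_localized]), which tends to [0] by hypothesis, and the part
    inside tends to [F x] because [F] is continuously differentiable. *)

(** * The modulus and limits of complex numbers *)

Section modulus_theory.
Context {R : realType}.
Implicit Types (z w : R[i]) (r : R).

Lemma modulusM z w : modulus (z * w) = modulus z * modulus w.
Proof. exact: complex.ComplexField.Normc.normcM. Qed.

Lemma modulusD z w : modulus (z + w) <= modulus z + modulus w.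
Proof. exact: complex.le_normcD. Qed.

Lemma modulusN z : modulus (- z) = modulus z.
Proof. exact: complex.normcN. Qed.

Lemma modulusB z w : modulus (z - w) <= modulus z + modulus w.
Proof. by rewrite (le_trans (modulusD _ _))// modulusN. Qed.

Lemma modulus_distC z w : modulus (z - w) = modulus (w - z).
Proof. by rewrite -modulusN opprB. Qed.

Lemma modulusE z : modulus z = Num.sqrt (complex.Re z ^+ 2 + complex.Im z ^+ 2).
Proof. by case: z. Qed.

Lemma modulus_ge0 z : 0 <= modulus z.
Proof. by rewrite modulusE sqrtr_ge0. Qed.

Lemma modulus0 : modulus (0 : R[i]) = 0.
Proof. exact: complex.ComplexField.Normc.normc0. Qed.

Lemma modulusV z : modulus z^-1 = (modulus z)^-1.
Proof. exact: complex.ComplexField.Normc.normcV. Qed.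

Lemma modulus_real r : modulus r%:C = `|r|.
Proof. by rewrite modulusE/= expr0n/= addr0 sqrtr_sqr. Qed.

Lemma modulusi : modulus ('i%C : R[i]) = 1.
Proof. by rewrite modulusE/= expr0n/= add0r expr1n sqrtr1. Qed.

Lemma normr_Re z : `|complex.Re z| <= modulus z.
Proof. by rewrite modulusE -sqrtr_sqr ler_sqrt ?lerDl ?sqr_ge0// addr_ge0 ?sqr_ge0. Qed.

Lemma normr_Im z : `|complex.Im z| <= modulus z.
Proof. by rewrite modulusE -sqrtr_sqr ler_sqrt ?lerDr ?sqr_ge0// addr_ge0 ?sqr_ge0. Qed.

Lemma modulus_leD z : modulus z <= `|complex.Re z| + `|complex.Im z|.
Proof.
rewrite modulusE -[leRHS]ger0_norm ?addr_ge0// -sqrtr_sqr ler_sqrt ?sqr_ge0//.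
rewrite sqrrD !real_normK ?num_real//.
have := mulr_ge0 (normr_ge0 (complex.Re z)) (normr_ge0 (complex.Im z)); lra.
Qed.

Lemma modulus_expi r : modulus (expi r) = 1.
Proof. by rewrite modulusE/= cos2Dsin2 sqrtr1. Qed.

Lemma cReB z w : complex.Re (z - w) = complex.Re z - complex.Re w.
Proof. by case: z w => [? ?] [? ?]. Qed.
Lemma cImB z w : complex.Im (z - w) = complex.Im z - complex.Im w.
Proof. by case: z w => [? ?] [? ?]. Qed.
Lemma cReD z w : complex.Re (z + w) = complex.Re z + complex.Re w.
Proof. by case: z w => [? ?] [? ?]. Qed.
Lemma cImD z w : complex.Im (z + w) = complex.Im z + complex.Im w.
Proof. by case: z w => [? ?] [? ?]. Qed.
Lemma cReM z w : complex.Re (z * w) =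
  complex.Re z * complex.Re w - complex.Im z * complex.Im w.
Proof. by case: z w => [? ?] [? ?]. Qed.
Lemma cImM z w : complex.Im (z * w) =
  complex.Re z * complex.Im w + complex.Im z * complex.Re w.
Proof. by case: z w => [? ?] [? ?]. Qed.
Lemma complex_eta z : z = complex.Re z +i* complex.Im z.
Proof. by case: z. Qed.

(** The norm of [R[i]] takes its values in [R[i]] itself; this is the bridge to
    limits, and hence to estimates, in [R]. *)
Lemma cvg_modulus (T : Type) (F : set_system T) (FF : Filter F)
    (f : T -> R[i]) z :
  (f x @[x --> F] --> z) <-> (modulus (f x - z) @[x --> F] --> (0 : R)).
Proof.
split=> h.
- apply/cvgrPdist_lt => e e0.
  move/cvgrPdist_lt : h => /(_ e%:C).
  rewrite ltcR => /(_ e0); apply: filterS => x /=.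
  rewrite complex.normc_def ltcR sub0r normrN ger0_norm ?modulus_ge0//.
  by rewrite modulus_distC modulusE.
- apply/cvgrPdist_lt => -[e e'] /=.
  rewrite ltcE/= => /andP[/eqP-> e0].
  move/cvgrPdist_lt : h => /(_ e e0); apply: filterS => x /=.
  rewrite complex.normc_def ltcR sub0r normrN ger0_norm ?modulus_ge0//.
  by rewrite modulus_distC modulusE.
Qed.

Lemma cvg_complex (T : Type) (F : set_system T) (FF : Filter F)
    (f : T -> R[i]) z :
  (f x @[x --> F] --> z) <->
  (complex.Re (f x) @[x --> F] --> complex.Re z) /\
  (complex.Im (f x) @[x --> F] --> complex.Im z).
Proof.
rewrite cvg_modulus; split.
- move=> h; split; apply/cvgrPdist_lt => e e0;
  move/cvgrPdist_lt : h => /(_ e e0); apply: filterS => x /=;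
  rewrite sub0r normrN ger0_norm ?modulus_ge0// => /(le_lt_trans _); apply.
    by rewrite distrC -cReB normr_Re.
  by rewrite distrC -cImB normr_Im.
- move=> [h1 h2].
  have h : `|complex.Re (f x) - complex.Re z| + `|complex.Im (f x) - complex.Im z|
      @[x --> F] --> (0 : R).
    rewrite -[X in _ --> X](addr0 (0:R)); apply: cvgD; apply/norm_cvg0P;
    by apply/subr_cvg0.
  apply: (squeeze_cvgr _ _ h); last exact: (cvg_cst (0 : R)).
  apply: nearW => x; rewrite modulus_ge0/= (le_trans (modulus_leD _))//.
  by rewrite cReB cImB.
Qed.

End modulus_theory.

(** * Derivatives of complex-valued functions *)

Section cderivative.
Context {R : realType}.
Implicit Types (f g : R -> R[i]) (x y : R) (l m : R[i]).

Definition is_cderive f x l : Prop :=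
  is_derive x 1 (fun y => complex.Re (f y)) (complex.Re l) /\
  is_derive x 1 (fun y => complex.Im (f y)) (complex.Im l).

Definition ccontinuous_at f x : Prop :=
  {for x, continuous (fun y => complex.Re (f y))} /\
  {for x, continuous (fun y => complex.Im (f y))}.

Lemma is_derive_quotient (f : R -> R) x (l : R) :
  is_derive x 1 f l <-> ((f z - f x) / (z - x) @[z --> x^'] --> l).
Proof.
split.
- move=> /is_derive1_caratheodory[g [fE /continuous_withinNx cg <-]].
  apply: cvg_trans cg; apply: near_eq_cvg; near=> z.
  rewrite fE mulfK// subr_eq0.
  by near: z; exact: nbhs_dnbhs_neq.
- move=> h; apply/is_derive1_caratheodory.
  exists (fun z => if z == x then l else (f z - f x) / (z - x)); split.
  + move=> z; case: eqP => [->|/eqP]; first by rewrite !subrr mulr0.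
    by rewrite -subr_eq0 => /divfK->.
  + apply/continuous_withinNx; rewrite eqxx; apply: cvg_trans h.
    apply: near_eq_cvg; near=> z; rewrite ifN//.
    by near: z; exact: nbhs_dnbhs_neq.
  + by rewrite eqxx.
Unshelve. all: by end_near. Qed.

Lemma Re_divr (z : R[i]) (r : R) : complex.Re (z / r%:C) = complex.Re z / r.
Proof.
by rewrite -(fmorphV (real_complex R)) cReM/= mulr0 subr0.
Qed.

Lemma Im_divr (z : R[i]) (r : R) : complex.Im (z / r%:C) = complex.Im z / r.
Proof.
by rewrite -(fmorphV (real_complex R)) cImM/= mulr0 add0r.
Qed.

Lemma is_cderive_quotient f x l :
  is_cderive f x l <-> (difference_quotient f x z @[z --> x^'] --> l).
Proof.
rewrite cvg_complex /is_cderive !is_derive_quotient.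
have eRe z : complex.Re (difference_quotient f x z) =
    (complex.Re (f z) - complex.Re (f x)) / (z - x).
  by rewrite Re_divr cReB.
have eIm z : complex.Im (difference_quotient f x z) =
    (complex.Im (f z) - complex.Im (f x)) / (z - x).
  by rewrite Im_divr cImB.
by under [X in _ <-> (X @ _ --> _) /\ _]eq_fun do rewrite eRe;
   under [X in _ <-> _ /\ (X @ _ --> _)]eq_fun do rewrite eIm.
Qed.

Lemma is_cderiveP f x l :
  is_cderive f x l <-> cderivable f x /\ cderive f x = l.
Proof.
rewrite is_cderive_quotient; split.
  move=> h; split; first by apply/cvg_ex; exists l.
  exact: cvg_lim.
by move=> [h <-].
Qed.

Lemma is_cderive_continuous f x l : is_cderive f x l -> ccontinuous_at f x.
Proof.
by move=> [[h1 _] [h2 _]]; split; apply: differentiable_continuous;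
  apply/derivable1_diffP.
Qed.

Lemma is_derive_near (f g : R -> R) x (l : R) :
  (\forall y \near x, f y = g y) -> is_derive x 1 f l -> is_derive x 1 g l.
Proof. exact: near_eq_is_derive. Qed.

Lemma is_cderive_near f g x l :
  (\forall y \near x, f y = g y) -> is_cderive f x l -> is_cderive g x l.
Proof.
by move=> h [h1 h2]; split; [apply: is_derive_near h1|apply: is_derive_near h2];
  apply: filterS h => y ->.
Qed.

Lemma is_cderive_cst l x : is_cderive (fun=> l) x 0.
Proof. by split; exact: is_derive_cst. Qed.

Lemma is_cderive_real (f : R -> R) x (l : R) :
  is_derive x 1 f l -> is_cderive (fun y => (f y)%:C) x l%:C.
Proof. by move=> h; split => //=; exact: is_derive_cst. Qed.

Lemma is_cderiveD f g x l m : is_cderive f x l -> is_cderive g x m ->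
  is_cderive (fun y => f y + g y) x (l + m).
Proof.
move=> [h1 h2] [k1 k2]; rewrite /is_cderive cReD cImD.
under eq_fun do rewrite cReD; under [X in _ /\ is_derive _ _ X _]eq_fun do rewrite cImD.
by split; apply: is_deriveD.
Qed.

Lemma is_cderiveM f g x l m : is_cderive f x l -> is_cderive g x m ->
  is_cderive (fun y => f y * g y) x (l * g x + f x * m).
Proof.
move=> [h1 h2] [k1 k2]; rewrite /is_cderive !cReD !cImD !cReM !cImM.
under eq_fun do rewrite cReM; under [X in _ /\ is_derive _ _ X _]eq_fun do rewrite cImM.
split.
  apply: (is_derive_eq (is_deriveB (is_deriveM h1 k1) (is_deriveM h2 k2))).
  by rewrite /= /GRing.scale/=; ring.
apply: (is_derive_eq (is_deriveD (is_deriveM h1 k2) (is_deriveM h2 k1))).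
by rewrite /= /GRing.scale/=; ring.
Qed.

Lemma is_cderiveZ (c : R[i]) f x l : is_cderive f x l ->
  is_cderive (fun y => c * f y) x (c * l).
Proof.
by move=> /(is_cderiveM (is_cderive_cst c x)); rewrite mul0r add0r.
Qed.

Lemma is_cderiveB f g x l m : is_cderive f x l -> is_cderive g x m ->
  is_cderive (fun y => f y - g y) x (l - m).
Proof.
move=> hf /(is_cderiveZ (-1)) hg.
have := is_cderiveD hf hg; rewrite mulN1r.
by under eq_fun do rewrite mulN1r.
Qed.

Lemma is_cderive_comp f (g : R -> R) x l (d : R) :
  is_cderive f (g x) l -> is_derive x 1 g d ->
  is_cderive (fun y => f (g y)) x (l * d%:C).
Proof.
move=> [h1 h2] hg; rewrite /is_cderive cReM cImM/= !mulr0 subr0 add0r.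
by split; [exact: (is_derive1_comp h1 hg)|exact: (is_derive1_comp h2 hg)].
Qed.

Lemma is_cderive_expi x : is_cderive (@expi R) x ('i%C * expi x).
Proof.
rewrite /is_cderive cReM cImM/= !mul0r !mul1r sub0r add0r; split => /=.
  exact: is_derive_cos.
exact: is_derive_sin.
Qed.

Lemma ccontinuous_atM f g x : ccontinuous_at f x -> ccontinuous_at g x ->
  ccontinuous_at (fun y => f y * g y) x.
Proof.
move=> [h1 h2] [k1 k2]; split.
  rewrite (_ : (fun y => _) = fun y => complex.Re (f y) * complex.Re (g y) -
    complex.Im (f y) * complex.Im (g y)); last by apply/funext => y; rewrite cReM.
  by apply: cvgB; apply: cvgM.
rewrite (_ : (fun y => _) = fun y => complex.Re (f y) * complex.Im (g y) +
  complex.Im (f y) * complex.Re (g y)); last by apply/funext => y; rewrite cImM.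
by apply: cvgD; apply: cvgM.
Qed.

Lemma ccontinuous_atD f g x : ccontinuous_at f x -> ccontinuous_at g x ->
  ccontinuous_at (fun y => f y + g y) x.
Proof.
move=> [h1 h2] [k1 k2]; split.
  rewrite (_ : (fun y => _) = fun y => complex.Re (f y) + complex.Re (g y));
    last by apply/funext => y; rewrite cReD.
  exact: cvgD.
rewrite (_ : (fun y => _) = fun y => complex.Im (f y) + complex.Im (g y));
  last by apply/funext => y; rewrite cImD.
exact: cvgD.
Qed.

Lemma ccontinuous_atP f x : ccontinuous_at f x <-> (f y @[y --> x] --> f x).
Proof. by rewrite cvg_complex. Qed.

End cderivative.

(** * Weighted classes of differentiable functions *)

Section differentiability_class.
Context {R : realType}.
Implicit Types (D : set R) (w : R -> R) (f g : R -> R[i]).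

(** [f] has [m] derivatives on [D], and they are bounded by [w] together with
    [f].  The derivatives are existentially quantified, so that explicit
    formulas can serve as witnesses, and two-sided, so that [D] may be a closed
    set. *)
Fixpoint Cbound D (m : nat) w f : Prop :=
  (forall y, D y -> ccontinuous_at f y /\ modulus (f y) <= w y) /\
  match m with
  | 0%N => True
  | m'.+1 => exists f' : R -> R[i],
      (forall y, D y -> is_cderive f y (f' y)) /\ Cbound D m' w f'
  end.

Lemma Cbound_bound D m w f : Cbound D m w f ->
  forall y, D y -> modulus (f y) <= w y.
Proof. by case: m => [|m] [h _] y /h[]. Qed.

Lemma Cbound_continuous D m w f : Cbound D m w f ->
  forall y, D y -> ccontinuous_at f y.
Proof. by case: m => [|m] [h _] y /h[]. Qed.

Lemma Cbound_subset D D' m w w' f : D' `<=` D ->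
  (forall y, D' y -> w y <= w' y) -> Cbound D m w f -> Cbound D' m w' f.
Proof.
move=> DD ww; elim: m f => [|m ih] f [h1 h2]; split.
- move=> y D'y; have [h3 h4] := h1 y (DD y D'y).
  by split=> //; rewrite (le_trans h4)// ww.
- by [].
- move=> y D'y; have [h3 h4] := h1 y (DD y D'y).
  by split=> //; rewrite (le_trans h4)// ww.
- by case: h2 => f' [h2 h3]; exists f'; split; [move=> y /DD/h2|exact: ih].
Qed.

Lemma Cbound_le D m w w' f : (forall y, D y -> w y <= w' y) ->
  Cbound D m w f -> Cbound D m w' f.
Proof. exact: Cbound_subset. Qed.

Lemma CboundS D m w f : Cbound D m.+1 w f -> Cbound D m w f.
Proof.
elim: m f => [|m ih] f [h1 [f' [h2 h3]]]; split => //.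
by exists f'; split => //; exact: ih.
Qed.

Lemma CboundD D m w1 w2 f g : Cbound D m w1 f -> Cbound D m w2 g ->
  Cbound D m (fun y => w1 y + w2 y) (fun y => f y + g y).
Proof.
elim: m f g => [|m ih] f g [f1 f2] [g1 g2]; split => //.
- move=> y Dy; have [? ?] := f1 y Dy; have [? ?] := g1 y Dy; split.
    exact: ccontinuous_atD.
  by rewrite (le_trans (modulusD _ _))// lerD.
- move=> y Dy; have [? ?] := f1 y Dy; have [? ?] := g1 y Dy; split.
    exact: ccontinuous_atD.
  by rewrite (le_trans (modulusD _ _))// lerD.
- have [f' [f3 f4]] := f2; have [g' [g3 g4]] := g2.
  exists (fun y => f' y + g' y); split; last exact: ih.
  by move=> y Dy; apply: is_cderiveD; [exact: f3|exact: g3].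
Qed.

(** The factor [2 ^+ m] is the sum of the coefficients in Leibniz' formula. *)
Lemma CboundM D m w1 w2 f g : Cbound D m w1 f -> Cbound D m w2 g ->
  Cbound D m (fun y => 2 ^+ m * (w1 y * w2 y)) (fun y => f y * g y).
Proof.
elim: m f g => [|m ih] f g.
  move=> [f1 f2] [g1 g2]; split => // y Dy.
  have [? ?] := f1 y Dy; have [? ?] := g1 y Dy; split.
    exact: ccontinuous_atM.
  by rewrite modulusM expr0 mul1r ler_pM// modulus_ge0.
move=> hf hg; split.
  move=> y Dy; split.
    apply: ccontinuous_atM; first exact: Cbound_continuous hf _ Dy.
    exact: Cbound_continuous hg _ Dy.
  have fw := Cbound_bound hf Dy; have gw := Cbound_bound hg Dy.
  rewrite modulusM (@le_trans _ _ (w1 y * w2 y))//.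
    by rewrite ler_pM// modulus_ge0.
  rewrite ler_peMl ?mulr_ge0 ?(le_trans (modulus_ge0 _) fw)//.
    by rewrite (le_trans (modulus_ge0 _) gw).
  by rewrite exprn_ege1// ler1n.
have [_ [f' [f3 f4]]] := hf; have [_ [g' [g3 g4]]] := hg.
exists (fun y => f' y * g y + f y * g' y); split.
  by move=> y Dy; apply: is_cderiveM; [exact: f3|exact: g3].
apply: Cbound_le (CboundD (ih _ _ f4 (CboundS hg)) (ih _ _ (CboundS hf) g4)).
by move=> y _; rewrite exprS -mulrA mulr2n mulrDl mul1r.
Qed.

Lemma Cbound_cst D m (c : R[i]) : Cbound D m (fun=> modulus c) (fun=> c).
Proof.
elim: m c => [|m ih] c; split => //.
- by move=> y _; split => //; split; exact: cvg_cst.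
- by move=> y _; split => //; split; exact: cvg_cst.
- exists (fun=> 0); split; first by move=> y _; exact: is_cderive_cst.
  by apply: Cbound_le (ih 0) => y _; rewrite modulus0 modulus_ge0.
Qed.

Lemma CboundZ D m w f (c : R[i]) : Cbound D m w f ->
  Cbound D m (fun y => modulus c * w y) (fun y => c * f y).
Proof.
elim: m f => [|m ih] f hf; split => //.
- move=> y Dy; split.
    apply: ccontinuous_atM; last exact: Cbound_continuous hf _ Dy.
    by split; exact: cvg_cst.
  by rewrite modulusM ler_wpM2l ?modulus_ge0// (Cbound_bound hf Dy).
- move=> y Dy; split.
    apply: ccontinuous_atM; last exact: Cbound_continuous hf _ Dy.
    by split; exact: cvg_cst.
  by rewrite modulusM ler_wpM2l ?modulus_ge0// (Cbound_bound hf Dy).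
- have [_ [f' [f3 f4]]] := hf; exists (fun y => c * f' y); split; last exact: ih.
  by move=> y Dy; apply: is_cderiveZ; exact: f3.
Qed.

Lemma Cbound_cderiven n (a M : R) f : Cn n f ->
  (forall k y, (k <= n)%N -> modulus (cderiven k f y) <= M * weight y `^ a) ->
  Cbound setT n (fun y => M * weight y `^ a) f.
Proof.
move=> [dn cn] bn.
suff h m k : (k + m = n)%N ->
    Cbound setT m (fun y => M * weight y `^ a) (cderiven k f) by exact: (h n 0%N).
elim: m k => [|m ih] k kmn; split => //.
- move=> y _; split; last by apply: bn; rewrite -kmn leq_addr.
  by apply/ccontinuous_atP; move: kmn; rewrite addn0 => ->; exact: cn.
- move=> y _; split; last by apply: bn; rewrite -kmn leq_addr.
  have /dn h : (k < n)%N by rewrite -kmn -addSnnS leq_addr.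
  by apply: (@is_cderive_continuous _ _ _ (cderive (cderiven k f) y));
    exact/is_cderiveP.
- exists (cderiven k.+1 f); split; last by apply: ih; rewrite addSnnS.
  move=> y _; apply/is_cderiveP; split => //.
  by apply: dn; rewrite -kmn -addSnnS leq_addr.
Qed.

Lemma weight_ge1 (y : R) : 1 <= weight y.
Proof. by rewrite lerDl. Qed.

Lemma weight_gt0 (y : R) : 0 < weight y.
Proof. by rewrite (lt_le_trans ltr01)// weight_ge1. Qed.

Lemma Cn_norm_bound n (a : R) f : Cn_weighted n a f ->
  forall k y, (k <= n)%N ->
    modulus (cderiven k f y) <= Cn_norm n a f * weight y `^ a.
Proof.
move=> [_ [M [M0 hM]]] k y kn.
have w0 z : 0 < weight z `^ a by rewrite powR_gt0// weight_gt0.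
rewrite -ler_pdivrMr//.
rewrite /Cn_norm.
pose F := fun k : 'I_n.+1 =>
    sup [set modulus (cderiven k f y) / weight y `^ a | y in [set: R]].
apply: (@le_trans _ _ (F (inord k))); last exact: le_bigmax.
apply: ub_le_sup; last by exists y => //; rewrite inordK.
exists M => _ [z _ <-]; rewrite ler_pdivrMr//.
by rewrite hM// inordK.
Qed.

Lemma Cn_norm_ge0 n (a : R) f : 0 <= Cn_norm n a f.
Proof. exact: bigmax_ge_id. Qed.

Lemma Cbound_Cn_norm n (a : R) f : Cn_weighted n a f ->
  Cbound setT n (fun y => Cn_norm n a f * weight y `^ a) f.
Proof.
by move=> h; apply: Cbound_cderiven; [case: h|exact: Cn_norm_bound].
Qed.

End differentiability_class.

(** * Polynomial and Gaussian weights *)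

Section weights.
Context {R : realType}.
Notation mu := (@lebesgue_measure R).
Implicit Types (g eta y : R).

(** The two exponents add up under products.  The polynomial one is consumed by
    integrations by parts; the Gaussian one only serves to make integrals
    converge, and the estimates of oscillatory integrals do not depend on it. *)
Definition wt g eta y : R := weight y `^ g * expR (- eta * y ^+ 2).

Lemma wt_gt0 g eta y : 0 < wt g eta y.
Proof. by rewrite mulr_gt0 ?expR_gt0// powR_gt0// weight_gt0. Qed.

Lemma wt_ge0 g eta y : 0 <= wt g eta y. Proof. exact/ltW/wt_gt0. Qed.

Lemma wtM g1 g2 e1 e2 y :
  wt g1 e1 y * wt g2 e2 y = wt (g1 + g2) (e1 + e2) y.
Proof.
rewrite /wt powRD ?(gt_eqF (weight_gt0 _)) ?implybT//.
by rewrite opprD mulrDl expRD; ring.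
Qed.

Lemma wt0r g y : wt g 0 y = weight y `^ g.
Proof. by rewrite /wt oppr0 mul0r expR0 mulr1. Qed.

Lemma wt_le g1 g2 e1 e2 y : g1 <= g2 -> e2 <= e1 -> wt g1 e1 y <= wt g2 e2 y.
Proof.
move=> g12 e12; rewrite ler_pM ?powR_ge0 ?expR_ge0//.
  by rewrite ler_powR// weight_ge1.
by rewrite ler_expR ler_wpM2r ?sqr_ge0// lerN2.
Qed.

Lemma weight_continuous : continuous (@weight R).
Proof.
move=> y; apply: cvgD; first exact: cvg_cst.
exact: (@norm_continuous _ R).
Qed.

Lemma measurable_wt g eta (D : set R) : measurable_fun D (wt g eta).
Proof.
apply: (@measurable_funS _ _ _ _ setT) => //; apply: measurable_funM.
  apply: (measurableT_comp (measurable_powR g)).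
  by apply: continuous_measurable_fun; exact: weight_continuous.
apply: measurableT_comp => //; apply: measurable_funM => //.
Qed.

Lemma powR_cvgy_neg (p : R) : 0 < p -> x `^ (- p) @[x --> +oo] --> (0 : R).
Proof.
move=> p0; apply/cvgrPdist_le => e e0; near=> x.
rewrite sub0r normrN ger0_norm ?powR_ge0// powRN.
have x0 : 0 < x by near: x; exact: nbhs_pinfty_gt.
have h : (e^-1) `^ p^-1 <= x by near: x; exact: nbhs_pinfty_ge.
rewrite -[leRHS]invrK lef_pV2 ?posrE ?invr_gt0 ?powR_gt0//.
have -> : e^-1 = (e^-1 `^ p^-1) `^ p.
  by rewrite -powRrM mulVf ?gt_eqF// powRr1// invr_ge0 ltW.
by apply: ge0_ler_powR => //; rewrite ?nnegrE ?powR_ge0 ?ltW.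
Unshelve. all: by end_near. Qed.

Lemma integrable_weight g : g < -1 -> mu.-integrable setT (EFin \o wt g 0).
Proof.
move=> g1.
have eE : EFin \o wt g 0 = fun y => (weight y `^ g)%:E.
  by apply/funext => y /=; rewrite wt0r.
apply/integrableP; split; first by apply/measurable_EFinP; exact: measurable_wt.
have -> : (\int[mu]_x `|(EFin \o wt g 0) x| = \int[mu]_x (weight x `^ g)%:E)%E.
  by apply: eq_integral => y _; rewrite /= wt0r ger0_norm// powR_ge0.
have cw : continuous (fun y : R => weight y `^ g).
  move=> y.
  have cp : {for weight (y : R), continuous (fun u : R => u `^ g)}.
    apply: differentiable_continuous; apply/derivable1_diffP.
    by apply: derivable_powR; rewrite in_itv/= andbT weight_gt0.
  exact: (cvg_comp (@weight R) (fun u : R => u `^ g) (@weight_continuous y) cp).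
rewrite ge0_symfun_integralT; last 3 first.
- by move=> y; rewrite powR_ge0.
- exact: cw.
- by move=> y; rewrite /= /weight normrN.
rewrite -set_itvcy.
pose F y : R := (g + 1)^-1 * (1 + y) `^ (g + 1).
have dF y : 0 <= y -> is_derive y 1 F ((1 + y) `^ g).
  move=> y0; have y1 : 0 < 1 + y by rewrite (lt_le_trans ltr01)// lerDl.
  have h1 : is_derive (1 + y) 1 (fun u : R => u `^ (g + 1)) ((g + 1) * (1 + y) `^ (g + 1 - 1)).
    exact: is_derive1_powR.
  have h2 : is_derive y 1 (fun y : R => 1 + y) 1.
    by apply: (is_derive_eq (is_deriveD (is_derive_cst (1 : R) y 1)
      (is_derive_id y 1))); rewrite add0r.
  apply: (is_derive_eq (is_deriveZ (g + 1)^-1 (is_derive1_comp h1 h2))).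
  rewrite /GRing.scale/= mulr1 addrK mulrA mulVf ?mul1r// lt_eqF//; lra.
rewrite (@ge0_continuous_FTC2y _ (fun y => weight y `^ g) F 0 0).
- by rewrite -EFinB -EFinM ltry.
- by move=> x _; rewrite powR_ge0.
- exact: continuous_subspaceT.
- have p0 : 0 < - (g + 1) by lra.
  have := powR_cvgy_neg p0; rewrite opprK => h.
  have h1 : 1 + x @[x --> +oo] --> (+oo : set_system R).
    apply/cvgryPge => A; near=> y.
    rewrite addrC -lerBlDr; near: y. apply: nbhs_pinfty_ge; exact: num_real.
  have h2 := cvg_comp (fun y : R => 1 + y) (fun y : R => y `^ (g + 1)) h1 h.
  by have := cvgM (cvg_cst (g + 1)^-1) h2; rewrite mulr0; apply.
- by move=> x x0; have [] := dF x (ltW x0).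
- apply: cvg_at_right_filter.
  apply: differentiable_continuous; apply/derivable1_diffP.
  by have [] := dF 0 (lexx 0).
- move=> x; rewrite in_itv/= andbT => x0.
  have [h1 h2] := dF x (ltW x0).
  by rewrite derive1E h2 /weight ger0_norm// ltW.
Unshelve. all: by end_near. Qed.

Lemma wt_gauss_bounded g eta : 0 < eta -> exists2 C : R, 0 <= C &
  forall y, wt g eta y <= C.
Proof.
move=> eta0.
(* one Taylor term of the exponential, of large order, beats the weight *)
have [N gN] : exists N : nat, g <= (N.+1)%:R * 2.
  exists (Num.truncn `|g|); rewrite (le_trans (ler_norm _))//.
  have := truncnS_gt `|g|.
  move=> /ltW /le_trans; apply; rewrite ler_peMr//; lra.
exists (2 ^+ (2 * N.+1) * (1 + eta^-1 ^+ N.+1 * (N.+1)`!%:R)).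
  by rewrite mulr_ge0// ?exprn_ge0// addr_ge0// mulr_ge0// exprn_ge0// invr_ge0 ltW.
move=> y.
have wge := weight_ge1 y.
rewrite (le_trans (wt_le y gN (lexx _)))//.
rewrite /wt -natrM powR_mulrn ?(ltW (weight_gt0 y))// mulNr expRN.
rewrite ler_pdivrMr ?expR_gt0//.
have eX := expR_ge1Dxn N (mulr_ge0 (ltW eta0) (sqr_ge0 y)).
have hb : weight y ^+ (N.+1 * 2) <= 2 ^+ (2 * N.+1) * (1 + (y ^+ 2) ^+ N.+1).
  rewrite mulnC /weight; have [y1|y1] := lerP `|y| 1.
    rewrite (@le_trans _ _ (2 ^+ (2 * N.+1)))//.
      by rewrite lerXn2r ?nnegrE ?addr_ge0//; lra.
    by rewrite ler_peMr ?exprn_ge0// lerDl exprn_ge0// sqr_ge0.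
  rewrite (@le_trans _ _ ((2 * `|y|) ^+ (2 * N.+1)))//.
    by rewrite lerXn2r ?nnegrE ?addr_ge0 ?mulr_ge0//; lra.
  rewrite exprMn ler_wpM2l ?exprn_ge0// exprM real_normK ?num_real//.
  by rewrite lerDr.
apply: (le_trans hb); rewrite -mulrA ler_wpM2l ?exprn_ge0//.
have X0 : 0 <= (y ^+ 2) ^+ N.+1 by rewrite exprn_ge0 ?sqr_ge0.
have E1 : 1 <= expR (eta * y ^+ 2).
  by rewrite (le_trans _ eX)// lerDl divr_ge0// exprn_ge0// mulr_ge0 ?sqr_ge0 ?ltW.
rewrite mulrDl mul1r lerD//.
rewrite -ler_pdivrMl; last first.
  by rewrite mulr_gt0 ?exprn_gt0 ?invr_gt0// ltr0n fact_gt0.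
rewrite (le_trans _ eX)// invfM [(eta^-1) ^+ _]exprVn invrK [(eta * _) ^+ _]exprMn.
by rewrite mulrAC lerDr.
Qed.

Lemma wt_gauss_le_sqr g eta : 0 < eta -> exists2 C : R, 0 <= C &
  forall y, wt g eta y <= C * wt (-2) 0 y.
Proof.
move=> /(wt_gauss_bounded (g + 2))[C C0 h]; exists C => // y.
rewrite -(ler_pdivrMr _ _ (wt_gt0 _ _ _)).
rewrite (le_trans _ (h y))//.
have -> : (wt (-2) 0 y)^-1 = wt 2 0 y.
  by rewrite !wt0r powRN invrK.
by rewrite wtM addr0.
Qed.

Lemma integrable_wt g eta : 0 < eta -> mu.-integrable setT (EFin \o wt g eta).
Proof.
move=> /(wt_gauss_le_sqr g)[C C0 h].
have := @integrable_weight (-2); rewrite ltrN2 ltr1n => /(_ isT) h2.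
have := integrableZl measurableT C h2.
apply: le_integrable => //; first by apply/measurable_EFinP; exact: measurable_wt.
move=> y _ /=; rewrite lee_fin ger0_norm ?wt_ge0// (le_trans (h y))//.
by rewrite ler_norm.
Qed.

Lemma wt_cvg0 g eta : 0 < eta -> wt g eta k%:R @[k --> \oo] --> (0 : R) /\
  wt g eta (- k%:R) @[k --> \oo] --> (0 : R).
Proof.
move=> /(wt_gauss_le_sqr g)[C C0 h].
have wE (k : nat) : wt (-2) 0 (- k%:R) = wt (-2) 0 k%:R.
  by rewrite !wt0r /weight normrN.
have h1 : (k%:R + 1)^-1 @[k --> \oo] --> (0 : R).
  have := @cvg_harmonic R; apply: cvg_trans.
  by apply: near_eq_cvg; apply: nearW => k /=; rewrite natr1.
have h2 (k : nat) : wt (-2) 0 k%:R <= (k%:R + 1)^-1 :> R.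
  rewrite wt0r /weight ger0_norm// powRN powR_mulrn; last by rewrite addr_ge0.
  have k0 : 0 <= k%:R :> R by [].
  rewrite lef_pV2 ?posrE ?exprn_gt0//; try lra.
  rewrite expr2 addrC ler_peMr//; lra.
have h3 : C * (k%:R + 1)^-1 @[k --> \oo] --> (0 : R).
  by have := cvgM (cvg_cst C) h1; rewrite mulr0; apply.
split; apply: (squeeze_cvgr _ (cvg_cst (0 : R)) h3); apply: nearW => k;
  rewrite wt_ge0/= (le_trans (h _))// ?wE ler_wpM2l//.
Qed.

Lemma wt0_le_gauss g (c : R) y : `|y| <= c -> wt g 0 y <= expR (c ^+ 2) * wt g 1 y.
Proof.
move=> yc; rewrite /wt oppr0 mul0r expR0 mulr1 mulrCA ler_peMr ?powR_ge0//.
rewrite -expRD -[leLHS]expR0 ler_expR mulN1r subr_ge0.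
rewrite -[y ^+ 2]real_normK ?num_real//.
by rewrite lerXn2r ?nnegrE ?normr_ge0// (le_trans _ yc).
Qed.

End weights.

(** * Integrals of complex-valued functions *)

Section complex_integrals.
Context {R : realType}.
Notation mu := (@lebesgue_measure R).
Implicit Types (D : set R) (f h : R -> R[i]) (g : R -> R).

Definition cmeasurable D f : Prop :=
  measurable_fun D (fun y => complex.Re (f y)) /\
  measurable_fun D (fun y => complex.Im (f y)).

Lemma ccontinuous_measurable D f : measurable D ->
  (forall y, D y -> ccontinuous_at f y) -> cmeasurable D f.
Proof.
move=> mD cf; split; apply: subspace_continuous_measurable_fun => //;
  apply: continuous_in_subspaceT => y /set_mem /cf[]; done.
Qed.

Lemma cintegrable_le D f g : measurable D -> cmeasurable D f ->
  mu.-integrable D (EFin \o g) ->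
  (forall y, D y -> modulus (f y) <= g y) -> cintegrable D f.
Proof.
move=> mD [m1 m2] ig fg; split; apply: (le_integrable _ _ _ ig) => //.
- exact/measurable_EFinP.
- move=> y Dy /=; rewrite lee_fin (le_trans (normr_Re _))//.
  by rewrite (le_trans (fg y Dy))// ler_norm.
- exact/measurable_EFinP.
- move=> y Dy /=; rewrite lee_fin (le_trans (normr_Im _))//.
  by rewrite (le_trans (fg y Dy))// ler_norm.
Qed.

(** The factor [2] comes from estimating real and imaginary parts separately. *)
Lemma modulus_cintegral_le D f g : measurable D -> cintegrable D f ->
  mu.-integrable D (EFin \o g) ->
  (forall y, D y -> modulus (f y) <= g y) ->
  modulus (cintegral D f) <= 2 * \int[mu]_(y in D) g y.
Proof.
move=> mD [i1 i2] ig fg; rewrite (le_trans (modulus_leD _))//.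
rewrite mulr_natl mulr2n lerD//.
- rewrite (le_trans (le_normr_Rintegral _ i1))// le_Rintegral//.
    exact: integrable_norm.
  by move=> y Dy; rewrite (le_trans (normr_Re _))// fg.
- rewrite (le_trans (le_normr_Rintegral _ i2))// le_Rintegral//.
    exact: integrable_norm.
  by move=> y Dy; rewrite (le_trans (normr_Im _))// fg.
Qed.

Lemma cintegrableS D D' f : measurable D -> measurable D' -> D' `<=` D ->
  cintegrable D f -> cintegrable D' f.
Proof. by move=> mD mD' DD [i1 i2]; split; [apply: integrableS i1|apply: integrableS i2]. Qed.

Lemma cintegrableD D f h : measurable D -> cintegrable D f ->
  cintegrable D h -> cintegrable D (fun y => f y + h y).
Proof.
move=> mD [f1 f2] [h1 h2]; split.
  by apply: eq_integrable (integrableD _ f1 h1) => // y _ /=; rewrite cReD.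
by apply: eq_integrable (integrableD _ f2 h2) => // y _ /=; rewrite cImD.
Qed.

Lemma cintegrableZ D (c : R[i]) f : measurable D -> cintegrable D f ->
  cintegrable D (fun y => c * f y).
Proof.
move=> mD [f1 f2]; split.
  apply: eq_integrable (integrableB _ (integrableZl _ (complex.Re c) f1)
    (integrableZl _ (complex.Im c) f2)) => // y _ /=.
  by rewrite cReM -!EFinM -EFinB.
apply: eq_integrable (integrableD _ (integrableZl _ (complex.Re c) f2)
    (integrableZl _ (complex.Im c) f1)) => // y _ /=.
by rewrite cImM -!EFinM -EFinD.
Qed.

Lemma cintegralD D f h : measurable D -> cintegrable D f ->
  cintegrable D h ->
  cintegral D (fun y => f y + h y) = cintegral D f + cintegral D h.
Proof.
move=> mD [f1 f2] [h1 h2]; rewrite /cintegral.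
apply/eqP; rewrite eq_complex /= -!RintegralD//.
by apply/andP; split; apply/eqP; apply: eq_Rintegral => y _; rewrite ?cReD ?cImD.
Qed.

Lemma integrable_cmul D g (r : R) : measurable D -> mu.-integrable D (EFin \o g) ->
  mu.-integrable D (fun y => (r * g y)%:E).
Proof.
move=> mD h; apply: eq_integrable (integrableZl _ r h) => // y _.
Qed.

Lemma cintegralZ D (c : R[i]) f : measurable D -> cintegrable D f ->
  cintegral D (fun y => c * f y) = c * cintegral D f.
Proof.
move=> mD [f1 f2]; rewrite [RHS]complex_eta cReM cImM /cintegral /=.
rewrite -!RintegralZl// -RintegralB -?RintegralD//; try exact: integrable_cmul.
by congr (_ +i* _); apply: eq_Rintegral => y _; rewrite ?cReM ?cImM.
Qed.

Lemma cintegralB D f h : measurable D -> cintegrable D f ->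
  cintegrable D h ->
  cintegral D (fun y => f y - h y) = cintegral D f - cintegral D h.
Proof.
move=> mD f1 h1; rewrite -mulN1r -cintegralZ// -cintegralD//; last first.
  exact: cintegrableZ.
by congr cintegral; apply/funext => y; rewrite mulN1r.
Qed.

Lemma cintegral_setU D1 D2 f : measurable D1 -> measurable D2 ->
  [disjoint D1 & D2] -> cintegrable (D1 `|` D2) f ->
  cintegral (D1 `|` D2) f = cintegral D1 f + cintegral D2 f.
Proof.
move=> m1 m2 d [f1 f2]; rewrite /cintegral.
by apply/eqP; rewrite eq_complex /= !Rintegral_setU// !eqxx.
Qed.

Lemma is_cderive_cintegral (U V : R -> R -> R[i]) (u v a : R) g :
  u < a < v ->
  (forall p, u < p < v -> cintegrable setT (U p)) ->
  (forall p y, u < p < v -> is_cderive (U ^~ y) p (V p y)) ->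
  mu.-integrable setT (EFin \o g) ->
  (forall p y, u < p < v -> modulus (V p y) <= g y) ->
  is_cderive (fun p => cintegral setT (U p)) a (cintegral setT (V a)).
Proof.
move=> uav iU dU ig gV.
have main (W W' : R -> R -> R) :
    (forall p, u < p < v -> mu.-integrable setT (EFin \o W p)) ->
    (forall p y, u < p < v -> is_derive p 1 (W ^~ y) (W' p y)) ->
    (forall p y, u < p < v -> `|W' p y| <= g y) ->
    is_derive a 1 (fun p => \int[mu]_(y in setT) W p y)
                  (\int[mu]_(y in setT) W' a y).
  move=> iW dW gW.
  have d1W p y : u < p < v -> partial1of2 W p y = W' p y.
    by move=> /(dW p y)[_ h]; rewrite partial1of2E.
  have Ia : (`]u, v[%classic : set R) a by rewrite /= in_itv/= uav.
  have i' : forall p, (`]u, v[%classic : set R) p ->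
      mu.-integrable setT (EFin \o W p).
    by move=> p; rewrite /= in_itv/=; exact: iW.
  have d' : forall p y, (`]u, v[%classic : set R) p -> [set: R] y ->
      derivable (W ^~ y) p 1.
    by move=> p y; rewrite /= in_itv/= => /(dW p y)[].
  have g0 y : 0 <= g y by rewrite (le_trans _ (gW a y uav)).
  have b' : forall p y, (`]u, v[%classic : set R) p -> [set: R] y ->
      `|partial1of2 W p y| <= g y.
    by move=> p y; rewrite /= in_itv/= => uv _; rewrite d1W// gW.
  apply: DeriveDef.
    exact: (derivable_under_integral measurableT Ia i' d' g0 ig b').
  rewrite -derive1E.
  rewrite (differentiation_under_integral measurableT Ia i' d' g0 ig b').
  by apply: eq_Rintegral => y _; rewrite d1W.
split.
  apply: (main (fun p y => complex.Re (U p y)) (fun p y => complex.Re (V p y))).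
  - by move=> p /iU[].
  - by move=> p y /(dU p y)[].
  - by move=> p y /(gV p y); apply: le_trans; exact: normr_Re.
apply: (main (fun p y => complex.Im (U p y)) (fun p y => complex.Im (V p y))).
- by move=> p /iU[].
- by move=> p y /(dU p y)[].
- by move=> p y /(gV p y); apply: le_trans; exact: normr_Im.
Qed.

End complex_integrals.

(** * The fundamental theorem of calculus on a neighbourhood of infinity *)

Section tails.
Context {R : realType}.
Notation mu := (@lebesgue_measure R).

Definition tail (c : R) : set R := [set y | c <= `|y|].

Lemma tailE (c : R) : 0 < c -> tail c = `]-oo, - c] `|` `[c, +oo[.
Proof.
move=> c0; apply/seteqP; split => y; rewrite /tail /= !in_itv/= andbT ler_normr.
  by move=> /orP[cy|cy]; [right|left; rewrite lerNr].
by case=> h; apply/orP; [right; rewrite lerNr|left].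
Qed.

Lemma measurable_tail (c : R) : 0 < c -> measurable (tail c).
Proof. by move=> c0; rewrite tailE//; apply: measurableU. Qed.

Lemma Rintegral_FTC (f f' : R -> R) (a b : R) : a < b ->
  (forall y, a <= y <= b -> is_derive y 1 f (f' y)) ->
  (forall y, a <= y <= b -> {for y, continuous f'}) ->
  \int[mu]_(y in `[a, b]) f' y = f b - f a.
Proof.
move=> ab df cf.
have cfy y : a <= y <= b -> {for y, continuous f}.
  move=> /df[h _].
  by apply: differentiable_continuous; apply/derivable1_diffP.
rewrite /Rintegral (@continuous_FTC2 _ f' f)//.
- apply: continuous_in_subspaceT => y /set_mem /=; rewrite in_itv/=; exact: cf.
- split.
  + by move=> y /=; rewrite in_itv/= => /andP[/ltW ay /ltW yb];
      have [] := df y; rewrite ?ay.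
  + by apply: cvg_at_right_filter; apply: cfy; rewrite lexx ltW.
  + by apply: cvg_at_left_filter; apply: cfy; rewrite lexx ltW.
- move=> y; rewrite in_itv/= => /andP[/ltW ay /ltW yb].
  by have [|h1 h2] := df y; rewrite ?ay// derive1E.
Qed.

Lemma Rintegral_exhaust (D : set R) (A : nat -> set R) (f : R -> R) :
  measurable D -> (forall k, measurable (A k)) ->
  (forall y, D y -> \forall k \near \oo, A k y) ->
  mu.-integrable D (EFin \o f) ->
  \int[mu]_(y in D `&` A k) f y @[k --> \oo] --> \int[mu]_(y in D) f y.
Proof.
move=> mD mA DA iF.
have [mf _] := integrableP _ _ _ iF.
under eq_fun do rewrite Rintegral_mkcondr.
have m1 k : measurable_fun D (fun y => ((f \_ (A k)) y)%:E).
  apply/measurable_EFinP; apply/measurable_restrict => //.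
  by apply: (@measurable_funS _ _ _ _ D) => //; exact/measurable_EFinP.
have c1 : {ae mu, forall y, D y ->
    ((f \_ (A k)) y)%:E @[k --> \oo] --> (EFin \o f) y}.
  apply: aeW => y Dy /=; apply: cvg_EFin; first exact: nearW.
  apply: cvg_near_cst; apply: filterS (DA y Dy) => k Ak /=.
  by rewrite patchE mem_set.
have b1 : {ae mu, forall y k, D y -> (`|((f \_ (A k)) y)%:E| <= `|(f y)%:E|)%E}.
  apply: aeW => y k Dy; rewrite /= patchE; case: ifPn => // _.
  by rewrite normr0 lee_fin.
have i1 : mu.-integrable D (fun y => `|(f y)%:E|%E) by exact: integrable_abse.
have [_ _ h] := @dominated_convergence _ _ _ mu D mD
  (fun k y => ((f \_ (A k)) y)%:E) (EFin \o f) (fun y => `|(f y)%:E|%E)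
  m1 mf c1 i1 b1.
by apply: fine_cvg; rewrite fineK; [exact: h|exact: integrable_fin_num].
Qed.

Lemma Rintegral_FTC_tail (f f' : R -> R) (c : R) : 0 < c ->
  (forall y, tail c y -> is_derive y 1 f (f' y)) ->
  (forall y, tail c y -> {for y, continuous f'}) ->
  mu.-integrable (tail c) (EFin \o f') ->
  f k%:R @[k --> \oo] --> (0 : R) -> f (- k%:R) @[k --> \oo] --> (0 : R) ->
  \int[mu]_(y in tail c) f' y = f (- c) - f c.
Proof.
move=> c0 df cf iF f0 fN0.
pose A (k : nat) : set R := `[- k%:R, k%:R]%classic.
have mT := measurable_tail c0.
have DA y : tail c y -> \forall k \near \oo, A k y.
  move=> _; near=> k; rewrite /A /= in_itv/= -ler_norml.
  by near: k; exact: nbhs_infty_ger.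
have mA k : measurable (A k) by exact: measurable_itv.
have h1 := Rintegral_exhaust mT mA DA iF.
have h2 : f k%:R - f c + (f (- c) - f (- k%:R)) @[k --> \oo]
    --> 0 - f c + (f (- c) - 0).
  by apply: cvgD; apply: cvgB => //; exact: cvg_cst.
have -> : f (- c) - f c = 0 - f c + (f (- c) - 0) by ring.
apply: cvg_unique h1 _; first exact: Rhausdorff.
apply: cvg_trans h2; apply: near_eq_cvg; near=> k.
have ck : c < k%:R by near: k; exact: nbhs_infty_gtr.
have -> : tail c `&` A k = `[c, k%:R]%classic `|` `[- k%:R, - c]%classic.
  apply/seteqP; split => y; rewrite /tail /A /= !in_itv/= ler_normr.
    by move=> [/orP[cy|cy] /andP[h3 h4]]; [left; rewrite cy|right; rewrite h3 lerNr].
  case=> /andP[h3 h4]; split.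
  - by rewrite h3.
  - by rewrite h4 andbT; lra.
  - by rewrite lerNr h4 orbT.
  - by rewrite h3/=; lra.
have sub1 : `[c, k%:R] `<=` tail c.
  by move=> y; rewrite /tail /= in_itv/= ler_normr => /andP[->].
have sub2 : `[- k%:R, - c] `<=` tail c.
  by move=> y; rewrite /tail /= in_itv/= ler_normr lerNr => /andP[_ ->]; rewrite orbT.
have e1 : \int[mu]_(y in `[c, k%:R]) f' y = f k%:R - f c.
  apply: Rintegral_FTC => // y yk.
    by apply: df; apply: sub1; rewrite /= in_itv.
  by apply: cf; apply: sub1; rewrite /= in_itv.
have e2 : \int[mu]_(y in `[- k%:R, - c]) f' y = f (- c) - f (- k%:R).
  apply: Rintegral_FTC => [|y yk|y yk]; first by rewrite ltrN2.
    by apply: df; apply: sub2; rewrite /= in_itv.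
  by apply: cf; apply: sub2; rewrite /= in_itv.
rewrite Rintegral_setU//.
- by rewrite e1 e2.
- by apply: integrableS iF => //; [exact: measurableU|rewrite subUset].
- apply/disj_setPS => y [/=]; rewrite !in_itv/= => /andP[h3 _] /andP[_ h4]; lra.
Unshelve. all: by end_near. Qed.

Lemma cintegral_FTC_tail (f f' : R -> R[i]) (c : R) : 0 < c ->
  (forall y, tail c y -> is_cderive f y (f' y)) ->
  (forall y, tail c y -> ccontinuous_at f' y) ->
  cintegrable (tail c) f' ->
  f k%:R @[k --> \oo] --> (0 : R[i]) -> f (- k%:R) @[k --> \oo] --> (0 : R[i]) ->
  cintegral (tail c) f' = f (- c) - f c.
Proof.
move=> c0 df cf [i1 i2] /cvg_complex[f1 f2] /cvg_complex[g1 g2].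
rewrite [RHS]complex_eta cReB cImB /cintegral.
congr (_ +i* _).
- apply: (@Rintegral_FTC_tail (fun y => complex.Re (f y))) => //.
    by move=> y /df[].
  by move=> y /cf[].
- apply: (@Rintegral_FTC_tail (fun y => complex.Im (f y))) => //.
    by move=> y /df[].
  by move=> y /cf[].
Qed.

End tails.

(** * Integration by parts against a quadratic phase *)

Section tail_estimate.
Context {R : realType}.
Notation mu := (@lebesgue_measure R).
Implicit Types (x y b eta g X A : R).

Lemma is_derive_sub x y : is_derive y 1 (fun y => y - x) 1.
Proof.
by apply: (is_derive_eq (is_deriveB (is_derive_id y 1)
  (is_derive_cst x y 1))); rewrite subr0.
Qed.

Lemma is_derive_sqr_sub x y b :
  is_derive y 1 (fun y => b * (y - x) ^+ 2) (2 * b * (y - x)).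
Proof.
apply: (is_derive_eq (is_deriveZ b (is_deriveX 2 (is_derive_sub x y)))).
by rewrite /GRing.scale/= expr1; ring.
Qed.

Lemma is_cderive_phase x b y :
  is_cderive (fun y => expi (b * (y - x) ^+ 2)) y
    ('i%C * expi (b * (y - x) ^+ 2) * (2 * b * (y - x))%:C).
Proof.
exact: (is_cderive_comp (is_cderive_expi _) (is_derive_sqr_sub x y b)).
Qed.

Lemma phase_continuous x b y :
  ccontinuous_at (fun y => expi (b * (y - x) ^+ 2)) y.
Proof. exact: is_cderive_continuous (is_cderive_phase x b y). Qed.

Lemma is_derive_inv_subX x y j : y - x != 0 ->
  is_derive y 1 (fun y => (y - x)^-1 ^+ j.+1) (- j.+1%:R * (y - x)^-1 ^+ j.+2).
Proof.
move=> yx.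
have -> : (fun y => (y - x)^-1 ^+ j.+1) = (fun y => (y - x)^-1) ^+ j.+1.
  by apply/funext => z; rewrite exprfctE.
apply: (is_derive_eq (is_deriveX j.+1 (@is_deriveV _ (fun y => y - x) y 1 1 yx
    (is_derive_sub x y)))).
rewrite /GRing.scale/= !exprVn !exprS. field.
by rewrite expf_neq0// yx.
Qed.

Lemma tail_dist X x y : `|x| <= X -> tail (X + 1) y ->
  1 <= `|y - x| /\ weight y <= (X + 2) * `|y - x|.
Proof.
rewrite /tail /= /weight => xX yX.
have h : `|y| - `|x| <= `|y - x| by exact: lerB_dist.
have x0 := normr_ge0 x.
split; first lra.
have : (X + 2) * (`|y| - `|x|) <= (X + 2) * `|y - x| by rewrite ler_wpM2l//; lra.
have : 0 <= (X + 1) * (`|y| - (X + 1)) by rewrite mulr_ge0//; lra.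
have : 0 <= (X + 2) * (X - `|x|) by rewrite mulr_ge0//; lra.
lra.
Qed.

(** The factor that each integration by parts introduces.  The tail stays at
    distance at least [1] from its pole, uniformly for [x] in [[- X, X]]. *)
Lemma Cbound_inv_sub m j X : 0 <= X -> exists2 C : R, 0 <= C &
  forall x, `|x| <= X -> Cbound (tail (X + 1)) m (fun y => C * wt (-1) 0 y)
    (fun y => ((y - x)^-1 ^+ j.+1)%:C).
Proof.
move=> X0; elim: m j => [|m ih] j.
  exists (X + 2); first by rewrite addr_ge0.
  move=> x xX; split => // y Dy; have [h1 h2] := tail_dist xX Dy.
  have yx : y - x != 0 by rewrite -normr_gt0 (lt_le_trans ltr01).
  split; first exact: is_cderive_continuous (is_cderive_real (is_derive_inv_subX j yx)).
  rewrite modulus_real normrX normfV wt0r powR_inv1 ?(ltW (weight_gt0 _))//.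
  rewrite exprS -[leRHS]mulr1 ler_pM ?invr_ge0 ?exprn_ge0 ?invr_ge0//.
    rewrite ler_pdivlMr ?weight_gt0// mulrC ler_pdivrMr//.
    by rewrite (lt_le_trans ltr01).
  by rewrite exprn_ile1 ?invr_ge0// invf_le1// (lt_le_trans ltr01).
have [C1 C10 h1] := ih j; have [C2 C20 h2] := ih j.+1.
exists (C1 + j.+1%:R * C2); first by rewrite addr_ge0// mulr_ge0.
move=> x xX; split.
  move=> y Dy; split; first exact: Cbound_continuous (h1 x xX) _ Dy.
  rewrite (le_trans (Cbound_bound (h1 x xX) Dy))// ler_wpM2r ?wt_ge0//.
  by rewrite lerDl mulr_ge0.
exists (fun y => (- j.+1%:R)%:C * ((y - x)^-1 ^+ j.+2)%:C); split.
  move=> y Dy; have [h3 _] := tail_dist xX Dy.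
  have yx : y - x != 0 by rewrite -normr_gt0 (lt_le_trans ltr01).
  by rewrite -rmorphM; exact: is_cderive_real (is_derive_inv_subX j yx).
apply: Cbound_le (CboundZ _ (h2 x xX)) => y _.
rewrite modulus_real normrN ger0_norm// mulrA ler_wpM2r ?wt_ge0//.
by rewrite lerDr.
Qed.

Lemma phase_integrable g eta X x b A f : 0 <= X -> 0 < eta ->
  (forall y, tail (X + 1) y -> ccontinuous_at f y) ->
  (forall y, tail (X + 1) y -> modulus (f y) <= A * wt g eta y) ->
  cintegrable (tail (X + 1)) (fun y => expi (b * (y - x) ^+ 2) * f y).
Proof.
move=> X0 eta0 cf bf; have c0 : 0 < X + 1 by rewrite ltr_wpDl.
have mT := measurable_tail c0.
apply: (@cintegrable_le _ _ _ (fun y => A * wt g eta y)) => //.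
- apply: ccontinuous_measurable => // y Dy; apply: ccontinuous_atM.
    exact: phase_continuous.
  exact: cf.
- apply: integrable_cmul => //.
  exact: integrableS (integrable_wt g eta0).
- by move=> y Dy; rewrite modulusM modulus_expi mul1r bf.
Qed.

(** Each integration by parts against the phase trades one derivative of [f]
    for one power of the weight and gains [b^-1], kept for the first one only.  The
    Gaussian factor makes all integrals absolutely convergent and kills the
    boundary terms at infinity; the constant does not depend on [eta], so the
    bound survives the limit where the Gaussian is removed. *)
Lemma tail_estimate n g X b0 : g - n%:R < -1 -> 0 <= X -> 0 < b0 ->
  exists2 C : R, 0 <= C & forall x b A eta f, `|x| <= X -> b0 <= b -> 0 <= A ->
    0 < eta -> Cbound (tail (X + 1)) n (fun y => A * wt g eta y) f ->
    modulus (cintegral (tail (X + 1)) (fun y => expi (b * (y - x) ^+ 2) * f y))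
      <= C * A * b^-1 ^+ (0 < n)%N.
Proof.
move=> + X0 b00; have c0 : 0 < X + 1 by rewrite ltr_wpDl.
have mT := measurable_tail c0.
elim: n g => [|n ih] g gn.
  have g1 : g < -1 by lra.
  exists (2 * \int[mu]_(y in tail (X + 1)) wt g 0 y).
    by rewrite mulr_ge0// Rintegral_ge0// => y _; exact: wt_ge0.
  move=> x b A eta f xX bb A0 eta0 hf; rewrite expr0 mulr1.
  have ig : mu.-integrable (tail (X + 1)) (EFin \o wt g 0).
    exact: integrableS (integrable_weight g1).
  rewrite -mulrA [_ * A]mulrC -RintegralZl//.
  apply: modulus_cintegral_le => //.
  - apply: phase_integrable (Cbound_continuous hf) (Cbound_bound hf) => //.
  - exact: integrable_cmul.
  - move=> y Dy; rewrite modulusM modulus_expi mul1r.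
    rewrite (le_trans (Cbound_bound hf Dy))// ler_wpM2l// wt_le// ltW//.
have [|C1 C10 h1] := ih (g - 1); first by move: gn; rewrite -natr1; lra.
have [C2 C20 h2] := Cbound_inv_sub n.+1 0 X0.
pose B := 1 + b0^-1.
have B0 : 0 <= B by rewrite addr_ge0// invr_ge0 ltW.
pose K := 2 ^+ n.+1 * C2.
have K0 : 0 <= K by rewrite mulr_ge0// exprn_ge0.
exists (2^-1 * (2 * (K * wt (g - 1) 0 (X + 1)) + C1 * K * B)).
  have w0 := wt_ge0 (g - 1) 0 (X + 1).
  have Kw := mulr_ge0 K0 w0; have CKB : 0 <= C1 * K * B by rewrite !mulr_ge0.
  lra.
move=> x b A eta f xX bb A0 eta0 hf; rewrite expr1.
have b1 : 0 < b by exact: lt_le_trans bb.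
have hfr := CboundM hf (h2 x xX).
pose w y := (K * A) * wt (g - 1) eta y.
have {}hfr : Cbound (tail (X + 1)) n.+1 w (fun y => f y * ((y - x)^-1 ^+ 1)%:C).
  apply: Cbound_le hfr => y _; rewrite /w.
  have <- : wt g eta y * wt (-1) 0 y = wt (g - 1) eta y by rewrite wtM addr0.
  by rewrite /K le_eqVlt; apply/orP; left; apply/eqP; ring.
have [_ [f1 [df1 hf1]]] := hfr.
(* expi (b (y - x)^2) = kap / (y - x) * its own derivative; the derivative of
   the product h is the integrand plus one of the same kind with weight g - 1
   and one derivative less *)
pose e y := expi (b * (y - x) ^+ 2).
pose kap : R[i] := (2 * b)^-1%:C * - 'i%C.
have mkap : modulus kap = 2^-1 * b^-1.
  rewrite modulusM modulus_real modulusN modulusi mulr1 ger0_norm; last first.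
    by rewrite invr_ge0 mulr_ge0// ltW.
  by rewrite invfM.
pose h y := kap * (e y * (f y * ((y - x)^-1 ^+ 1)%:C)).
have dh y : tail (X + 1) y -> is_cderive h y (e y * f y + kap * (e y * f1 y)).
  move=> Dy; have [h3 _] := tail_dist xX Dy.
  have yx : y - x != 0 by rewrite -normr_gt0 (lt_le_trans ltr01).
  have := is_cderiveZ kap (is_cderiveM (is_cderive_phase x b y) (df1 y Dy)).
  set u := (X in is_cderive _ _ X -> _); set v := (X in _ -> is_cderive _ _ X).
  suff -> : u = v by [].
  rewrite /u /v -/(e y) mulrDr; congr (_ + _).
  rewrite expr1.
  transitivity ((- 'i%C * 'i%C) * (((2 * b)^-1%:C * (2 * b * (y - x))%:C
    * ((y - x)^-1)%:C)) * (e y * f y)); first by rewrite /kap; ring.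
  rewrite mulNr -expr2 complex.sqr_i opprK mul1r -!rmorphM/=.
  rewrite (_ : (2 * b)^-1 * _ * _ = 1) ?mul1r//.
  by field; rewrite yx gt_eqF.
have ief := phase_integrable x b X0 eta0 (Cbound_continuous hf) (Cbound_bound hf).
have ief1 := phase_integrable x b X0 eta0 (Cbound_continuous hf1) (Cbound_bound hf1).
have hw y : tail (X + 1) y -> modulus (h y) <= 2^-1 * b^-1 * w y.
  move=> Dy; rewrite modulusM mkap ler_wpM2l ?mulr_ge0 ?invr_ge0 ?(ltW b1)//.
  rewrite modulusM modulus_expi mul1r; exact: (Cbound_bound hfr Dy).
have hcvg (s : nat -> R) : (forall k, `|s k| = k%:R) ->
    wt (g - 1) eta (s k) @[k --> \oo] --> (0 : R) ->
    h (s k) @[k --> \oo] --> (0 : R[i]).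
  move=> sk ws; apply/cvg_modulus.
  have h0 : 2^-1 * b^-1 * (K * A) * wt (g - 1) eta (s k) @[k --> \oo] --> (0 : R).
    by have := cvgM (cvg_cst (2^-1 * b^-1 * (K * A))) ws; rewrite mulr0; apply.
  apply: (squeeze_cvgr _ (cvg_cst (0 : R)) h0); near=> k.
  rewrite subr0 modulus_ge0/=.
  have Dk : tail (X + 1) (s k).
    by rewrite /tail /= sk; near: k; exact: nbhs_infty_ger.
  by rewrite (le_trans (hw _ Dk))// /w mulrA.
have [w0 wN0] := wt_cvg0 (g - 1) eta0.
have hc : forall y, tail (X + 1) y ->
    ccontinuous_at (fun y => e y * f y + kap * (e y * f1 y)) y.
  move=> y Dy; apply: ccontinuous_atD.
    apply: ccontinuous_atM; first exact: phase_continuous.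
    exact: Cbound_continuous hf _ Dy.
  apply: ccontinuous_atM; first by split; exact: cvg_cst.
  apply: ccontinuous_atM; first exact: phase_continuous.
  exact: Cbound_continuous hf1 _ Dy.
have hi : cintegrable (tail (X + 1)) (fun y => e y * f y + kap * (e y * f1 y)).
  by apply: cintegrableD => //; exact: cintegrableZ.
have := cintegral_FTC_tail c0 dh hc hi.
move=> /(_ (hcvg (fun k => k%:R) _ w0)) /(_ (hcvg (fun k => - k%:R) _ wN0)).
rewrite cintegralD//; last exact: cintegrableZ.
rewrite cintegralZ// => /(_ (fun k => ger0_norm (ler0n _ k))).
have nN : forall k : nat, `|- (k%:R : R)| = k%:R by move=> k; rewrite normrN ger0_norm.
move=> /(_ nN) hFTC.
have -> : cintegral (tail (X + 1)) (fun y => e y * f y) =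
    h (- (X + 1)) - h (X + 1) - kap * cintegral (tail (X + 1)) (fun y => e y * f1 y).
  by rewrite -hFTC addrK.
have DX : tail (X + 1) (X + 1) by rewrite /tail /= ler_norm.
have DNX : tail (X + 1) (- (X + 1)) by rewrite /tail /= normrN ler_norm.
have wX : w (X + 1) <= K * A * wt (g - 1) 0 (X + 1).
  by rewrite /w ler_wpM2l ?mulr_ge0// wt_le// ltW.
have wNX : w (- (X + 1)) <= K * A * wt (g - 1) 0 (X + 1).
  apply: le_trans wX; rewrite /w /wt /weight normrN sqrrN//.
have bi : 0 <= 2^-1 * b^-1 by rewrite mulr_ge0 ?invr_ge0 ?(ltW b1).
have hX : modulus (h (X + 1)) <= 2^-1 * b^-1 * (K * A * wt (g - 1) 0 (X + 1)).
  by rewrite (le_trans (hw _ DX))// ler_wpM2l.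
have hNX : modulus (h (- (X + 1))) <= 2^-1 * b^-1 * (K * A * wt (g - 1) 0 (X + 1)).
  by rewrite (le_trans (hw _ DNX))// ler_wpM2l.
have KA0 : 0 <= K * A by rewrite mulr_ge0.
have bB : b^-1 ^+ (0 < n)%N <= B.
  have b0i : 0 <= b0^-1 by rewrite invr_ge0 ltW.
  have bi0 : b^-1 <= b0^-1 by rewrite lef_pV2.
  by case: (0 < n)%N; rewrite ?expr0 ?expr1 /B; lra.
have i1 : modulus (kap * cintegral (tail (X + 1)) (fun y => e y * f1 y)) <=
    2^-1 * b^-1 * (C1 * (K * A) * B).
  rewrite modulusM mkap ler_wpM2l//.
  rewrite (le_trans (h1 x b (K * A) eta f1 xX bb KA0 eta0 hf1))//.
  by rewrite ler_wpM2l// mulr_ge0.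
rewrite (le_trans (modulusB _ _))//.
rewrite (le_trans (lerD (le_trans (modulusB _ _) (lerD hNX hX)) i1))//.
by rewrite le_eqVlt; apply/orP; left; apply/eqP; ring.
Unshelve. all: by end_near. Qed.

End tail_estimate.

(** * The Gaussian cut-off *)

Section gaussian_cutoff.
Context {R : realType}.
Implicit Types (y s e d : R).

(** Powers of the scaled variable [s * y] against a Gaussian, [s ^+ 2] being the
    strength of the cut-off: the span is stable under differentiation, which
    produces a factor [s <= 1], and half of the Gaussian bounds the power
    independently of [s].  Hence the uniformity in [Cbound_gauss]. *)
Let hermite (j : nat) s y : R := (s * y) ^+ j * expR (- s ^+ 2 * y ^+ 2).

Lemma is_derive_gauss s y :
  is_derive y 1 (fun y => expR (- s ^+ 2 * y ^+ 2))
    (- 2 * s ^+ 2 * y * expR (- s ^+ 2 * y ^+ 2)).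
Proof.
have h : is_derive y 1 (fun y => - s ^+ 2 * y ^+ 2) (- s ^+ 2 * (2 * y)).
  apply: (is_derive_eq (is_deriveZ (- s ^+ 2) (is_deriveX 2 (is_derive_id y 1)))).
  by rewrite /GRing.scale/= expr1; ring.
apply: (is_derive_eq (is_derive1_comp (is_derive_expR _) h)).
by ring.
Qed.

Let is_derive_hermite j s y : is_derive y 1 (hermite j s)
  (s * (j%:R * hermite j.-1 s y + (- 2) * hermite j.+1 s y)).
Proof.
have h : is_derive y 1 (fun y => (s * y) ^+ j) (j%:R * (s * y) ^+ j.-1 * s).
  have h1 : is_derive y 1 (fun y => s * y) s.
    by apply: (is_derive_eq (is_deriveZ s (is_derive_id y 1)));
      rewrite /GRing.scale/= mulr1.
  have -> : (fun y => (s * y) ^+ j) = (fun y => s * y) ^+ j.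
    by apply/funext => z; rewrite exprfctE.
  by apply: (is_derive_eq (is_deriveX j h1)).
apply: (is_derive_eq (is_deriveM h (is_derive_gauss s y))).
rewrite /GRing.scale/= /hermite [_ ^+ j.+1]exprS; ring.
Qed.

Let Cbound_hermite m j : exists2 C : R, 0 <= C & forall s, 0 < s <= 1 ->
  Cbound setT m (fun y => C * wt 0 (s ^+ 2 / 2) y) (fun y => (hermite j s y)%:C).
Proof.
have base i : exists2 C : R, 0 <= C & forall s y, 0 < s <= 1 ->
    modulus (hermite i s y)%:C <= C * wt 0 (s ^+ 2 / 2) y.
  have [|C C0 h] := @wt_gauss_bounded R i%:R (2^-1); first by rewrite invr_gt0.
  exists C => // s y /andP[s0 s1]; rewrite modulus_real normrM normrX.
  rewrite [`|expR _|]ger0_norm ?expR_ge0//.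
  have -> : expR (- s ^+ 2 * y ^+ 2) =
      expR (- 2^-1 * (s * y) ^+ 2) * wt 0 (s ^+ 2 / 2) y.
    by rewrite /wt powRr0 mul1r -expRD; congr expR; field.
  rewrite mulrA ler_wpM2r ?wt_ge0// (le_trans _ (h (s * y)))//.
  rewrite /wt ler_wpM2r ?expR_ge0// powR_mulrn ?(ltW (weight_gt0 _))//.
  by rewrite lerXn2r ?nnegrE ?(ltW (weight_gt0 _))// lerDr.
have cont i s y : ccontinuous_at (fun y => (hermite i s y)%:C) y.
  exact: is_cderive_continuous (is_cderive_real (is_derive_hermite i s y)).
elim: m j => [|m ih] j.
  by have [C C0 h] := base j; exists C => // s s01; split => // y _; split => //; exact: h.
have [C C0 h] := base j; have [C1 C10 h1] := ih j.-1; have [C2 C20 h2] := ih j.+1.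
exists (C + (j%:R * C1 + 2 * C2)).
  by rewrite !addr_ge0// mulr_ge0.
move=> s s01; split.
  move=> y _; split; first exact: cont.
  rewrite (le_trans (h s y s01))// ler_wpM2r ?wt_ge0// lerDl.
  by rewrite addr_ge0// mulr_ge0.
exists (fun y => s%:C * (j%:R%:C * (hermite j.-1 s y)%:C +
                         (- 2)%:C * (hermite j.+1 s y)%:C)); split.
  move=> y _; rewrite -!rmorphM/= -rmorphD/= -rmorphM.
  exact: is_cderive_real (is_derive_hermite j s y).
apply: Cbound_le (CboundZ _ (CboundD (CboundZ _ (h1 s s01))
  (CboundZ _ (h2 s s01)))) => y _.
have /andP[s0 s1] := s01.
rewrite !modulus_real normrN !ger0_norm ?(ltW s0)//.
set W := wt _ _ _; have W0 : 0 <= W by exact: wt_ge0.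
set a := j%:R * (C1 * W) + 2 * (C2 * W).
have a0 : 0 <= a by apply: addr_ge0; apply: mulr_ge0 => //; exact: mulr_ge0.
have -> : (C + (j%:R * C1 + 2 * C2)) * W = C * W + a by rewrite /a; ring.
rewrite (@le_trans _ _ a)//; first by rewrite ler_piMl.
by rewrite lerDr mulr_ge0.
Qed.

Definition gauss e y : R := expR (- e * y ^+ 2).

Lemma gauss_hermite e : 0 <= e -> gauss e = hermite 0 (Num.sqrt e).
Proof.
by move=> e0; apply/funext => y; rewrite /hermite expr0 mul1r sqr_sqrtr.
Qed.

Lemma Cbound_gauss m : exists2 C : R, 0 <= C & forall e, 0 < e -> e <= 1 ->
  Cbound setT m (fun y => C * wt 0 (e / 2) y) (fun y => (gauss e y)%:C).
Proof.
have [C C0 h] := Cbound_hermite m 0; exists C => // e e0 e1.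
rewrite (gauss_hermite (ltW e0)) -{1}(sqr_sqrtr (ltW e0)).
by apply: h; rewrite sqrtr_gt0 e0/= -sqrtr1 ler_sqrt.
Qed.

(** From [1 - expR (- v) <= Num.min 1 v <= v `^ d] for [0 < d <= 1]: a small [d]
    yields a rate in [e] at a small cost in weight. *)
Lemma gauss_diff_le d e e' y : 0 < d <= 1 -> 0 < e' -> e' <= e ->
  `|gauss e y - gauss e' y| <= e `^ d * wt (2 * d) (e' / 2) y.
Proof.
move=> /andP[d0 d1] e'0 ee.
have e0 : 0 < e by exact: lt_le_trans ee.
have v0 : 0 <= e * y ^+ 2 by rewrite mulr_ge0 ?sqr_ge0// ltW.
have u0 : 0 <= (e - e') * y ^+ 2 by rewrite mulr_ge0 ?sqr_ge0// subr_ge0.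
have -> : gauss e y - gauss e' y = - (gauss e' y * (1 - gauss (e - e') y)).
  rewrite mulrBr mulr1 opprB; congr (_ - _).
  by rewrite /gauss -expRD; congr expR; ring.
have g1 : gauss (e - e') y <= 1 by rewrite /gauss expR_le1 mulNr oppr_le0.
have g0 : 0 <= gauss (e - e') y by exact: expR_ge0.
rewrite normrN ger0_norm; last by rewrite mulr_ge0 ?expR_ge0// subr_ge0.
have hd : 1 - gauss (e - e') y <= (e * y ^+ 2) `^ d.
  have [v1|v1] := lerP 1 (e * y ^+ 2).
    rewrite (@le_trans _ _ 1)//; first lra.
    by rewrite -[leLHS](powRr0 (e * y ^+ 2)) ler_powR// ltW.
  rewrite (@le_trans _ _ (e * y ^+ 2))//.
    have : 1 + - ((e - e') * y ^+ 2) <= gauss (e - e') y.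
      by rewrite /gauss -mulNr expR_ge1Dx.
    have : (e - e') * y ^+ 2 <= e * y ^+ 2.
      by rewrite ler_wpM2r ?sqr_ge0// gerBl ltW.
    lra.
  move: v0; rewrite le_eqVlt => /orP[/eqP<-|v0]; first exact: powR_ge0.
  by apply: ger1_powR => //; rewrite v0 ltW.
have hw : (e * y ^+ 2) `^ d <= e `^ d * weight y `^ (2 * d).
  rewrite powRM ?sqr_ge0 ?(ltW e0)// ler_wpM2l ?powR_ge0//.
  rewrite powRrM ge0_ler_powR ?nnegrE ?sqr_ge0 ?powR_ge0 ?(ltW d0)//.
  rewrite powR_mulrn ?(ltW (weight_gt0 _))// -[leLHS]real_normK ?num_real//.
  by rewrite lerXn2r ?nnegrE ?(ltW (weight_gt0 _))// lerDr.
rewrite /wt mulrA mulrC ler_pM ?expR_ge0//; first by rewrite subr_ge0.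
  exact: le_trans hd hw.
rewrite /gauss ler_expR ler_wpM2r ?sqr_ge0// lerN2; lra.
Qed.

(** The function itself is estimated by [gauss_diff_le]; each derivative of a
    cut-off contains a factor [Num.sqrt e], which is at most [e `^ d]. *)
Lemma Cbound_gauss_diff m d : 0 < d <= 2^-1 -> exists2 C : R, 0 <= C &
  forall e e', 0 < e' -> e' <= e -> e <= 1 ->
  Cbound setT m (fun y => C * e `^ d * wt (2 * d) (e' / 2) y)
    (fun y => (gauss e y)%:C - (gauss e' y)%:C).
Proof.
move=> /andP[d0 d2].
have d1 : 0 < d <= 1 by rewrite d0/=; lra.
have [C1 C10 h1] := Cbound_hermite m 1.
exists (1 + 4 * C1); first by rewrite addr_ge0// mulr_ge0.
move=> e e' e'0 ee e1.
have e0 : 0 < e by exact: lt_le_trans ee.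
apply: CboundS; split.
  move=> y _; split.
    rewrite !gauss_hermite ?(ltW e0) ?(ltW e'0)//.
    apply: is_cderive_continuous.
    exact: is_cderiveB (is_cderive_real (is_derive_hermite 0 _ y))
                       (is_cderive_real (is_derive_hermite 0 _ y)).
  rewrite -rmorphB modulus_real/= (le_trans (gauss_diff_le y d1 e'0 ee))//.
  rewrite -mulrA ler_peMl ?mulr_ge0 ?powR_ge0 ?expR_ge0// lerDl.
  by rewrite mulr_ge0.
set s := Num.sqrt e; set s' := Num.sqrt e'.
have s0 : 0 < s by rewrite sqrtr_gt0.
have s'0 : 0 < s' by rewrite sqrtr_gt0.
have ss : s' <= s by rewrite ler_sqrt// ltW.
have s1 : s <= 1 by rewrite -sqrtr1 ler_sqrt.
exists (fun y => (s * - 2)%:C * (hermite 1 s y)%:C +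
    (s' * 2)%:C * (hermite 1 s' y)%:C); split.
  move=> y _; rewrite !gauss_hermite ?(ltW e0) ?(ltW e'0)//.
  have := is_cderiveB (is_cderive_real (is_derive_hermite 0 s y))
                       (is_cderive_real (is_derive_hermite 0 s' y)).
  rewrite !mul0r !add0r -!rmorphM -rmorphB -rmorphD/= => h.
  set v := (X in is_cderive _ _ X).
  rewrite (_ : v = (s * (-2 * hermite 1 s y) - s' * (-2 * hermite 1 s' y))%:C)//.
  by rewrite /v; congr (_%:C); ring.
have s01 : 0 < s <= 1 by rewrite s0.
have s'01 : 0 < s' <= 1 by rewrite s'0 (le_trans ss).
apply: Cbound_le (CboundD (CboundZ _ (h1 s s01)) (CboundZ _ (h1 s' s'01))) => y _.
rewrite !modulus_real !normrM normrN !(ger0_norm (ltW _))//.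
rewrite !sqr_sqrtr ?(ltW e0) ?(ltW e'0)//.
have w1 : wt 0 (e / 2) y <= wt (2 * d) (e' / 2) y.
  by rewrite wt_le ?mulr_ge0 ?(ltW d0)//; lra.
have w2 : wt 0 (e' / 2) y <= wt (2 * d) (e' / 2) y.
  by rewrite wt_le ?mulr_ge0 ?(ltW d0).
have sd : s <= e `^ d.
  by rewrite /s -powR12_sqrt ?(ltW e0)// ger_powR// e0.
have k1 : s * 2 * (C1 * wt 0 (e / 2) y) <=
    e `^ d * 2 * (C1 * wt (2 * d) (e' / 2) y).
  apply: ler_pM; [by rewrite mulr_ge0// ltW|by apply: mulr_ge0 => //; exact: wt_ge0|
    by rewrite ler_wpM2r|by rewrite ler_wpM2l].
have k2 : s' * 2 * (C1 * wt 0 (e' / 2) y) <=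
    e `^ d * 2 * (C1 * wt (2 * d) (e' / 2) y).
  apply: ler_pM; [by rewrite mulr_ge0// ltW|by apply: mulr_ge0 => //; exact: wt_ge0|
    by rewrite ler_wpM2r// (le_trans ss)|by rewrite ler_wpM2l].
rewrite (le_trans (lerD k1 k2))//.
have : 0 <= e `^ d * wt (2 * d) (e' / 2) y by rewrite mulr_ge0 ?powR_ge0 ?wt_ge0.
lra.
Qed.

End gaussian_cutoff.

(** * Regularized oscillatory integrals *)

Section regularized_oscillatory_integral.
Context {R : realType}.
Notation mu := (@lebesgue_measure R).
Implicit Types (x y b e eta g X A : R) (f : R -> R[i]).

Definition osc_integrand e b x f y : R[i] :=
  (gauss e y)%:C * (expi (b * (y - x) ^+ 2) * f y).

Definition osc e b x f : R[i] := cintegral setT (osc_integrand e b x f).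

Lemma gauss_continuous e y : ccontinuous_at (fun y => (gauss e y)%:C) y.
Proof.
have [e0|/ltW e0] := leP 0 e; last first.
  split; last exact: cvg_cst.
  apply: (@continuous_comp _ _ _ (fun y : R => - e * y ^+ 2) expR).
    by apply: cvgM; [exact: cvg_cst|exact: exprn_continuous].
  exact: continuous_expR.
rewrite /gauss -(sqr_sqrtr e0).
exact: is_cderive_continuous (is_cderive_real (is_derive_gauss _ y)).
Qed.

Lemma osc_integrand_continuous e b x f y : ccontinuous_at f y ->
  ccontinuous_at (osc_integrand e b x f) y.
Proof.
move=> cf; apply: ccontinuous_atM; first exact: gauss_continuous.
by apply: ccontinuous_atM => //; exact: phase_continuous.
Qed.

Lemma modulus_osc_integrand e b x f y :
  modulus (osc_integrand e b x f y) = gauss e y * modulus (f y).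
Proof.
by rewrite !modulusM modulus_expi mul1r modulus_real ger0_norm// expR_ge0.
Qed.

Lemma osc_integrand_le e b x f g A y : modulus (f y) <= A * wt g 0 y ->
  modulus (osc_integrand e b x f y) <= A * wt g e y.
Proof.
move=> h; rewrite modulus_osc_integrand wt0r in h *.
rewrite mulrA [leRHS]mulrC /gauss ler_wpM2l// expR_ge0//.
Qed.

Lemma osc_integrand_integrable e b x f g A : 0 < e ->
  (forall y, ccontinuous_at f y) -> (forall y, modulus (f y) <= A * wt g 0 y) ->
  cintegrable setT (osc_integrand e b x f).
Proof.
move=> e0 cf bf; apply: (@cintegrable_le _ _ _ (fun y => A * wt g e y)) => //.
- by apply: ccontinuous_measurable => // y _; exact: osc_integrand_continuous.
- by apply: integrable_cmul => //; exact: integrable_wt.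
- by move=> y _; exact: osc_integrand_le.
Qed.

Let setT_tail (c : R) : [set: R] = tail c `|` ~` tail c.
Proof. by rewrite setUv. Qed.

Lemma cintegral_split (c : R) f : 0 < c -> cintegrable setT f ->
  cintegral setT f = cintegral (tail c) f + cintegral (~` tail c) f.
Proof.
move=> c0; rewrite (setT_tail c) => iF; have mT := measurable_tail c0.
rewrite cintegral_setU//; first exact: measurableC.
by apply/disj_setPS => y [].
Qed.

(** Near the origin the integrand is estimated in absolute value, far away by
    [tail_estimate]. *)
Lemma osc_estimate n g X b0 : g - n%:R < -1 -> 0 <= X -> 0 < b0 ->
  exists2 C : R, 0 <= C & forall x b A eta f, `|x| <= X -> b0 <= b -> 0 <= A ->
    0 < eta -> Cbound setT n (fun y => A * wt g eta y) f ->
    modulus (cintegral setT (fun y => expi (b * (y - x) ^+ 2) * f y)) <= C * A.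
Proof.
move=> gn X0 b00; have c0 : 0 < X + 1 by rewrite ltr_wpDl.
have mT := measurable_tail c0; have mTC := measurableC mT.
have [C1 C10 h1] := tail_estimate gn X0 b00.
have i1 : mu.-integrable (~` tail (X + 1)) (EFin \o wt g 1).
  by apply: integrableS (integrable_wt g ltr01).
pose I1 := \int[mu]_(y in ~` tail (X + 1)) wt g 1 y.
have I10 : 0 <= I1 by rewrite Rintegral_ge0// => y _; exact: wt_ge0.
pose B := 1 + b0^-1.
have B0 : 0 <= B by rewrite addr_ge0// invr_ge0 ltW.
exists (C1 * B + 2 * (expR ((X + 1) ^+ 2) * I1)).
  by apply: addr_ge0; apply: mulr_ge0 => //; apply: mulr_ge0 => //; exact: expR_ge0.
move=> x b A eta f xX bb A0 eta0 hf.
have b1 : 0 < b by exact: lt_le_trans bb.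
have bB : b^-1 ^+ (0 < n)%N <= B.
  have b0i : 0 <= b0^-1 by rewrite invr_ge0 ltW.
  have bi0 : b^-1 <= b0^-1 by rewrite lef_pV2.
  by case: (0 < n)%N; rewrite ?expr0 ?expr1 /B; lra.
have iT : cintegrable setT (fun y => expi (b * (y - x) ^+ 2) * f y).
  apply: (@cintegrable_le _ _ _ (fun y => A * wt g eta y)) => //.
  - apply: ccontinuous_measurable => // y Dy; apply: ccontinuous_atM.
      exact: phase_continuous.
    exact: Cbound_continuous hf _ Dy.
  - by apply: integrable_cmul => //; exact: integrable_wt.
  - by move=> y Dy; rewrite modulusM modulus_expi mul1r; exact: Cbound_bound hf _ Dy.
rewrite (cintegral_split c0)// (le_trans (modulusD _ _))//.
rewrite mulrDl lerD//.
  have hT : Cbound (tail (X + 1)) n (fun y => A * wt g eta y) f.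
    exact: Cbound_subset hf.
  rewrite (le_trans (h1 x b A eta f xX bb A0 eta0 hT))//.
  by rewrite mulrAC ler_wpM2r// ler_wpM2l.
have -> : 2 * (expR ((X + 1) ^+ 2) * I1) * A =
    2 * \int[mu]_(y in ~` tail (X + 1)) (expR ((X + 1) ^+ 2) * A * wt g 1 y).
  by rewrite RintegralZl// -/I1; ring.
apply: modulus_cintegral_le => //.
- exact: cintegrableS iT.
- exact: integrable_cmul.
- move=> y Dy; rewrite modulusM modulus_expi mul1r.
  rewrite (le_trans (Cbound_bound hf (y := y) I))//.
  rewrite [expR _ * A]mulrC -mulrA ler_wpM2l//.
  rewrite (le_trans (wt_le y (lexx g) (ltW eta0)))//.
  by apply: wt0_le_gauss; move: Dy; rewrite /tail /= => /negP; rewrite -ltNge => /ltW.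
Qed.

(** [osc_estimate] for the product of [f] and the difference of two cut-offs,
    which is small by [Cbound_gauss_diff]. *)
Lemma osc_rate n g X b0 : g < n%:R - 1 -> 0 <= X -> 0 < b0 ->
  exists C d : R, [/\ 0 <= C, 0 < d & forall x b A f e e', `|x| <= X -> b0 <= b ->
    0 <= A -> Cbound setT n (fun y => A * wt g 0 y) f ->
    0 < e' -> e' <= e -> e <= 1 ->
    modulus (osc e b x f - osc e' b x f) <= C * A * e `^ d].
Proof.
move=> gn X0 b00.
(* small enough for g + 2 * d < n - 1: the weight lost in Cbound_gauss_diff *)
pose d := Num.min (2^-1) ((n%:R - 1 - g) / 4).
have d0 : 0 < d by rewrite /d lt_min invr_gt0 ltr0n/= divr_gt0// subr_gt0.
have d2 : d <= 2^-1 by rewrite /d ge_min lexx.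
have d4 : d <= (n%:R - 1 - g) / 4 by rewrite /d ge_min lexx orbT.
have [|C1 C10 h1] := @osc_estimate n (g + 2 * d) X b0 _ X0 b00; first lra.
have d02 : 0 < d <= 2^-1 by rewrite d0.
have [C2 C20 h2] := Cbound_gauss_diff n d02.
exists (C1 * (2 ^+ n * C2)), d; split=> //.
  by apply: mulr_ge0 => //; apply: mulr_ge0 => //; exact: exprn_ge0.
move=> x b A f e e' xX bb A0 hf e'0 ee e1.
have e0 : 0 < e by exact: lt_le_trans ee.
have cf y : ccontinuous_at f y by exact: Cbound_continuous hf _ _.
have bf y : modulus (f y) <= A * wt g 0 y by exact: Cbound_bound hf _ _.
rewrite -cintegralB//; [|exact: osc_integrand_integrable cf bf..].
have -> : (fun y => osc_integrand e b x f y - osc_integrand e' b x f y) =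
    (fun y => expi (b * (y - x) ^+ 2) *
       (f y * ((gauss e y)%:C - (gauss e' y)%:C))).
  by apply/funext => y; rewrite /osc_integrand; ring.
have hd := CboundM hf (h2 e e' e'0 ee e1).
have {}hd : Cbound setT n (fun y => 2 ^+ n * C2 * A * e `^ d *
      wt (g + 2 * d) (e' / 2) y)
    (fun y => f y * ((gauss e y)%:C - (gauss e' y)%:C)).
  apply: Cbound_le hd => y _.
  have <- : wt g 0 y * wt (2 * d) (e' / 2) y = wt (g + 2 * d) (e' / 2) y.
    by rewrite wtM add0r.
  by rewrite le_eqVlt; apply/orP; left; apply/eqP; ring.
have A'0 : 0 <= 2 ^+ n * C2 * A * e `^ d.
  by rewrite !mulr_ge0 ?powR_ge0 ?exprn_ge0.
have e'20 : 0 < e' / 2 by rewrite divr_gt0.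
have := h1 x b _ (e' / 2) _ xX bb A'0 e'20 hd.
by move=> /le_trans; apply; rewrite le_eqVlt; apply/orP; left; apply/eqP; ring.
Qed.

(** The cut-off of strength [1] makes the integral absolutely convergent, and
    [osc_rate] compares the other ones with it. *)
Lemma osc_bound n g X b0 : g < n%:R - 1 -> 0 <= X -> 0 < b0 ->
  exists2 C : R, 0 <= C & forall x b A f e, `|x| <= X -> b0 <= b ->
    0 <= A -> Cbound setT n (fun y => A * wt g 0 y) f ->
    0 < e -> e <= 1 -> modulus (osc e b x f) <= C * A.
Proof.
move=> gn X0 b00; have [C [d [C0 d0 h]]] := osc_rate gn X0 b00.
pose I1 := \int[mu]_(y in setT) wt g 1 y.
have I10 : 0 <= I1 by rewrite Rintegral_ge0// => y _; exact: wt_ge0.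
exists (2 * I1 + C); first by rewrite addr_ge0// mulr_ge0.
move=> x b A f e xX bb A0 hf e0 e1.
have cf y : ccontinuous_at f y by exact: Cbound_continuous hf _ _.
have bf y : modulus (f y) <= A * wt g 0 y by exact: Cbound_bound hf _ _.
have -> : osc e b x f = osc 1 b x f - (osc 1 b x f - osc e b x f) by ring.
rewrite (le_trans (modulusB _ _))// mulrDl lerD//; last first.
  by rewrite (le_trans (h x b A f 1 e xX bb A0 hf e0 e1 (lexx 1)))// powR1 mulr1.
have -> : 2 * I1 * A = 2 * \int[mu]_(y in setT) (A * wt g 1 y).
  by rewrite RintegralZl//; [rewrite /I1; ring|exact: integrable_wt].
apply: modulus_cintegral_le => //.
- exact: osc_integrand_integrable cf bf.
- by apply: integrable_cmul => //; exact: integrable_wt.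
- by move=> y _; exact: osc_integrand_le.
Qed.

End regularized_oscillatory_integral.

(** * Limits at a uniform rate *)

Section uniform_limits.
Context {R : realType}.
Implicit Types (C d e a u v M : R).

Lemma powR_small C d eta : 0 < d -> 0 <= C -> 0 < eta ->
  exists e : R, [/\ 0 < e, e <= 1 & C * e `^ d <= eta].
Proof.
move=> d0 C0 eta0.
have := powR_cvg0 d0; move=> /cvgrPdist_le/(_ (eta / (C + 1))).
have C1 : 0 < C + 1 by rewrite ltr_wpDl.
rewrite divr_gt0// => /(_ isT) h.
have : \forall e \near (0 : R)^'+, [/\ 0 < e, e <= 1 & C * e `^ d <= eta].
  near=> e; split.
  - by near: e; exact: nbhs_right_gt.
  - by near: e; exact: nbhs_right_le.
  - have : `|0 - e `^ d| <= eta / (C + 1) by near: e.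
    rewrite sub0r normrN ger0_norm ?powR_ge0// ler_pdivlMr// => h1.
    rewrite (le_trans _ h1)// mulrDr mulr1 mulrC lerDl powR_ge0//.
by move=> /filter_ex[e h1]; exists e.
Unshelve. all: by end_near. Qed.

Lemma lt_near_right0 (e : R) : 0 < e -> \forall e' \near 0^'+, 0 < e' /\ e' <= e.
Proof.
move=> e0; near=> e'; split.
  by near: e'; exact: nbhs_right_gt.
by near: e'; exact: nbhs_right_le.
Unshelve. all: by end_near. Qed.

Lemma modulus_lim_le (U : R -> R[i]) (z l : R[i]) M :
  U e @[e --> 0^'+] --> l ->
  (\forall e \near 0^'+, modulus (U e - z) <= M) -> modulus (l - z) <= M.
Proof.
move=> /cvg_modulus Ul hM; apply/ler_addgt0Pr => eta eta0.
move/cvgrPdist_le : Ul => /(_ eta eta0) Ul.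
have : \forall e \near (0 : R)^'+, modulus (U e - z) <= M /\
    `|0 - modulus (U e - l)| <= eta by exact: filterI.
move=> H; have [e [h1]] := @filter_ex _ _ (at_right_proper_filter (0 : R)) _ H.
rewrite sub0r normrN ger0_norm ?modulus_ge0// => h2.
have -> : l - z = (U e - z) - (U e - l) by ring.
by rewrite (le_trans (modulusB _ _))// lerD.
Qed.

(** A Cauchy criterion; the rate passes to the limit. *)
Lemma rate_cvg (U : R -> R[i]) C d : 0 < d -> 0 <= C ->
  (forall e e', 0 < e' -> e' <= e -> e <= 1 -> modulus (U e - U e') <= C * e `^ d) ->
  exists2 l, U e @[e --> 0^'+] --> l &
    forall e, 0 < e -> e <= 1 -> modulus (l - U e) <= C * e `^ d.
Proof.
move=> d0 C0 hU.
have main (p : R[i] -> R) : (forall z w, p (z - w) = p z - p w) ->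
    (forall z, `|p z| <= modulus z) -> cvg (p (U e) @[e --> 0^'+]).
  move=> pB pm; apply/cauchy_cvgP; apply: cauchy_exP => eta eta0.
  have eta20 : 0 < eta / 2 by rewrite divr_gt0.
  have [e [e0 e1 he]] := powR_small d0 C0 eta20.
  exists (p (U e)).
  apply: filterS (lt_near_right0 e0) => e' [e'0 ee] /=.
  rewrite /ball/= -pB (le_lt_trans (pm _))//.
  rewrite (le_lt_trans (hU e e' e'0 ee e1))// (le_lt_trans he)//; lra.
have /cvg_ex[lr hr] := (main (@complex.Re R) (@cReB R) (@normr_Re R)).
have /cvg_ex[li hi] := (main (@complex.Im R) (@cImB R) (@normr_Im R)).
have hl : U e @[e --> 0^'+] --> lr +i* li by apply/cvg_complex.
exists (lr +i* li) => // e e0 e1; apply: (modulus_lim_le hl).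
apply: filterS (lt_near_right0 e0) => e' [e'0 ee].
by rewrite modulus_distC hU.
Qed.

(** The mean value theorem fails for complex-valued functions; the inequality
    is obtained from real and imaginary parts, whence the factor [2]. *)
Lemma modulus_mean_value (f f' : R -> R[i]) (a b M : R) : a <= b ->
  (forall y, a <= y <= b -> is_cderive f y (f' y)) ->
  (forall y, a <= y <= b -> modulus (f' y) <= M) ->
  modulus (f b - f a) <= 2 * M * (b - a).
Proof.
move=> ab df bf.
have main (g g' : R -> R) : (forall y, a <= y <= b -> is_derive y 1 g (g' y)) ->
    (forall y, a <= y <= b -> `|g' y| <= M) -> `|g b - g a| <= M * (b - a).
  move=> dg bg; have [||c cab ->] := @MVT_segment R g g' a b ab.
  - by move=> y; rewrite in_itv/= => /andP[/ltW ay /ltW yb]; apply: dg; rewrite ay.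
  - apply: continuous_in_subspaceT => y /set_mem /=; rewrite in_itv/= => /dg[h _].
    by apply: differentiable_continuous; apply/derivable1_diffP.
  - rewrite normrM [`|b - a|]ger0_norm ?subr_ge0// ler_wpM2r ?subr_ge0//.
    by apply: bg; move: cab; rewrite in_itv.
rewrite (le_trans (modulus_leD _))// cReB cImB -mulrA mulr_natl mulr2n lerD//.
  apply: (main (fun y => complex.Re (f y)) (fun y => complex.Re (f' y))).
    by move=> y /df[].
  by move=> y /bf; apply: le_trans; exact: normr_Re.
apply: (main (fun y => complex.Im (f y)) (fun y => complex.Im (f' y))).
  by move=> y /df[].
by move=> y /bf; apply: le_trans; exact: normr_Im.
Qed.

(** Uniform convergence of the derivatives, through the mean value inequality
    for the differences [U e' - U e]. *)
Lemma is_cderive_limit (U V : R -> R -> R[i]) (U0 : R -> R[i]) (V0 : R[i])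
    (u v a C d : R) : u < a < v -> 0 < d -> 0 <= C ->
  (forall p e, u < p < v -> 0 < e -> e <= 1 -> is_cderive (U e) p (V e p)) ->
  (forall p e e', u < p < v -> 0 < e' -> e' <= e -> e <= 1 ->
     modulus (V e p - V e' p) <= C * e `^ d) ->
  (forall p, u < p < v -> U e p @[e --> 0^'+] --> U0 p) ->
  V e a @[e --> 0^'+] --> V0 ->
  is_cderive U0 a V0.
Proof.
move=> uav d0 C0 dU bV cU cV.
apply/is_cderive_quotient/cvg_modulus/cvgrPdist_le => eta eta0.
have eta40 : 0 < eta / 4 by rewrite divr_gt0.
have [e [e0 e1 he]] := powR_small d0 C0 eta40.
have h1 : modulus (V0 - V e a) <= eta / 4.
  rewrite (le_trans _ he)//; apply: (modulus_lim_le cV).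
  apply: filterS (lt_near_right0 e0) => e' [e'0 ee].
  by rewrite modulus_distC bV.
have /is_cderive_quotient/cvg_modulus/cvgrPdist_le/(_ _ eta40) h2 :=
  dU a e uav e0 e1.
have h3 : \forall z \near a^', u < z < v.
  by apply: nbhs_dnbhs; exact: (@near_in_itvoo _ u v a).
near=> z.
have zuv : u < z < v by near: z.
have za : z - a != 0 by rewrite subr_eq0; near: z; exact: nbhs_dnbhs_neq.
have h4 : modulus (difference_quotient (U e) a z - V e a) <= eta / 4.
  have : `|0 - modulus (difference_quotient (U e) a z - V e a)| <= eta / 4 by near: z.
  by rewrite sub0r normrN ger0_norm ?modulus_ge0.
have h5 e' : 0 < e' -> e' <= e ->
    modulus ((U e' z - U e' a) - (U e z - U e a)) <= eta / 2 * `|z - a|.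
  move=> e'0 ee.
  have -> : (U e' z - U e' a) - (U e z - U e a) =
    (U e' z - U e z) - (U e' a - U e a) by ring.
  have dW y : u < y < v ->
      is_cderive (fun y => U e' y - U e y) y (V e' y - V e y).
    move=> yuv; apply: is_cderiveB; first exact: (dU _ _ yuv e'0 (le_trans ee e1)).
    exact: (dU _ _ yuv e0 e1).
  have bW y : u < y < v -> modulus (V e' y - V e y) <= eta / 4.
    by move=> yuv; rewrite modulus_distC (le_trans (bV _ _ _ yuv e'0 ee e1)).
  have [h|h] := leP a z.
    apply: (@le_trans _ _ (2 * (eta / 4) * (z - a))).
      apply: (@modulus_mean_value (fun y => U e' y - U e y)
        (fun y => V e' y - V e y)) => // y ayz; [apply: dW|apply: bW]; lra.
    by rewrite ger0_norm ?subr_ge0// ler_wpM2r ?subr_ge0//; lra.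
  rewrite modulus_distC distrC.
  apply: (@le_trans _ _ (2 * (eta / 4) * (a - z))).
    apply: (@modulus_mean_value (fun y => U e' y - U e y)
      (fun y => V e' y - V e y)) => [|y ayz|y ayz];
      [exact: ltW|apply: dW; lra|apply: bW; lra].
  by rewrite ger0_norm ?subr_ge0 ?(ltW h)// ler_wpM2r ?subr_ge0 ?(ltW h)//; lra.
have h6 : modulus ((U0 z - U0 a) - (U e z - U e a)) <= eta / 2 * `|z - a|.
  apply: (@modulus_lim_le (fun e' => U e' z - U e' a)).
    by apply: cvgB; exact: cU.
  by apply: filterS (lt_near_right0 e0) => e' [e'0 ee]; exact: h5.
have h7 : modulus (difference_quotient U0 a z - difference_quotient (U e) a z)
    <= eta / 2.
  rewrite -mulrBl modulusM modulusV modulus_real ler_pdivrMr ?normr_gt0//.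
rewrite sub0r normrN ger0_norm ?modulus_ge0//.
have -> : difference_quotient U0 a z - V0 =
  (difference_quotient U0 a z - difference_quotient (U e) a z) +
  (difference_quotient (U e) a z - V e a) - (V0 - V e a) by ring.
rewrite (le_trans (modulusB _ _))//.
rewrite (le_trans (lerD (modulusD _ _) (lexx _)))//; lra.
Unshelve. all: by end_near. Qed.

End uniform_limits.

(** * Oscillatory integrals and their derivatives *)

Section oscillatory_integral.
Context {R : realType}.
Notation mu := (@lebesgue_measure R).
Implicit Types (x y b e g X A : R) (f : R -> R[i]).

Definition osc0 b x f : R[i] := lim (osc e b x f @[e --> 0^'+]).

(** All constants depend on [b], [x] and [f] only through the bounds [b0], [X]
    and [A]; this uniformity is what makes limits commute with derivatives. *)
Lemma osc0_rate n g X b0 : g < n%:R - 1 -> 0 <= X -> 0 < b0 ->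
  exists C d : R, [/\ 0 <= C, 0 < d & forall x b A f, `|x| <= X -> b0 <= b ->
    0 <= A -> Cbound setT n (fun y => A * wt g 0 y) f ->
    [/\ osc e b x f @[e --> 0^'+] --> osc0 b x f,
        forall e e', 0 < e' -> e' <= e -> e <= 1 ->
          modulus (osc e b x f - osc e' b x f) <= C * A * e `^ d,
        forall e, 0 < e -> e <= 1 ->
          modulus (osc0 b x f - osc e b x f) <= C * A * e `^ d
      & modulus (osc0 b x f) <= C * A]].
Proof.
move=> gn X0 b00.
have [C1 [d [C10 d0 h1]]] := osc_rate gn X0 b00.
have [C2 C20 h2] := osc_bound gn X0 b00.
exists (C1 + C2), d; split => //; first exact: addr_ge0.
move=> x b A f xX bb A0 hf.
have h e e' : 0 < e' -> e' <= e -> e <= 1 ->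
    modulus (osc e b x f - osc e' b x f) <= (C1 + C2) * A * e `^ d.
  move=> e'0 ee e1; rewrite (le_trans (h1 x b A f e e' xX bb A0 hf e'0 ee e1))//.
  by rewrite ler_wpM2r ?powR_ge0// ler_wpM2r// lerDl.
have CA0 : 0 <= (C1 + C2) * A by rewrite mulr_ge0// addr_ge0.
have [l hl hle] := rate_cvg d0 CA0 h.
have lE : osc0 b x f = l by exact: cvg_lim.
rewrite lE; split => //.
rewrite -[l]subr0; apply: (modulus_lim_le hl).
apply: filterS (lt_near_right0 ltr01) => e [e0 e1].
rewrite subr0 (le_trans (h2 x b A f e xX bb A0 hf e0 e1))//.
by rewrite ler_wpM2r// lerDr.
Qed.

Lemma osc0_cvg n g b x A f : g < n%:R - 1 -> 0 < b -> 0 <= A ->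
  Cbound setT n (fun y => A * wt g 0 y) f ->
  osc e b x f @[e --> 0^'+] --> osc0 b x f.
Proof.
move=> gn b0 A0 hf; have [C [d [_ _ h]]] := osc0_rate gn (normr_ge0 x) b0.
by have [] := h x b A f (lexx _) (lexx _) A0 hf.
Qed.

Lemma oscD e b x f1 f2 g A1 A2 : 0 < e ->
  Cbound setT 0 (fun y => A1 * wt g 0 y) f1 ->
  Cbound setT 0 (fun y => A2 * wt g 0 y) f2 ->
  osc e b x (fun y => f1 y + f2 y) = osc e b x f1 + osc e b x f2.
Proof.
move=> e0 h1 h2; rewrite /osc -cintegralD//.
- by congr cintegral; apply/funext => y; rewrite /osc_integrand; ring.
- exact: (osc_integrand_integrable _ _ e0 (fun y => Cbound_continuous h1 I)
    (fun y => Cbound_bound h1 I)).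
- exact: (osc_integrand_integrable _ _ e0 (fun y => Cbound_continuous h2 I)
    (fun y => Cbound_bound h2 I)).
Qed.

Lemma oscZ e b x (c : R[i]) f g A : 0 < e ->
  Cbound setT 0 (fun y => A * wt g 0 y) f ->
  osc e b x (fun y => c * f y) = c * osc e b x f.
Proof.
move=> e0 h; rewrite /osc -cintegralZ//.
- by congr cintegral; apply/funext => y; rewrite /osc_integrand; ring.
- exact: (osc_integrand_integrable _ _ e0 (fun y => Cbound_continuous h I)
    (fun y => Cbound_bound h I)).
Qed.

Lemma Cbound0 D m w f : Cbound D m w f -> Cbound D 0 w f.
Proof. by case: m => [//|m] [h _]. Qed.

Lemma eq_cvg_right0 (T : Type) (u v : R -> T) :
  (forall e, 0 < e -> u e = v e) -> v e @[e --> 0^'+] `=>` u e @[e --> 0^'+].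
Proof.
move=> uv; apply: near_eq_cvg; near=> e; apply: uv.
by near: e; exact: nbhs_right_gt.
Unshelve. all: by end_near. Qed.

Lemma osc0D n b x f1 f2 g A1 A2 : g < n%:R - 1 -> 0 < b -> 0 <= A1 -> 0 <= A2 ->
  Cbound setT n (fun y => A1 * wt g 0 y) f1 ->
  Cbound setT n (fun y => A2 * wt g 0 y) f2 ->
  osc0 b x (fun y => f1 y + f2 y) = osc0 b x f1 + osc0 b x f2.
Proof.
move=> gn b0 A10 A20 h1 h2; apply: cvg_lim => //.
have h : osc e b x f1 + osc e b x f2 @[e --> 0^'+] --> osc0 b x f1 + osc0 b x f2.
  exact: cvgD (osc0_cvg (x := x) gn b0 A10 h1) (osc0_cvg (x := x) gn b0 A20 h2).
refine (cvg_trans (eq_cvg_right0 _) h) => e e0 /=.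
by rewrite (oscD b x e0 (Cbound0 h1) (Cbound0 h2)).
Qed.

Lemma osc0Z n b x (c : R[i]) f g A : g < n%:R - 1 -> 0 < b -> 0 <= A ->
  Cbound setT n (fun y => A * wt g 0 y) f ->
  osc0 b x (fun y => c * f y) = c * osc0 b x f.
Proof.
move=> gn b0 A0 h1; apply: cvg_lim => //.
have /cvg_modulus h := osc0_cvg (x := x) gn b0 A0 h1.
have h' : modulus c * modulus (osc e b x f - osc0 b x f) @[e --> 0^'+]
    --> modulus c * 0 by exact: cvgM (cvg_cst _) h.
rewrite mulr0 in h'; apply/cvg_modulus.
refine (cvg_trans (eq_cvg_right0 _) h') => e e0 /=.
by rewrite (oscZ b x c e0 (Cbound0 h1)) -mulrBr modulusM.
Qed.

(** At a fixed cut-off this is differentiation under the integral sign, and the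
    derivatives converge uniformly in the parameter by [osc0_rate].  The
    parameter may enter through [b], [x] and [f], so that derivatives in space,
    in time and in the phase parameter are all instances. *)
Lemma is_cderive_osc0 n g (bp xp : R -> R) (Q Q1 : R -> R -> R[i])
    (u v p0 b0 X A : R) : g < n%:R - 1 -> 0 < b0 -> 0 <= X -> 0 <= A ->
  u < p0 < v ->
  (forall p, u < p < v -> b0 <= bp p) ->
  (forall p, u < p < v -> `|xp p| <= X) ->
  (forall p, u < p < v -> Cbound setT n (fun y => A * wt g 0 y) (Q p)) ->
  (forall p, u < p < v -> Cbound setT n (fun y => A * wt g 0 y) (Q1 p)) ->
  (forall p y, u < p < v ->
     is_cderive (fun p => expi (bp p * (y - xp p) ^+ 2) * Q p y) p
       (expi (bp p * (y - xp p) ^+ 2) * Q1 p y)) ->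
  is_cderive (fun p => osc0 (bp p) (xp p) (Q p)) p0
    (osc0 (bp p0) (xp p0) (Q1 p0)).
Proof.
move=> gn b00 X0 A0 uv hb hx hQ hQ1 dQ.
have [C [d [C0 d0 h]]] := osc0_rate gn X0 b00.
apply: (@is_cderive_limit _ (fun e p => osc e (bp p) (xp p) (Q p))
  (fun e p => osc e (bp p) (xp p) (Q1 p)) _ _ u v p0 (C * A) d) => //.
- exact: mulr_ge0.
- move=> p e uvp e0 e1.
  apply: (@is_cderive_cintegral _
    (fun p => osc_integrand e (bp p) (xp p) (Q p))
    (fun p => osc_integrand e (bp p) (xp p) (Q1 p)) u v p
    (fun y => A * wt g e y)) => //.
  + move=> q uvq; exact: (osc_integrand_integrable _ _ e0
      (fun y => Cbound_continuous (hQ q uvq) I)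
      (fun y => Cbound_bound (hQ q uvq) I)).
  + by move=> q y uvq; apply: is_cderiveZ; exact: dQ.
  + by apply: integrable_cmul => //; exact: integrable_wt.
  + by move=> q y uvq; apply: osc_integrand_le; exact: Cbound_bound (hQ1 q uvq) _ I.
- move=> p e e' uvp; have [_ h1 _ _] := h _ _ _ _ (hx p uvp) (hb p uvp) A0 (hQ1 p uvp).
  exact: h1.
- by move=> p uvp; have [] := h _ _ _ _ (hx p uvp) (hb p uvp) A0 (hQ p uvp).
- by have [] := h _ _ _ _ (hx p0 uv) (hb p0 uv) A0 (hQ1 p0 uv).
Qed.

Lemma Cbound_subr n x : Cbound setT n (fun y => (1 + `|x|) * wt 1 0 y)
  (fun y => (y - x)%:C).
Proof.
have wx y : modulus (y - x)%:C <= (1 + `|x|) * wt 1 0 y.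
  rewrite modulus_real wt0r powRr1 ?(ltW (weight_gt0 _))// /weight.
  rewrite (le_trans (ler_normB _ _))//.
  have := mulr_ge0 (normr_ge0 x) (normr_ge0 y); lra.
have cx y : ccontinuous_at (fun y => (y - x)%:C) y.
  exact: is_cderive_continuous (is_cderive_real (is_derive_sub x y)).
case: n => [|n]; first by split.
split => //; exists (fun=> 1%:C); split.
  by move=> y _; exact: is_cderive_real (is_derive_sub x y).
apply: Cbound_le (Cbound_cst _ _ _) => y _; rewrite modulus_real normr1.
rewrite wt0r powRr1 ?(ltW (weight_gt0 _))// -[leLHS]mul1r.
by rewrite ler_pM// ?weight_ge1// lerDl.
Qed.

(** Families of amplitudes with a common bound on [P]: it is stable under the
    operations that occur when the Green function is differentiated, the
    weights of products being added. *)
Definition Cfamily (P : set R) n g (Q : R -> R -> R[i]) : Prop :=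
  exists2 A : R, 0 <= A &
    forall p, P p -> Cbound setT n (fun y => A * wt g 0 y) (Q p).

Lemma CfamilyD P n g Q1 Q2 : Cfamily P n g Q1 -> Cfamily P n g Q2 ->
  Cfamily P n g (fun p y => Q1 p y + Q2 p y).
Proof.
move=> [A1 A10 h1] [A2 A20 h2]; exists (A1 + A2); first exact: addr_ge0.
move=> p Pp; apply: Cbound_le (CboundD (h1 p Pp) (h2 p Pp)) => y _.
by rewrite mulrDl.
Qed.

Lemma CfamilyM P n g1 g2 Q1 Q2 : Cfamily P n g1 Q1 -> Cfamily P n g2 Q2 ->
  Cfamily P n (g1 + g2) (fun p y => Q1 p y * Q2 p y).
Proof.
move=> [A1 A10 h1] [A2 A20 h2]; exists (2 ^+ n * (A1 * A2)).
  by rewrite !mulr_ge0// exprn_ge0.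
move=> p Pp; apply: Cbound_le (CboundM (h1 p Pp) (h2 p Pp)) => y _.
have -> : wt (g1 + g2) 0 y = wt g1 0 y * wt g2 0 y by rewrite wtM addr0.
by rewrite le_eqVlt; apply/orP; left; apply/eqP; ring.
Qed.

Lemma CfamilyZ P n g (c : R -> R[i]) M Q : (forall p, P p -> modulus (c p) <= M) ->
  Cfamily P n g Q -> Cfamily P n g (fun p y => c p * Q p y).
Proof.
move=> hc [A A0 h]; exists (`|M| * A); first exact: mulr_ge0.
move=> p Pp; apply: Cbound_le (CboundZ (c p) (h p Pp)) => y _.
rewrite mulrA ler_wpM2r ?wt_ge0// ler_wpM2r//.
by rewrite (le_trans (hc p Pp))// ler_norm.
Qed.

Lemma Cfamily_le P n g g' Q : g <= g' -> Cfamily P n g Q -> Cfamily P n g' Q.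
Proof.
move=> gg [A A0 h]; exists A => // p Pp; apply: Cbound_le (h p Pp) => y _.
by rewrite ler_wpM2l// wt_le.
Qed.

Lemma Cfamily_subr P n X (xp : R -> R) : (forall p, P p -> `|xp p| <= X) ->
  Cfamily P n 1 (fun p y => (y - xp p)%:C).
Proof.
move=> hx; exists (1 + `|X|); first by rewrite addr_ge0.
move=> p Pp; apply: Cbound_le (Cbound_subr n (xp p)) => y _.
by rewrite ler_wpM2r ?wt_ge0// lerD2l (le_trans (hx p Pp))// ler_norm.
Qed.

Lemma Cfamily_cst P n g A f : 0 <= A ->
  Cbound setT n (fun y => A * wt g 0 y) f -> Cfamily P n g (fun=> f).
Proof. by move=> A0 h; exists A. Qed.

End oscillatory_integral.

(** * Absolute continuity from dominated increments *)

Section absolute_continuity.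
Context {R : realType}.
Notation mu := (@lebesgue_measure R).
Implicit Types (f g u m rho : R -> R) (s p q h : R).

Lemma derive_seq u s (l : R) (h : nat -> R) : is_derive s 1 u l ->
  (forall k, h k != 0) -> h k @[k --> \oo] --> (0 : R) ->
  (u (s + h k) - u s) / h k @[k --> \oo] --> l.
Proof.
move=> /is_derive_quotient/cvgr_dnbhsP du h0 hcvg.
have E k : s + h k - s = h k by ring.
have : (u (s + h k) - u s) / (s + h k - s) @[k --> \oo] --> l.
  apply: (du (fun k => s + h k)); split.
    by move=> k; rewrite -subr_eq0 E.
  by rewrite -[X in _ --> X]addr0; apply: cvgD => //; exact: cvg_cst.
by under eq_fun do rewrite E.
Qed.

(** The integral of the difference quotient of a continuous [u] of step [h] is
    a difference of difference quotients of a primitive of [u], which converges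
    to [u s2 - u s1] as [h] tends to [0]; the quotients are nonnegative, so
    Fatou's lemma applies.  As for the Cantor function, nothing better than an
    inequality can be expected. *)
Lemma monotone_derivative u g p q s1 s2 : p < s1 -> s1 < s2 -> s2 < q ->
  (forall s s', p <= s -> s <= s' -> s' <= q -> u s <= u s') ->
  (forall s, p <= s <= q -> {for s, continuous u}) ->
  measurable_fun `[s1, s2] g ->
  {ae mu, forall s, s1 <= s <= s2 -> is_derive s 1 u (g s)} ->
  mu.-integrable `[s1, s2] (EFin \o g) /\
  \int[mu]_(s in `[s1, s2]) g s <= u s2 - u s1.
Proof.
move=> ps ss sq nd cu mg dg.
(* steps that keep s2 + h k inside of [p, q] *)
pose h (k : nat) : R := (q - s2) / k.+2%:R.
have h0 k : 0 < h k by rewrite divr_gt0 ?subr_gt0.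
have hq k : h k < q - s2 by rewrite ltr_pdivrMr// ltr_pMr ?subr_gt0// ltr1n.
have hn0 k : h k != 0 by rewrite gt_eqF.
have hcvg : h k @[k --> \oo] --> (0 : R).
  have h1 : (q - s2) * (k.+2%:R)^-1 @[k --> \oo] --> (q - s2) * 0.
    apply: cvgM; first exact: cvg_cst.
    have := @cvg_harmonic R; rewrite -(cvg_shiftn 1); apply: cvg_trans.
    by apply: near_eq_cvg; apply: nearW => k /=; rewrite addn1.
  by rewrite mulr0 in h1.
have iu : mu.-integrable `[p, q] (EFin \o u).
  apply: continuous_compact_integrable; first exact: segment_compact.
  by apply: continuous_in_subspaceT => s /set_mem /=; rewrite in_itv/=; exact: cu.
pose U s := \int[mu]_(y in `[p, s]) u y.
have dU s : p < s < q -> is_derive s 1 U (u s).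
  move=> /andP[p1 q1].
  have cus : {for s, continuous u} by apply: cu; rewrite !ltW.
  have [d1 d2] := continuous_FTC1_closed q1 iu p1 cus.
  by apply: DeriveDef => //; rewrite -derive1E.
pose Dk k s := (u (s + h k) - u s) / h k.
have cD k s : s1 <= s <= s2 -> {for s, continuous (Dk k)}.
  move=> /andP[a1 a2]; apply: cvgM; last exact: cvg_cst.
  apply: cvgB; last by apply: cu; lra.
  have c1 : {for s + h k, continuous u}.
    by apply: cu; have := h0 k; have := hq k; lra.
  apply: (@continuous_comp _ _ _ (fun s => s + h k) u) => //.
  by apply: cvgD; [exact: cvg_id|exact: cvg_cst].
have D0 k s : s1 <= s <= s2 -> 0 <= Dk k s.
  move=> /andP[a1 a2]; rewrite divr_ge0 ?(ltW (h0 k))// subr_ge0 nd//.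
  - lra.
  - by rewrite lerDl ltW.
  - have := hq k; lra.
have mD k : measurable_fun `[s1, s2] (Dk k).
  apply: subspace_continuous_measurable_fun => //.
  by apply: continuous_in_subspaceT => s /set_mem /=; rewrite in_itv/=; exact: cD.
pose Phi k s := (U (s + h k) - U s) / h k.
have iD k : \int[mu]_(s in `[s1, s2]) Dk k s = Phi k s2 - Phi k s1.
  apply: Rintegral_FTC => // [s /andP[a1 a2]|s as12]; last exact: cD.
  have d1 : is_derive (s + h k) 1 U (u (s + h k)).
    by apply: dU; have := h0 k; have := hq k; lra.
  have d2 : is_derive s 1 U (u s) by apply: dU; lra.
  have d3 : is_derive s 1 (fun s => s + h k) 1.
    by apply: (is_derive_eq (is_deriveD (is_derive_id s 1)
      (is_derive_cst (h k) s 1))); rewrite addr0.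
  have E : Phi k = (h k)^-1 \*: ((U \o (fun s => s + h k)) - U).
    by apply/funext => z; rewrite /Phi /= mulrC.
  rewrite E; apply: (is_derive_eq (is_deriveZ (h k)^-1 (is_deriveB
    (@is_derive1_comp _ U (fun s => s + h k) s _ _ d1 d3) d2))).
  by rewrite mulr1 /Dk /GRing.scale/= mulrC.
have cPhi : Phi k s2 - Phi k s1 @[k --> \oo] --> u s2 - u s1.
  by apply: cvgB; apply: derive_seq => //; apply: dU; lra.
have iDE k : (\int[mu]_(s in `[s1, s2]) (Dk k s)%:E = (Phi k s2 - Phi k s1)%:E)%E.
  rewrite -iD /Rintegral fineK//; apply: integrable_fin_num => //.
  apply: continuous_compact_integrable; first exact: segment_compact.
  by apply: continuous_in_subspaceT => s /set_mem /=; rewrite in_itv/=; exact: cD.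
have mE k : measurable_fun `[s1, s2] (fun s => (Dk k s)%:E).
  exact/measurable_EFinP.
have fat := @fatou _ _ _ mu `[s1, s2]%classic (measurable_itv _)
  (fun k s => (Dk k s)%:E) mE _.
have {}fat : (\int[mu]_(s in `[s1, s2]) limn_einf (fun k => (Dk k s)%:E) <=
    (u s2 - u s1)%:E)%E.
  apply: le_trans (fat _) _.
    by move=> k s /=; rewrite in_itv/= lee_fin; exact: D0.
  under [X in limn_einf X]eq_fun do rewrite iDE.
  have cE : (Phi k s2 - Phi k s1)%:E @[k --> \oo] --> (u s2 - u s1)%:E.
    by apply: cvg_EFin => //; exact: nearW.
  rewrite is_cvg_limn_einfE; last by apply/cvg_ex; eexists; exact: cE.
  by rewrite (cvg_lim _ cE).
have aeg : {ae mu, forall s, `[s1, s2]%classic s ->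
    limn_einf (fun k => (Dk k s)%:E) = `|(g s)%:E|%E}.
  apply: (@filterS _ _ (ae_filter_ringOfSetsType mu) _ _ _ dg) => s dgs; rewrite /= in_itv/= => ss12.
  have cE : (Dk k s)%:E @[k --> \oo] --> (g s)%:E.
    by apply: cvg_EFin; [exact: nearW|exact: derive_seq (dgs ss12) hn0 hcvg].
  rewrite is_cvg_limn_einfE; last by apply/cvg_ex; eexists; exact: cE.
  have gE : lim ((Dk k s)%:E @[k --> \oo]) = (g s)%:E by exact: cvg_lim cE.
  have g0 : 0 <= g s.
    rewrite -lee_fin -gE; apply: lime_ge; first by apply/cvg_ex; eexists; exact: cE.
    by apply: nearW => k; rewrite lee_fin D0.
  by rewrite gE /= ger0_norm.
have mgE : measurable_fun `[s1, s2] (EFin \o g) by exact/measurable_EFinP.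
have mga : measurable_fun `[s1, s2] (fun s => `|(g s)%:E|%E).
  exact: measurableT_comp.
have ml : measurable_fun `[s1, s2] (fun s => limn_einf (fun k => (Dk k s)%:E)).
  rewrite /limn_einf; apply: measurableT_comp => //.
  by apply: measurable_fun_limn_esup => k; apply: measurableT_comp.
have E : (\int[mu]_(s in `[s1, s2]) limn_einf (fun k => (Dk k s)%:E) =
    \int[mu]_(s in `[s1, s2]) `|(g s)%:E|)%E by exact: ae_eq_integral.
rewrite E in fat.
have ig : mu.-integrable `[s1, s2] (EFin \o g).
  by apply/integrableP; split => //; rewrite (le_lt_trans fat)// ltry.
split => //.
have h1 : `|\int[mu]_(s in `[s1, s2]) g s| <= \int[mu]_(s in `[s1, s2]) `|g s|.
  exact: le_normr_Rintegral.
rewrite (le_trans (ler_norm _))// (le_trans h1)//.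
rewrite -lee_fin (le_trans _ fat)// /Rintegral fineK//.
by apply: integrable_fin_num => //; exact: integrable_norm.
Qed.

End absolute_continuity.

Section absolute_continuity_criterion.
Context {R : realType}.
Notation mu := (@lebesgue_measure R).
Implicit Types (rho phi : R -> R) (f : R -> R[i]) (I : set R) (s p q : R).

(** With [m] a primitive of [rho], both [m + phi] and [m - phi] are
    nondecreasing, so [monotone_derivative] bounds the integrals of [rho + g]
    and of [rho - g] by the corresponding increments.  The two bounds add up to
    an equality for [rho], hence both are equalities. *)
Lemma dominated_increments phi rho g p q s1 s2 : p < s1 -> s1 < s2 -> s2 < q ->
  mu.-integrable `[p, q] (EFin \o rho) ->
  (forall s s', p <= s -> s < s' -> s' <= q ->
    `|phi s' - phi s| <= \int[mu]_(y in `[s, s']) rho y) ->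
  (forall s, p <= s <= q -> {for s, continuous phi}) ->
  measurable_fun `[s1, s2] g ->
  {ae mu, forall s, s1 <= s <= s2 -> is_derive s 1 phi (g s)} ->
  mu.-integrable `[s1, s2] (EFin \o g) /\
  \int[mu]_(s in `[s1, s2]) g s = phi s2 - phi s1.
Proof.
move=> ps ss sq irho hphi cphi mg dg.
(* extended by 0, so that its primitive is defined and continuous beyond q *)
pose rho' := rho \_ `[p, q].
have irho' : mu.-integrable setT (EFin \o rho').
  rewrite -restrict_EFin; apply/integrable_restrict => //=.
  by rewrite setTI.
have irhoS (D : set R) : measurable D -> mu.-integrable D (EFin \o rho').
  by move=> mD; exact: integrableS irho'.
pose m s := \int[mu]_(y in `[p, s]) rho' y.
have mE s s' : p <= s -> s < s' -> s' <= q ->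
    m s' - m s = \int[mu]_(y in `[s, s']) rho y.
  move=> h1 h2 h3; rewrite /m.
  rewrite (@Rintegral_itvB _ rho' (BLeft p) (BRight s') s); first last.
  - by rewrite bnd_simp ltW.
  - by rewrite bnd_simp.
  - exact: irhoS.
  rewrite Rintegral_itv_obnd_cbnd; last exact: irhoS.
  apply: eq_Rintegral => y; rewrite inE/= in_itv/= => /andP[a1 a2].
  by rewrite /rho' patchE mem_set//= in_itv/= (le_trans h1 a1) (le_trans a2 h3).
have cm s : p < s -> {for s, continuous m}.
  move=> psl; have ps1 : p <= s + 1 by lra.
  have := @parameterized_integral_continuous _ p (s + 1) rho' ps1 (irhoS _ (measurable_itv _)).
  rewrite continuous_within_itvP; last lra.
  move=> [h _ _]; by apply: h; rewrite in_itv/= psl/= ltrDl.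
have dm : {ae mu, forall s, p < s -> is_derive s 1 m (rho' s)}.
  have l1 : locally_integrable setT rho' by apply: open_integrable_locally; [exact: openT|exact: irho'].
  have l2 : forall y : R, mu.-integrable [set` Interval (BLeft p) (BRight y)]
    (EFin \o rho') by move=> y; exact: irhoS.
  apply: (@filterS _ _ (ae_filter_ringOfSetsType mu) _ _ _ (FTC1 l2 l1)).
  move=> s /= h ps'; have [|h1 h2] := h; first by rewrite lte_fin.
  have h3 : 'D_1 m s = rho' s by rewrite -derive1E.
  exact: DeriveDef h1 h3.
(* the primitive m is continuous on the right of p only *)
pose p' := (p + s1) / 2; pose q' := (s2 + q) / 2.
have mrho : measurable_fun `[s1, s2] rho'.
  by apply/measurable_EFinP; have /integrableP[] := irhoS _ (measurable_itv `[s1, s2]).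
have key (e : R) : e = 1 \/ e = -1 ->
    mu.-integrable `[s1, s2] (EFin \o (fun s => rho' s + e * g s)) /\
    \int[mu]_(s in `[s1, s2]) (rho' s + e * g s) <=
      (m s2 + e * phi s2) - (m s1 + e * phi s1).
  move=> e1; apply: (@monotone_derivative _ (fun s => m s + e * phi s) _ p' q').
  - by rewrite /p'; lra.
  - by [].
  - by rewrite /q'; lra.
  - move=> s s' h1 h2 h3; move: h2; rewrite le_eqVlt => /orP[/eqP->//|h2].
    have p's : p <= s by move: h1; rewrite /p'; lra.
    have s'q : s' <= q by move: h3; rewrite /q'; lra.
    have := hphi s s' p's h2 s'q; rewrite -mE// ler_norml.
    by case: e1 => ->; lra.
  - move=> s /andP[h1 h2]; apply: cvgD.
      by apply: cm; move: h1; rewrite /p'; lra.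
    apply: cvgM; first exact: cvg_cst.
    by apply: cphi; move: h1 h2; rewrite /p' /q'; lra.
  - by apply: measurable_funD => //; apply: measurable_funM.
  - apply: (@filterS2 _ _ (ae_filter_ringOfSetsType mu) _ _ _ _ dm dg).
    move=> s h1 h2 ss12; apply: is_deriveD; first by apply: h1; lra.
    exact: is_deriveZ (h2 ss12).
have [i1 h1] := key 1 (or_introl erefl).
have [i2 h2] := key (-1) (or_intror erefl).
have irho12 := irhoS _ (measurable_itv `[s1, s2]).
have ig : mu.-integrable `[s1, s2] (EFin \o g).
  apply: eq_integrable (integrableB _ i1 irho12) => // s _ /=.
  by rewrite -EFinB mul1r addrAC subrr add0r.
split => //.
move: h1 h2; rewrite !RintegralD//; [|exact: integrable_cmul..].
rewrite !RintegralZl//.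
have e1 : m s2 - m s1 = \int[mu]_(y in `[s1, s2]) rho' y.
  rewrite mE ?(ltW ps) ?(ltW sq)//.
  apply: eq_Rintegral => y; rewrite inE/= in_itv/= => /andP[a1 a2].
  by rewrite /rho' patchE mem_set//= in_itv/=; apply/andP; split; lra.
rewrite -e1 => h1 h2; apply/eqP; rewrite eq_le; apply/andP; split; lra.
Qed.

Let stepk (k : nat) : R := k.+1%:R^-1.

(** Equal to the derivative of [phi] wherever that exists on [I], and measurable
    as an upper limit of a sequence. *)
Let density I phi s : R := fine (limn_esup (fun k =>
  (((phi \_ I) (s + stepk k) - (phi \_ I) s) / stepk k)%:E)).

Let measurable_density I phi : open I -> (forall s, I s -> {for s, continuous phi}) ->
  measurable_fun setT (density I phi).
Proof.
move=> oI cphi.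
have mphi : measurable_fun setT (phi \_ I).
  apply/(measurable_restrictT _ _).1; first exact: open_measurable.
  by apply: open_continuous_measurable_fun => // s /set_mem/cphi.
apply: measurableT_comp => //.
apply: measurable_fun_limn_esup => k; apply/measurable_EFinP.
apply: measurable_funM => //; apply: measurable_funB => //.
apply: (measurableT_comp mphi); exact: measurable_funD.
Qed.

Let densityE I phi s l : open I -> I s -> is_derive s 1 phi l ->
  density I phi s = l.
Proof.
move=> oI Is dphi.
have sc : stepk k @[k --> \oo] --> (0 : R) by exact: cvg_harmonic.
have h : ((phi \_ I) (s + stepk k) - (phi \_ I) s) / stepk k @[k --> \oo] --> l.
  have h0 : forall k, stepk k != 0 by move=> k; rewrite invr_eq0.
  have := derive_seq dphi h0 sc; apply: cvg_trans; apply: near_eq_cvg.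
  have nI : \forall k \near \oo, I (s + stepk k).
    have : s + stepk k @[k --> \oo] --> s + 0 by apply: cvgD => //; exact: cvg_cst.
    by rewrite addr0; apply; exact: open_nbhs_nbhs.
  by apply: filterS nI => k Ik; rewrite !patchE !mem_set.
have hE : (((phi \_ I) (s + stepk k) - (phi \_ I) s) / stepk k)%:E
    @[k --> \oo] --> l%:E.
  by apply: cvg_EFin => //; exact: nearW.
rewrite /density is_cvg_limn_esupE; last by apply/cvg_ex; eexists; exact: hE.
have -> : lim ((((phi \_ I) (s + stepk k) - (phi \_ I) s) / stepk k)%:E
    @[k --> \oo]) = l%:E by exact: cvg_lim hE.
by [].
Qed.

Lemma open_left I s : open I -> I s -> exists2 p, I p & p < s.
Proof.
move=> oI Is; have : \forall y \near s, I y by exact: open_nbhs_nbhs.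
move=> /nbhs_ballP[e /= e0 h]; exists (s - e / 2).
  apply: h; rewrite /ball/= opprB addrC subrK gtr0_norm ?divr_gt0//; lra.
by rewrite gtrBl divr_gt0.
Qed.

Lemma open_right I s : open I -> I s -> exists2 p, I p & s < p.
Proof.
move=> oI Is; have : \forall y \near s, I y by exact: open_nbhs_nbhs.
move=> /nbhs_ballP[e /= e0 h]; exists (s + e / 2).
  apply: h; rewrite /ball/= opprD addrA subrr add0r normrN gtr0_norm ?divr_gt0//; lra.
by rewrite ltrDl divr_gt0.
Qed.

(** The derivative, given almost everywhere, integrates to [f] on segments by
    [dominated_increments]; a compact subset of [I] lies in such a segment, whence
    local integrability. *)
Lemma loc_AC_dominated I f : open I -> is_interval I ->
  (forall p q, I p -> I q -> p < q -> exists2 rho,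
     mu.-integrable `[p, q] (EFin \o rho) &
     forall s s', p <= s -> s < s' -> s' <= q ->
       modulus (f s' - f s) <= \int[mu]_(y in `[s, s']) rho y) ->
  (forall s, I s -> ccontinuous_at f s) ->
  {ae mu, forall s, I s -> cderivable f s} ->
  loc_AC I f.
Proof.
move=> oI iI dom cf df.
have main (pr : R[i] -> R) : (forall z w, pr (z - w) = pr z - pr w) ->
    (forall z, `|pr z| <= modulus z) ->
    (forall s, I s -> {for s, continuous (fun s => pr (f s))}) ->
    {ae mu, forall s, I s -> derivable (fun s => pr (f s)) s 1} ->
    let g := density I (fun s => pr (f s)) in
    locally_integrable I g /\ forall s1 s2, I s1 -> I s2 -> s1 < s2 ->
      pr (f s2) - pr (f s1) = \int[mu]_(s in `[s1, s2]) g s.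
  move=> prB prm cpr dpr g.
  have loc s1 s2 : I s1 -> I s2 -> s1 < s2 ->
      mu.-integrable `[s1, s2] (EFin \o g) /\
      \int[mu]_(s in `[s1, s2]) g s = pr (f s2) - pr (f s1).
    move=> I1 I2 s12; have [p Ip ps] := open_left oI I1.
    have [q Iq sq] := open_right oI I2.
    have pq : p < q by rewrite (lt_trans ps)// (lt_trans s12).
    have [rho irho hrho] := dom p q Ip Iq pq.
    apply: (@dominated_increments (fun s => pr (f s)) rho g p q) => //.
    - by move=> s s' h1 h2 h3; rewrite -prB (le_trans (prm _))// hrho.
    - by move=> s ss; apply: cpr; exact: iI ss.
    - by apply: (@measurable_funS _ _ _ _ setT) => //; exact: measurable_density.
    - apply: (@filterS _ _ (ae_filter_ringOfSetsType mu) _ _ _ dpr).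
      move=> s h ss; have Is : I s by exact: (iI s1 s2).
      have ds := derivableP (h Is).
      by rewrite /g (densityE oI Is ds).
  split; last by move=> s1 s2 I1 I2 s12; have [] := loc s1 s2 I1 I2 s12.
  split => //.
    by apply: (@measurable_funS _ _ _ _ setT) => //; exact: measurable_density.
  move=> K KI cK.
  have [->|/set0P K0] := eqVneq K set0; first by rewrite integral_set0.
  have cid : {within K, continuous (id : R -> R)} by apply: continuous_subspaceT => ?.
  have [a /set_mem Ka aK] := compact_EVT_min K0 cK cid.
  have [b /set_mem Kb bK] := compact_EVT_max K0 cK cid.
  have [s1 I1 s1a] := open_left oI (KI a Ka).
  have [s2 I2 bs2] := open_right oI (KI b Kb).
  have ab : a <= b by apply: bK; exact: mem_set.
  have s12 : s1 < s2 by lra.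
  have [/integrableP[mg ig] _] := loc s1 s2 I1 I2 s12.
  apply: le_lt_trans ig; apply: ge0_subset_integral => //.
  - exact: compact_measurable.
  - by apply/measurable_EFinP; apply: measurableT_comp => //; exact/measurable_EFinP.
  - move=> y Ky; rewrite /= in_itv/=.
    have := aK y (mem_set Ky); have := bK y (mem_set Ky); lra.
have d1 : {ae mu, forall s, I s -> derivable (fun s => complex.Re (f s)) s 1}.
  apply: (@filterS _ _ (ae_filter_ringOfSetsType mu) _ _ _ df) => s h /h h1.
  by have [[]] : is_cderive f s (cderive f s) by apply/is_cderiveP.
have d2 : {ae mu, forall s, I s -> derivable (fun s => complex.Im (f s)) s 1}.
  apply: (@filterS _ _ (ae_filter_ringOfSetsType mu) _ _ _ df) => s h /h h1.
  by have [_ []] : is_cderive f s (cderive f s) by apply/is_cderiveP.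
have [l1 h1] := main (@complex.Re R) (@cReB R) (@normr_Re R)
  (fun s Is => (cf s Is).1) d1.
have [l2 h2] := main (@complex.Im R) (@cImB R) (@normr_Im R)
  (fun s Is => (cf s Is).2) d2.
exists (fun s => density I (fun s => complex.Re (f s)) s +i*
                 density I (fun s => complex.Im (f s)) s); split; first exact: (conj l1 l2).
move=> s1 s2 I1 I2 s12; rewrite [LHS]complex_eta cReB cImB /cintegral.
by congr (_ +i* _); [exact: h1|exact: h2].
Qed.

End absolute_continuity_criterion.

(** * Absolutely continuous and locally bounded functions *)

Section local_properties.
Context {R : realType}.
Notation mu := (@lebesgue_measure R).
Implicit Types (I : set R) (a ga : R -> R) (s p q t x : R).

Lemma times_open (T : \bar R) : open (times T).
Proof.
have -> : times T = [set t : R | 0 < t] `&` [set t : R | (t%:E < T)%E] by [].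
apply: openI; first exact: open_gt.
case: T => [T| |].
- rewrite (_ : [set t | _] = [set t : R | t < T]); first exact: open_lt.
  by apply/seteqP; split => t /=; rewrite lte_fin.
- rewrite (_ : [set t | _] = setT); first exact: openT.
  by apply/seteqP; split => t //= _; rewrite ltry.
- rewrite (_ : [set t | _] = set0); first exact: open0.
  by apply/seteqP; split => t //=.
Qed.

Lemma times_interval (T : \bar R) : is_interval (times T).
Proof.
move=> p q [p0 pT] [q0 qT] t /andP[pt tq]; split; first exact: lt_le_trans pt.
by rewrite (le_lt_trans _ qT)// lee_fin.
Qed.

Lemma locally_integrable_segment I ga p q : is_interval I -> I p -> I q ->
  locally_integrable I ga -> mu.-integrable `[p, q] (EFin \o ga).
Proof.
move=> iI Ip Iq [mg oI hg].
have sub : `[p, q] `<=` I by move=> t; rewrite /= in_itv/=; exact: iI.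
apply/integrableP; split; last exact: (hg _ sub (@segment_compact _ p q)).
by apply/measurable_EFinP; apply: (measurable_funS _ sub mg); exact: open_measurable.
Qed.

Lemma AC_continuous I a ga : open I -> is_interval I -> locally_integrable I ga ->
  (forall s1 s2, I s1 -> I s2 -> s1 < s2 ->
     a s2 - a s1 = \int[mu]_(y in `[s1, s2]) ga y) ->
  forall s, I s -> {for s, continuous a}.
Proof.
move=> oI iI lg ha s Is.
have [p Ip ps] := open_left oI Is; have [q Iq sq] := open_right oI Is.
have ig := locally_integrable_segment iI Ip Iq lg.
have pq : p <= q by lra.
have := parameterized_integral_continuous pq ig.
rewrite continuous_within_itvP; last lra.
move=> [h _ _]; have {}h : {for s, continuous (fun x => \int[mu]_(y in `[p, x]) ga y)}.
  by apply: h; rewrite in_itv/= ps sq.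
have h2 : {for s, continuous (fun x => a p + \int[mu]_(y in `[p, x]) ga y)}.
  by apply: cvgD; [exact: cvg_cst|exact: h].
have hE : forall t, p < t < q -> a p + \int[mu]_(y in `[p, t]) ga y = a t.
  move=> t /andP[pt tq]; rewrite -ha//; first by ring.
  by apply: (iI p q) => //; rewrite !ltW.
rewrite /prop_for /continuous_at -(hE s) ?ps ?sq//; apply: cvg_trans h2; apply: near_eq_cvg.
have : \forall t \near s, t \in `]p, q[.
  by apply: near_in_itvoo; rewrite in_itv/= ps sq.
by apply: filterS => t; rewrite in_itv/= => /hE ->.
Qed.

Lemma ae_forall_countable d (X : measurableType d) (nu : {measure set X -> \bar R})
    (K : countType) (P : K -> X -> Prop) :
  (forall k, {ae nu, forall z, P k z}) -> {ae nu, forall z, forall k, P k z}.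
Proof.
move=> h.
have : {ae nu, forall z, forall n : nat, if unpickle n is Some k then P k z else True}.
  apply/ae_foralln => n; case: unpickle => [k|]; first exact: h.
  exact: aeW.
apply: (@filterS _ _ (ae_filter_ringOfSetsType nu)) => z hz k.
by have := hz (pickle k); rewrite pickleK.
Qed.

(** Lebesgue's differentiation theorem on each of the countably many intervals
    with rational end points in [I]. *)
Lemma AC_derivable I a ga : open I -> is_interval I -> locally_integrable I ga ->
  (forall s1 s2, I s1 -> I s2 -> s1 < s2 ->
     a s2 - a s1 = \int[mu]_(y in `[s1, s2]) ga y) ->
  {ae mu, forall s, I s -> derivable a s 1}.
Proof.
move=> oI iI lg ha.
have loc p q : I p -> I q -> p < q -> {ae mu, forall s, p < s < q -> derivable a s 1}.
  move=> Ip Iq pq; pose g' := ga \_ `[p, q].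
  have ig' : mu.-integrable setT (EFin \o g').
    rewrite -restrict_EFin; apply/integrable_restrict => //=; rewrite setTI.
    exact: locally_integrable_segment lg.
  have l1 : locally_integrable setT g'.
    by apply: open_integrable_locally; [exact: openT|exact: ig'].
  have l2 : forall y : R, mu.-integrable [set` Interval (BLeft p) (BRight y)]
      (EFin \o g') by move=> y; exact: integrableS ig'.
  apply: (@filterS _ _ (ae_filter_ringOfSetsType mu) _ _ _ (FTC1 l2 l1)).
  move=> s /= h /andP[ps sq]; have [|dF _] := h; first by rewrite lte_fin.
  have dF2 : is_derive s 1 (fun x => a p + \int[mu]_(t in `[p, x]) g' t)
      (0 + 'D_1 (fun x => \int[mu]_(t in `[p, x]) g' t) s).
    exact: (is_deriveD (is_derive_cst (a p) s 1) (derivableP dF)).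
  suff : is_derive s 1 a (0 + 'D_1 (fun x => \int[mu]_(t in `[p, x]) g' t) s) by case.
  apply: is_derive_near dF2.
  have : \forall t \near s, t \in `]p, q[.
    by apply: near_in_itvoo; rewrite in_itv/= ps sq.
  apply: filterS => t; rewrite in_itv/= => /andP[pt tq].
  have It : I t by apply: (iI p q) => //; rewrite !ltW.
  have -> : \int[mu]_(y in `[p, t]) g' y = \int[mu]_(y in `[p, t]) ga y.
    apply: eq_Rintegral => y; rewrite inE/= in_itv/= => /andP[a1 a2].
    by rewrite /g' patchE mem_set//= in_itv/= a1 (le_trans a2 (ltW tq)).
  by rewrite -ha//; ring.
have : {ae mu, forall s, forall r : rat * rat,
    I (ratr r.1) -> I (ratr r.2) -> (ratr r.1 : R) < ratr r.2 ->
    ratr r.1 < s < ratr r.2 -> derivable a s 1}.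
  apply: ae_forall_countable => r.
  have [I1|nI1] := pselect (I (ratr r.1)); last by apply: aeW => s /nI1.
  have [I2|nI2] := pselect (I (ratr r.2)); last by apply: aeW => s _ /nI2.
  have [h|h] := ltP (ratr r.1 : R) (ratr r.2).
    apply: (@filterS _ _ (ae_filter_ringOfSetsType mu) _ _ _ (loc _ _ I1 I2 h)).
    by move=> s hs _ _ _; exact: hs.
  by apply: aeW => s _ _.
apply: (@filterS _ _ (ae_filter_ringOfSetsType mu)) => s h Is.
have [p Ip ps] := open_left oI Is; have [q Iq sq] := open_right oI Is.
have [r1] := rat_in_itvoo ps; rewrite in_itv/= => /andP[pr rs].
have [r2] := rat_in_itvoo sq; rewrite in_itv/= => /andP[sr rq].
apply: (h (r1, r2)) => /=.
- by apply: (iI p q) => //; rewrite !ltW// (lt_trans rs)// (lt_trans sr).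
- by apply: (iI p q) => //; rewrite !ltW// (lt_trans ps)// (lt_trans sr).
- exact: lt_trans rs sr.
- by rewrite rs.
Qed.

Lemma locally_bounded_t (T : \bar R) (N : R -> R -> R) p q x :
  locally_bounded T N -> times T p -> times T q ->
  exists M, forall t, p <= t <= q -> `|N t x| <= M.
Proof.
move=> hN Tp Tq.
have /compact_near_coveringP := @segment_compact _ p q.
move=> /(_ R (+oo : set_system R) (fun M t => `|N t x| <= M) _) h.
have : \forall M \near +oo, `[p, q] `<=` (fun t => `|N t x| <= M).
  apply: h => t /=; rewrite in_itv/= => /(times_interval Tp Tq) Tt.
  have [M [[A B] [/= At Bx] AB]] := hN t x Tt.
  exists (A, [set M' | M <= M']); first split => //=.
    by apply: nbhs_pinfty_ge; exact: num_real.
  move=> [t' M'] [/= At' MM']; apply: le_trans MM'.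
  by apply: (AB (t', x)); split => //=; exact: nbhs_singleton.
move=> /filter_ex[M hM]; exists M => t tpq; apply: (hM t).
by rewrite /= in_itv.
Qed.

Lemma locally_bounded_x (T : \bar R) (N : R -> R -> R) (X : R) t :
  locally_bounded T N -> times T t ->
  exists M, forall x, `|x| <= X -> `|N t x| <= M.
Proof.
move=> hN Tt.
have /compact_near_coveringP := @segment_compact _ (- X) X.
move=> /(_ R (+oo : set_system R) (fun M x => `|N t x| <= M) _) h.
have : \forall M \near +oo, `[- X, X] `<=` (fun x => `|N t x| <= M).
  apply: h => x _.
  have [M [[A B] [/= At Bx] AB]] := hN t x Tt.
  exists (B, [set M' | M <= M']); first split => //=.
    by apply: nbhs_pinfty_ge; exact: num_real.
  move=> [x' M'] [/= Bx' MM']; apply: le_trans MM'.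
  by apply: (AB (t, x')); split => //=; exact: nbhs_singleton.
move=> /filter_ex[M hM]; exists M => x xX; apply: (hM x).
by rewrite /= in_itv/= -ler_norml.
Qed.

(** For exchanging a quantifier over the reals with an almost everywhere
    quantifier: it suffices to treat the rationals. *)
Lemma ccontinuous_rat_eq0 (D : R -> R[i]) : (forall y, ccontinuous_at D y) ->
  (forall r : rat, D (ratr r) = 0) -> forall y, D y = 0.
Proof.
move=> cD Dr.
have main (phi : R -> R) y : {for y, continuous phi} ->
    (forall r : rat, phi (ratr r) = 0) -> phi y = 0.
  move=> cphi phir; apply/eqP; apply: contraT => phiy.
  have n0 : 0 < `|phi y| by rewrite normr_gt0.
  move/cvgrPdist_lt : cphi => /(_ _ n0) /nbhs_ballP[e /= e0 h].
  have yey : y < y + e by rewrite ltrDl.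
  have [r] := rat_in_itvoo yey; rewrite in_itv/= => /andP[yr re].
  have : ball y e (ratr r : R) by rewrite /ball/= distrC gtr0_norm ?subr_gt0//; lra.
  by move=> /h; rewrite /= phir subr0 ltxx.
move=> y; rewrite [LHS]complex_eta.
rewrite (main (fun y => complex.Re (D y)) y (cD y).1); last by move=> r; rewrite Dr.
by rewrite (main (fun y => complex.Im (D y)) y (cD y).2)// => r; rewrite Dr.
Qed.

End local_properties.

(** * Oscillatory integrals as functions of space *)

Section space_derivative.
Context {R : realType}.
Notation mu := (@lebesgue_measure R).
Implicit Types (I : set R) (f : R -> R[i]) (b g x y s p q : R).

Lemma Rintegral_itv_cst (c p q : R) : p <= q ->
  \int[mu]_(y in `[p, q]) c = c * (q - p).
Proof.
move=> pq; have E : mu `[p, q]%classic = (q - p)%:E.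
  rewrite lebesgue_measure_itv/= lte_fin; move: pq.
  by rewrite le_eqVlt => /orP[/eqP->|->//]; rewrite ltxx subrr.
transitivity (c * fine (mu `[p, q]%classic)); last by rewrite E.
exact: Rintegral_cst.
Qed.

(** The derivative need not be continuous; a locally bounded one makes [f]
    locally Lipschitz, and a constant dominates its increments. *)
Lemma loc_AC_bounded_derivative I f f' : open I -> is_interval I ->
  (forall s, I s -> is_cderive f s (f' s)) ->
  (forall p q, I p -> I q -> exists M, forall s, p <= s <= q -> modulus (f' s) <= M) ->
  loc_AC I f.
Proof.
move=> oI iI df bf; apply: loc_AC_dominated => //.
- move=> p q Ip Iq pq; have [M hM] := bf p q Ip Iq.
  exists (fun=> 2 * M).
    apply: continuous_compact_integrable; first exact: segment_compact.
    by apply: continuous_subspaceT => y; exact: cvg_cst.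
  move=> s s' ps ss sq; rewrite Rintegral_itv_cst ?(ltW ss)//.
  apply: modulus_mean_value; first exact: ltW.
    by move=> y yss; apply: df; apply: (iI p q) => //; lra.
  by move=> y yss; apply: hM; lra.
- by move=> s Is; exact: is_cderive_continuous (df s Is).
- by apply: aeW => s Is; have /is_cderiveP[] := df s Is.
Qed.

Lemma is_cderive_phase_x b x y :
  is_cderive (fun x => expi (b * (y - x) ^+ 2)) x
    (expi (b * (y - x) ^+ 2) * (- 2%:R * 'i%C * b%:C * (y - x)%:C)).
Proof.
have h : is_derive x 1 (fun x => b * (y - x) ^+ 2) (- (2 * b * (y - x))).
  have h1 : is_derive x 1 (fun x => y - x) (-1).
    by apply: (is_derive_eq (is_deriveB (is_derive_cst y x 1)
      (is_derive_id x 1))); rewrite sub0r.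
  apply: (is_derive_eq (is_deriveZ b (is_deriveX 2 h1))).
  by rewrite /GRing.scale/= expr1; ring.
have := is_cderive_comp (is_cderive_expi _) h.
set u := (X in is_cderive _ _ X -> _); set v := (X in _ -> is_cderive _ _ X).
suff -> : u = v by [].
rewrite /u /v rmorphN !rmorphM/= (_ : 2%:C = 2 :> R[i]); last first.
  by rewrite -(rmorph_nat (real_complex R) 2).
by ring.
Qed.

(** The amplitude of the [x]-derivative of [expi (b * (y - x) ^+ 2) * Q x y]:
    differentiating the phase costs one power of the weight. *)
Definition amplitude_x (Q Q' : R -> R -> R[i]) b : R -> R -> R[i] :=
  fun x y => Q' x y + (- 2%:R * 'i%C * b%:C) * ((y - x)%:C * Q x y).

Lemma Cfamily_common_bound (P : set R) n g (Q1 Q2 : R -> R -> R[i]) :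
  Cfamily P n g Q1 -> Cfamily P n g Q2 -> exists2 A : R, 0 <= A &
    forall p, P p -> Cbound setT n (fun y => A * wt g 0 y) (Q1 p) /\
                     Cbound setT n (fun y => A * wt g 0 y) (Q2 p).
Proof.
move=> [A1 A10 h1] [A2 A20 h2]; exists (A1 + A2); first exact: addr_ge0.
move=> p Pp; split.
  by apply: Cbound_le (h1 p Pp) => y _; rewrite ler_wpM2r ?wt_ge0// lerDl.
by apply: Cbound_le (h2 p Pp) => y _; rewrite ler_wpM2r ?wt_ge0// lerDr.
Qed.

Lemma Cfamily_amplitude_x (P : set R) n g X (Q Q' : R -> R -> R[i]) b :
  (forall x, P x -> `|x| <= X) -> Cfamily P n g Q -> Cfamily P n (g + 1) Q' ->
  Cfamily P n (g + 1) (amplitude_x Q Q' b).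
Proof.
move=> PX hQ hQ'; apply: CfamilyD => //.
apply: (@CfamilyZ _ _ _ _ (fun=> - 2%:R * 'i%C * b%:C) (modulus (- 2%:R * 'i%C * b%:C))).
  by [].
by rewrite addrC; apply: CfamilyM => //; exact: (@Cfamily_subr _ P n X id).
Qed.

Lemma is_cderive_osc0_x n g b (Q Q' : R -> R -> R[i]) x : g < n%:R - 1 -> 0 < b ->
  (forall X : R, Cfamily [set x | `|x| <= X] n g Q) ->
  (forall X : R, Cfamily [set x | `|x| <= X] n g (amplitude_x Q Q' b)) ->
  (forall x y, is_cderive (Q ^~ y) x (Q' x y)) ->
  is_cderive (fun x => osc0 b x (Q x)) x (osc0 b x (amplitude_x Q Q' b x)).
Proof.
move=> gn b0 hQ hQ' dQ.
have [A A0 hA] := Cfamily_common_bound (hQ (`|x| + 1)) (hQ' (`|x| + 1)).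
have sub p : x - 1 < p < x + 1 -> `|p| <= `|x| + 1.
  move=> /andP[h1 h2]; rewrite ler_norml.
  have := ler_norm x; have := ler_norm (- x); rewrite normrN; lra.
apply: (@is_cderive_osc0 _ n g (fun=> b) id Q (amplitude_x Q Q' b)
  (x - 1) (x + 1) x b (`|x| + 1) A) => //.
- by rewrite ltrBlDr !ltrDl ltr01.
- by move=> p /sub/hA[].
- by move=> p /sub/hA[].
- move=> p y _; have := is_cderiveM (is_cderive_phase_x b p y) (dQ p y).
  set u := (X in is_cderive _ _ X -> _); set v := (X in _ -> is_cderive _ _ X).
  by suff -> : u = v by []; rewrite /u /v /amplitude_x; ring.
Qed.

Lemma osc0_bounded n g b (Q : R -> R -> R[i]) p q : g < n%:R - 1 -> 0 < b ->
  (forall X : R, Cfamily [set x | `|x| <= X] n g Q) ->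
  exists M, forall x, p <= x <= q -> modulus (osc0 b x (Q x)) <= M.
Proof.
move=> gn b0 hQ; pose X := `|p| + `|q|.
have X0 : 0 <= X by rewrite addr_ge0.
have [A A0 hA] := hQ X.
have [C [d [C0 d0 h]]] := osc0_rate gn X0 b0.
exists (C * A) => x /andP[px xq].
have xX : `|x| <= X.
  rewrite ler_norml /X; have := ler_norm q; have := ler_norm (- p); rewrite normrN.
  have := normr_ge0 p; have := normr_ge0 q; lra.
by have [] := h x b A (Q x) xX (lexx b) A0 (hA x xX).
Qed.

End space_derivative.

(** * Oscillatory integrals as functions of time *)

Section time_derivative.
Context {R : realType}.
Notation mu := (@lebesgue_measure R).
Context (I : set R) (oI : open I) (iI : is_interval I).
Context (n : nat) (g x : R) (gn : g < n%:R - 1).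
Context (P P' : R -> R -> R[i]).

Let seg (p q : R) : set R := [set t | p <= t <= q].

(** The amplitude of the derivative with respect to the phase parameter. *)
Let Pb (t y : R) : R[i] := 'i%C * ((y - x)%:C * ((y - x)%:C * P t y)).

Context (hP : forall p q, I p -> I q -> Cfamily (seg p q) n g P).
Context (hPb : forall p q, I p -> I q -> Cfamily (seg p q) n g Pb).
Context (hP' : forall p q, I p -> I q -> Cfamily (seg p q) n g P').
Context (dP : forall t y, I t -> is_cderive (P ^~ y) t (P' t y)).

Let bound3 p q : I p -> I q -> exists2 A : R, 0 <= A & forall t, p <= t <= q ->
  [/\ Cbound setT n (fun y => A * wt g 0 y) (P t),
      Cbound setT n (fun y => A * wt g 0 y) (Pb t)
    & Cbound setT n (fun y => A * wt g 0 y) (P' t)].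
Proof.
move=> Ip Iq; have [A1 A10 h1] := Cfamily_common_bound (hP Ip Iq) (hPb Ip Iq).
have [A2 A20 h2] := hP' Ip Iq; exists (A1 + A2); first exact: addr_ge0.
move=> t tpq; have [h3 h4] := h1 t tpq; split.
- by apply: Cbound_le h3 => y _; rewrite ler_wpM2r ?wt_ge0// lerDl.
- by apply: Cbound_le h4 => y _; rewrite ler_wpM2r ?wt_ge0// lerDl.
- by apply: Cbound_le (h2 t tpq) => y _; rewrite ler_wpM2r ?wt_ge0// lerDr.
Qed.

Lemma is_cderive_osc0_amplitude t b : I t -> 0 < b ->
  is_cderive (fun t => osc0 b x (P t)) t (osc0 b x (P' t)).
Proof.
move=> It b0; have [p Ip pt] := open_left oI It; have [q Iq tq] := open_right oI It.
have [A A0 hA] := bound3 Ip Iq.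
have sub s : p < s < q -> p <= s <= q by move=> /andP[/ltW-> /ltW->].
apply: (@is_cderive_osc0 _ n g (fun=> b) (fun=> x) P P' p q t b `|x| A) => //.
- by rewrite pt.
- by move=> s /sub/hA[].
- by move=> s /sub/hA[].
- move=> s y /sub spq; apply: is_cderiveZ; apply: dP; exact: (iI Ip Iq).
Qed.

Lemma is_cderive_osc0_phase t b : I t -> 0 < b ->
  is_cderive (fun b => osc0 b x (P t)) b (osc0 b x (Pb t)).
Proof.
move=> It b0; have [A A0 hA] := bound3 It It.
have [h1 h2 _] := hA t ltac:(by rewrite lexx).
apply: (@is_cderive_osc0 _ n g id (fun=> x) (fun=> P t) (fun=> Pb t)
  (b / 2) (2 * b) b (b / 2) `|x| A) => //.
- exact: divr_gt0.
- apply/andP; split; lra.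
- by move=> p /andP[/ltW].
- move=> p y _.
  have h : is_derive p 1 (fun p => p * (y - x) ^+ 2) ((y - x) ^+ 2).
    have -> : (fun p => p * (y - x) ^+ 2) = (y - x) ^+ 2 \*: (id : R -> R).
      by apply/funext => z; rewrite /GRing.scale/= mulrC.
    by apply: (is_derive_eq (is_deriveZ _ (is_derive_id p 1)));
      rewrite /GRing.scale/= mulr1.
  have := is_cderiveM (is_cderive_comp (is_cderive_expi _) h) (is_cderive_cst (P t y) p).
  set u := (X in is_cderive _ _ X -> _); set v := (X in _ -> is_cderive _ _ X).
  by suff -> : u = v by []; rewrite /u /v /Pb rmorphXn/=; ring.
Qed.

(** First the phase parameter moves at fixed time, then time at a fixed phase
    parameter; each step obeys the mean value inequality even where [a] is not
    differentiable. *)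
Lemma osc0_time_lipschitz p q (a : R -> R) b0 : I p -> I q -> 0 < b0 ->
  (forall t, p <= t <= q -> b0 <= a t) ->
  exists2 C : R, 0 <= C & forall s s', p <= s -> s <= s' -> s' <= q ->
    modulus (osc0 (a s') x (P s') - osc0 (a s) x (P s)) <=
      C * (`|a s' - a s| + (s' - s)).
Proof.
move=> Ip Iq b00 ha; have [A A0 hA] := bound3 Ip Iq.
have [C [d [C0 d0 h]]] := osc0_rate gn (normr_ge0 x) b00.
exists (2 * (C * A)); first by rewrite !mulr_ge0.
move=> s s' ps ss sq.
have Is : I s by apply: (iI Ip Iq); rewrite ps (le_trans ss sq).
have Is' : I s' by apply: (iI Ip Iq); rewrite sq (le_trans ps ss).
have bt t b : p <= t <= q -> b0 <= b -> modulus (osc0 b x (P' t)) <= C * A.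
  by move=> tpq bb; have [_ _ h1] := hA t tpq; have [] := h x b A (P' t) (lexx _) bb A0 h1.
have bb t b : p <= t <= q -> b0 <= b -> modulus (osc0 b x (Pb t)) <= C * A.
  by move=> tpq b0b; have [_ h1 _] := hA t tpq; have [] := h x b A (Pb t) (lexx _) b0b A0 h1.
have as0 : b0 <= a s by apply: ha; rewrite ps (le_trans ss).
have as0' : b0 <= a s' by apply: ha; rewrite sq (le_trans ps).
rewrite -(subrKA (osc0 (a s) x (P s'))).
rewrite (le_trans (modulusD _ _))// mulrDr lerD//.
  have mv b1 b2 : b0 <= b1 -> b1 <= b2 ->
      modulus (osc0 b2 x (P s') - osc0 b1 x (P s')) <= 2 * (C * A) * (b2 - b1).
    move=> h1 h2; apply: (@modulus_mean_value _ (fun b => osc0 b x (P s'))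
      (fun b => osc0 b x (Pb s'))) => //.
      by move=> b /andP[h3 _]; apply: is_cderive_osc0_phase => //; lra.
    by move=> b /andP[h3 _]; apply: bb; [rewrite sq (le_trans ps)|exact: le_trans h3].
  have [h1|h1] := leP (a s) (a s').
    by rewrite ger0_norm ?subr_ge0//; exact: mv.
  rewrite modulus_distC ltr0_norm ?subr_lt0// opprB; apply: mv => //; exact: ltW.
apply: (@modulus_mean_value _ (fun t => osc0 (a s) x (P t)) (fun t => osc0 (a s) x (P' t))) => //.
  move=> t /andP[h1 h2]; apply: is_cderive_osc0_amplitude; last exact: lt_le_trans as0.
  by apply: (iI Is Is'); rewrite h1.
by move=> t /andP[h1 h2]; apply: bt => //; rewrite (le_trans ps)//= (le_trans h2).
Qed.

Lemma modulus_expi_sub (u v : R) : modulus (expi u - expi v) <= 2 * `|u - v|.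
Proof.
wlog h : u v / v <= u => [hw|].
  have [h|/ltW h] := leP v u; first exact: hw.
  by rewrite modulus_distC distrC; exact: hw.
rewrite ger0_norm ?subr_ge0// -[2]mulr1.
apply: (@modulus_mean_value _ (@expi R) (fun t => 'i%C * expi t)) => //.
  by move=> y _; exact: is_cderive_expi.
by move=> y _; rewrite modulusM modulusi modulus_expi mulr1.
Qed.

(** With the cut-off present, powers of the weight are free: those lost by
    estimating the phase increment crudely are absorbed in [g + 4]. *)
Lemma osc_jointly_continuous e t0 b1 : 0 < e -> I t0 ->
  exists2 L : R, 0 <= L & \forall t \near t0, forall b,
    modulus (osc e b x (Pb t) - osc e b1 x (Pb t0)) <= L * (`|b - b1| + `|t - t0|).
Proof.
move=> e0 It0.
have [p Ip pt] := open_left oI It0; have [q Iq tq] := open_right oI It0.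
have [A A0 hA] := bound3 Ip Iq.
pose Z := 1 + (1 + `|x|) ^+ 2; have Z0 : 0 <= Z by rewrite addr_ge0 ?sqr_ge0.
pose I1 := \int[mu]_(y in setT) wt (g + 4) e y.
have I10 : 0 <= I1 by rewrite Rintegral_ge0// => y _; exact: wt_ge0.
exists (2 * (2 * A * Z ^+ 2 * I1)); first by rewrite !mulr_ge0 ?sqr_ge0.
have nt : \forall t \near t0, p < t < q.
  have : t0 \in `]p, q[ by rewrite in_itv/= pt tq.
  by move=> /near_in_itvoo; apply: filterS => t; rewrite in_itv.
apply: filterS nt => t /andP[/ltW pt' /ltW tq'] b.
have tpq : p <= t <= q by rewrite pt'.
have t0pq : p <= t0 <= q by rewrite !ltW.
have [h1 h2 h3] := hA t tpq; have [k1 k2 k3] := hA t0 t0pq.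
have zle y : 1 + (y - x) ^+ 2 <= Z * wt 2 0 y.
  rewrite wt0r powR_mulrn ?(ltW (weight_gt0 _))// /Z mulrDl mul1r lerD//.
    by rewrite exprn_ege1// weight_ge1.
  rewrite -exprMn -[leLHS]real_normK ?num_real//.
  rewrite lerXn2r ?nnegrE ?mulr_ge0 ?addr_ge0//.
  have := mulr_ge0 (normr_ge0 x) (normr_ge0 y).
  have := ler_normB y x; rewrite /weight; lra.
have dPt y : modulus (P t y - P t0 y) <= 2 * (A * wt g 0 y) * `|t - t0|.
  have mv s s' : p <= s -> s <= s' -> s' <= q ->
      modulus (P s' y - P s y) <= 2 * (A * wt g 0 y) * (s' - s).
    move=> a1 a2 a3; apply: (@modulus_mean_value _ (P ^~ y) (P' ^~ y)) => //.
      by move=> r /andP[r1 r2]; apply: dP; apply: (iI Ip Iq); lra.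
    move=> r /andP[r1 r2]; have [_ _ hr] := hA r ltac:(lra).
    exact: Cbound_bound hr _ _.
  have [tt|tt] := leP t0 t.
    by rewrite ger0_norm ?subr_ge0//; apply: mv => //; lra.
  rewrite modulus_distC ltr0_norm ?subr_lt0// opprB; apply: mv => //; lra.
have iPb s : p <= s <= q -> forall b', cintegrable setT (osc_integrand e b' x (Pb s)).
  move=> spq b'; have [_ hs _] := hA s spq.
  exact: (osc_integrand_integrable _ _ e0 (fun y => Cbound_continuous hs Logic.I)
    (fun y => Cbound_bound hs Logic.I)).
rewrite /osc -cintegralB//; [|exact: iPb..].
pose K := 2 * A * Z ^+ 2 * (`|b - b1| + `|t - t0|).
have -> : 2 * (2 * A * Z ^+ 2 * I1) * (`|b - b1| + `|t - t0|) =
    2 * \int[mu]_(y in setT) (K * wt (g + 4) e y).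
  by rewrite RintegralZl//; [rewrite /K -/I1; ring|exact: integrable_wt].
apply: modulus_cintegral_le => //.
- have : cintegrable setT (fun y => osc_integrand e b x (Pb t) y +
      (-1) * osc_integrand e b1 x (Pb t0) y).
    apply: cintegrableD => //; first exact: iPb.
    by apply: cintegrableZ => //; exact: iPb.
  by congr (cintegrable _ _); apply/funext => y; rewrite mulN1r.
- by apply: integrable_cmul => //; exact: integrable_wt.
move=> y _; rewrite /osc_integrand /Pb.
set E := expi (b * _); set E1 := expi (b1 * _).
have -> : (gauss e y)%:C * (E * ('i%C * ((y - x)%:C * ((y - x)%:C * P t y)))) -
    (gauss e y)%:C * (E1 * ('i%C * ((y - x)%:C * ((y - x)%:C * P t0 y)))) =
    (gauss e y)%:C * 'i%C * ((y - x) ^+ 2)%:C *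
      ((E - E1) * P t y + E1 * (P t y - P t0 y)).
  by rewrite rmorphXn/=; ring.
rewrite !modulusM modulusi mulr1 !modulus_real ger0_norm ?expR_ge0//.
rewrite (ger0_norm (sqr_ge0 _)).
set z2 := (y - x) ^+ 2; set S := `|b - b1| + `|t - t0|.
have z20 : 0 <= z2 by exact: sqr_ge0.
have W0 : 0 <= wt g 0 y by exact: wt_ge0.
have S0 : 0 <= S by rewrite addr_ge0.
have in1 : modulus ((E - E1) * P t y + E1 * (P t y - P t0 y)) <=
    2 * A * wt g 0 y * (S * (1 + z2)).
  rewrite (le_trans (modulusD _ _))// !modulusM modulus_expi mul1r.
  have e1 : modulus (E - E1) <= 2 * (`|b - b1| * z2).
    rewrite (le_trans (modulus_expi_sub _ _))// -mulrBl normrM.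
    by rewrite (ger0_norm z20).
  have e2 : modulus (E - E1) * modulus (P t y) <= 2 * (`|b - b1| * z2) * (A * wt g 0 y).
    by rewrite ler_pM ?modulus_ge0// (Cbound_bound h1).
  rewrite (le_trans (lerD e2 (dPt y)))//.
  have := mulr_ge0 (mulr_ge0 A0 W0) (normr_ge0 (b - b1)).
  have := mulr_ge0 (mulr_ge0 (mulr_ge0 A0 W0) (normr_ge0 (t - t0))) z20.
  rewrite /S; lra.
have zle2 : z2 <= Z * wt 2 0 y by rewrite (le_trans _ (zle y))// lerDr.
have zz : z2 * (1 + z2) <= (Z * wt 2 0 y) ^+ 2.
  by rewrite expr2 ler_pM// ?addr_ge0//; exact: zle.
have -> : K * wt (g + 4) e y = gauss e y * (2 * A * wt g 0 y * S * (Z * wt 2 0 y) ^+ 2).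
  have -> : wt (g + 4) e y = wt g 0 y * wt 2 0 y * wt 2 0 y * gauss e y.
    have -> : gauss e y = wt 0 e y by rewrite /wt powRr0 mul1r.
    by rewrite !wtM; congr wt; ring.
  by rewrite /K -/S; ring.
rewrite -mulrA ler_wpM2l ?expR_ge0//.
rewrite (le_trans (ler_wpM2l z20 in1))//.
have -> : z2 * (2 * A * wt g 0 y * (S * (1 + z2))) =
  2 * A * wt g 0 y * S * (z2 * (1 + z2)) by ring.
by rewrite ler_wpM2l//; do 3! apply: mulr_ge0 => //.
Qed.

(** A uniform limit of the functions of [osc_jointly_continuous]. *)
Lemma osc0_jointly_continuous t0 b1 eta : I t0 -> 0 < b1 -> 0 < eta ->
  exists2 r : R, 0 < r & \forall t \near t0, forall b, `|b - b1| <= r ->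
    modulus (osc0 b x (Pb t) - osc0 b1 x (Pb t0)) <= eta.
Proof.
move=> It0 b10 eta0.
have [p Ip pt] := open_left oI It0; have [q Iq tq] := open_right oI It0.
have [A A0 hA] := bound3 Ip Iq.
have b20 : 0 < b1 / 2 by rewrite divr_gt0.
have [C [d [C0 d0 h]]] := osc0_rate gn (normr_ge0 x) b20.
have eta3 : 0 < eta / 3 by rewrite divr_gt0.
have [e [e0 e1 he]] := powR_small d0 (mulr_ge0 C0 A0) eta3.
have [L L0 hL] := osc_jointly_continuous b1 e0 It0.
pose r0 := eta / (6 * (L + 1)).
have L1 : 0 < L + 1 by rewrite ltr_wpDl.
have r00 : 0 < r0 by rewrite divr_gt0// mulr_gt0.
exists (Num.min (b1 / 2) r0); first by rewrite lt_min b20.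
have nt : \forall t \near t0, p < t < q.
  have : t0 \in `]p, q[ by rewrite in_itv/= pt tq.
  by move=> /near_in_itvoo; apply: filterS => t; rewrite in_itv.
have nr : \forall t \near t0, `|t - t0| <= r0.
  by have := @cvgr_dist_le _ _ _ _ (nbhs_filter t0) id t0 cvg_id r0 r00;
    apply: filterS => t; rewrite distrC.
near=> t; move=> b; rewrite le_min => /andP[bb1 br].
have tpq : p <= t <= q.
  by have /andP[/ltW-> /ltW->] : p < t < q by near: t.
have t0pq : p <= t0 <= q by rewrite !ltW.
have [_ k1 _] := hA t tpq; have [_ k2 _] := hA t0 t0pq.
have b2b : b1 / 2 <= b by move: bb1; rewrite ler_norml; lra.
have b2b1 : b1 / 2 <= b1 by lra.
have [_ _ m1 _] := h x b A (Pb t) (lexx _) b2b A0 k1.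
have [_ _ m2 _] := h x b1 A (Pb t0) (lexx _) b2b1 A0 k2.
have {}m1 := le_trans (m1 e e0 e1) he.
have {}m2 := le_trans (m2 e e0 e1) he.
have m3 : modulus (osc e b x (Pb t) - osc e b1 x (Pb t0)) <= eta / 3.
  have hb : modulus (osc e b x (Pb t) - osc e b1 x (Pb t0)) <=
    L * (`|b - b1| + `|t - t0|) by move: b {bb1 br b2b m1}; near: t.
  have tr : `|t - t0| <= r0 by near: t.
  rewrite (le_trans hb)// (@le_trans _ _ ((L + 1) * (r0 + r0)))//.
    by rewrite ler_pM ?addr_ge0// ?lerD// lerDl.
  rewrite /r0 le_eqVlt; apply/orP; left; apply/eqP; field.
  by rewrite gt_eqF.
move: m1 m2 m3; move: (osc0 b x _) (osc0 b1 x _) (osc e b x _) (osc e b1 x _).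
move=> u v w1 w2 m1 m2 m3.
have -> : u - v = (u - w1) + ((w1 - w2) - (v - w2)) by ring.
rewrite (le_trans (modulusD _ _))//.
rewrite (le_trans (lerD m1 (le_trans (modulusB _ _) (lerD m3 m2))))//.
lra.
Unshelve. all: by end_near. Qed.

Let quotient_split (u1 u2 u3 L H : R[i]) (s s0 tau a' : R) : tau != 0 ->
  (u1 - u3) / tau%:C - (a'%:C * L + H) =
  ((u1 - s%:C * L) - (u2 - s0%:C * L)) / tau%:C + ((u2 - u3) / tau%:C - H)
    - (a' - (s - s0) / tau)%:C * L.
Proof.
move=> tau0; rewrite rmorphB fmorph_div/= !rmorphB/=.
by field; rewrite fmorph_eq0.
Qed.

(** As [a] may fail to be differentiable at points near [t0], the integrand
    cannot be differentiated on a neighbourhood of [t0].  The increment is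
    split instead: at time [t] the phase parameter moves from [a t0] to [a t],
    where the mean value inequality and joint continuity of the derivative in
    the parameter give the first term; then time moves at the phase parameter
    [a t0]. *)
Lemma is_cderive_osc0_time t0 (a : R -> R) a' : I t0 -> 0 < a t0 ->
  is_derive t0 1 a a' ->
  is_cderive (fun t => osc0 (a t) x (P t)) t0
    (a'%:C * osc0 (a t0) x (Pb t0) + osc0 (a t0) x (P' t0)).
Proof.
move=> It0 a0 da.
set L := osc0 (a t0) x (Pb t0); set H := osc0 (a t0) x (P' t0).
apply/is_cderive_quotient/cvg_modulus/cvgrPdist_le => eta eta0.
have eta30 : 0 < eta / 3 by rewrite divr_gt0.
have /is_cderive_quotient/cvg_modulus/cvgrPdist_le/(_ _ eta30) hH :=
  is_cderive_osc0_amplitude It0 a0.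
have /is_derive_quotient qa := da.
have eL0 : 0 < eta / 3 / (modulus L + 1).
  by rewrite divr_gt0// ltr_wpDl ?modulus_ge0.
have /cvgrPdist_le/(_ _ eL0) ha := qa.
have /cvgrPdist_le/(_ _ ltr01) ha1 := qa.
pose th := eta / 3 / (2 * (`|a'| + 1)).
have a'1 : 0 < `|a'| + 1 by rewrite ltr_wpDl.
have th0 : 0 < th by rewrite divr_gt0// mulr_gt0.
have [r r0 hr] := osc0_jointly_continuous It0 a0 th0.
have ca : {for t0, continuous a}.
  by case: da => dd _; apply: differentiable_continuous; apply/derivable1_diffP.
have car : \forall t \near t0, `|a t - a t0| <= Num.min r (a t0 / 2).
  have m0 : 0 < Num.min r (a t0 / 2) by rewrite lt_min r0 divr_gt0.
  move/cvgrPdist_le : ca => /(_ _ m0); apply: filterS => t.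
  by rewrite distrC.
have nI : \forall t \near t0, I t by exact: open_nbhs_nbhs.
near=> t.
have tt : t - t0 != 0 by rewrite subr_eq0; near: t; exact: nbhs_dnbhs_neq.
have It : I t by near: t; apply: nbhs_dnbhs.
have : `|a t - a t0| <= Num.min r (a t0 / 2) by near: t; apply: nbhs_dnbhs.
rewrite le_min => /andP[ar aa].
have hLt : forall b, `|b - a t0| <= r -> modulus (osc0 b x (Pb t) - L) <= th.
  by near: t; apply: nbhs_dnbhs.
have h1 : modulus (difference_quotient (fun t => osc0 (a t0) x (P t)) t0 t - H)
    <= eta / 3.
  have : `|0 - modulus (difference_quotient (fun t => osc0 (a t0) x (P t)) t0 t - H)|
    <= eta / 3 by near: t.
  by rewrite sub0r normrN ger0_norm ?modulus_ge0.
have h2 : `|a' - (a t - a t0) / (t - t0)| <= eta / 3 / (modulus L + 1) by near: t.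
have h3 : `|(a t - a t0) / (t - t0)| <= `|a'| + 1.
  have : `|a' - (a t - a t0) / (t - t0)| <= 1 by near: t.
  have := lerB_dist ((a t - a t0) / (t - t0)) a'; rewrite distrC; lra.
(* the derivative in b of osc0 b x (P t) - b L is small near b = a t0 *)
have h4 : modulus ((osc0 (a t) x (P t) - (a t)%:C * L) -
    (osc0 (a t0) x (P t) - (a t0)%:C * L)) <= 2 * th * `|a t - a t0|.
  have dW b : 0 < b -> is_cderive (fun b => osc0 b x (P t) - b%:C * L) b
      (osc0 b x (Pb t) - L).
    move=> b0; apply: is_cderiveB; first exact: is_cderive_osc0_phase.
    have := is_cderiveM (is_cderive_real (is_derive_id b 1)) (is_cderive_cst L b).
    by rewrite mulr0 addr0 mul1r.
  have ap : 0 < a t by move: aa; rewrite ler_norml; lra.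
  have [at0|at0] := leP (a t0) (a t).
    rewrite (ger0_norm (_ : 0 <= a t - a t0)) ?subr_ge0//.
    apply: (@modulus_mean_value _ (fun b => osc0 b x (P t) - b%:C * L)
      (fun b => osc0 b x (Pb t) - L)) => //.
      by move=> b /andP[b1 b2]; apply: dW; lra.
    move=> b /andP[b1 b2]; apply: hLt; move: ar.
    by rewrite !ger0_norm ?subr_ge0//; lra.
  have atE : `|a t - a t0| = a t0 - a t by rewrite ltr0_norm ?subr_lt0// opprB.
  rewrite modulus_distC atE.
  apply: (@modulus_mean_value _ (fun b => osc0 b x (P t) - b%:C * L)
    (fun b => osc0 b x (Pb t) - L)); first exact: ltW.
    by move=> b /andP[b1 b2]; apply: dW; lra.
  move=> b /andP[b1 b2]; apply: hLt; move: ar.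
  by rewrite atE ler0_norm ?subr_le0//; lra.
set W := (X in modulus X <= _) in h4.
rewrite sub0r normrN ger0_norm ?modulus_ge0//.
rewrite /difference_quotient (quotient_split _ (osc0 (a t0) x (P t)) _ _ _ (a t) (a t0) _ tt).
rewrite -/W.
rewrite (le_trans (modulusB _ _))//.
rewrite (le_trans (lerD (modulusD _ _) (lexx _)))//.
have -> : eta = eta / 3 + eta / 3 + eta / 3 by field.
rewrite !lerD//.
- rewrite modulusM modulusV modulus_real ler_pdivrMr ?normr_gt0//.
  rewrite (le_trans h4)//.
  have -> : `|a t - a t0| = `|(a t - a t0) / (t - t0)| * `|t - t0|.
    by rewrite -normrM divfK.
  rewrite mulrA ler_wpM2r//.
  rewrite (@le_trans _ _ (2 * th * (`|a'| + 1)))//.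
    by rewrite ler_wpM2l// mulr_ge0// ltW.
  rewrite /th le_eqVlt; apply/orP; left; apply/eqP; field.
  by rewrite gt_eqF.
- rewrite modulusM modulus_real.
  rewrite (@le_trans _ _ (eta / 3 / (modulus L + 1) * (modulus L + 1)))//.
    by rewrite ler_pM ?modulus_ge0// lerDl.
  by rewrite divfK// gt_eqF// ltr_wpDl ?modulus_ge0.
Unshelve. all: by end_near. Qed.

End time_derivative.

(** * Localization at the stationary point *)

Section initial_condition.
Context {R : realType}.
Notation mu := (@lebesgue_measure R).
Implicit Types (x y b e g c A : R) (f : R -> R[i]).

Lemma setC_tail_sub c : ~` tail c `<=` `[- c, c].
Proof.
by move=> y; rewrite /tail /= in_itv/= -ler_norml => /negP; rewrite -ltNge => /ltW.
Qed.

Lemma cintegral_setC_tail c f : cintegrable `[- c, c] f ->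
  cintegral (~` tail c) f = cintegral `[- c, c] f.
Proof.
move=> [i1 i2].
have -> : ~` tail c = [set` `]- c, c[].
  apply/seteqP; split => y; rewrite /tail /= in_itv/= -ltr_norml.
    by move/negP; rewrite -ltNge.
  by move=> h; apply/negP; rewrite -ltNge.
have main (h : R -> R) : mu.-integrable `[- c, c] (EFin \o h) ->
    \int[mu]_(y in `]- c, c[) h y = \int[mu]_(y in `[- c, c]) h y.
  move=> ih; rewrite Rintegral_itv_bndo_bndc; last first.
    by apply: integrableS ih => //; apply: subset_itv; rewrite bnd_simp.
  rewrite Rintegral_itv_obnd_cbnd//.
  by apply: integrableS ih => //; apply: subset_itv; rewrite bnd_simp.
by rewrite /cintegral !main.
Qed.

Lemma gauss_near1 e c y : 0 < e -> `|y| <= c -> `|gauss e y - 1| <= e * c ^+ 2.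
Proof.
move=> e0 yc; have yc2 : y ^+ 2 <= c ^+ 2.
  rewrite -[y ^+ 2]real_normK ?num_real//.
  by rewrite lerXn2r ?nnegrE ?normr_ge0// (le_trans _ yc).
have g1 : gauss e y <= 1.
  by rewrite /gauss -[leRHS]expR0 ler_expR mulNr oppr_le0 mulr_ge0 ?sqr_ge0// ltW.
rewrite ler0_norm ?subr_le0// opprB.
have := expR_ge1Dx (- e * y ^+ 2); rewrite -/(gauss e y) => h.
have : e * y ^+ 2 <= e * c ^+ 2 by rewrite ler_pM2l.
by move: h; rewrite mulNr; lra.
Qed.

(** Away from the stationary point the first integration by parts gains a
    factor [b^-1], with a constant independent of the cut-off; on the bounded
    interval around it the cut-off tends to [1] uniformly. *)
Lemma osc0_localized n g x : (0 < n)%N -> g < n%:R - 1 ->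
  exists2 C : R, 0 <= C & forall b A f, 1 <= b -> 0 <= A ->
    Cbound setT n (fun y => A * wt g 0 y) f ->
    modulus (osc0 b x f - cintegral `[- (`|x| + 1), `|x| + 1]
      (fun y => expi (b * (y - x) ^+ 2) * f y)) <= C * A / b.
Proof.
move=> n0 gn; set c := `|x| + 1.
have c0 : 0 < c by rewrite /c ltr_wpDl.
have mT := measurable_tail c0; have mTC := measurableC mT.
have gn' : g - n%:R < -1 by lra.
have [C1 C10 h1] := tail_estimate gn' (normr_ge0 x) ltr01.
have [C2 C20 h2] := @Cbound_gauss R n.
exists (C1 * (2 ^+ n * C2)).
  by apply: mulr_ge0 => //; apply: mulr_ge0 => //; exact: exprn_ge0.
move=> b A f b1 A0 hf.
have b0 : 0 < b by exact: lt_le_trans b1.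
have cf y : ccontinuous_at f y by exact: Cbound_continuous hf _ _.
have bf y : modulus (f y) <= A * wt g 0 y by exact: Cbound_bound hf _ _.
have i1 : mu.-integrable (~` tail c) (EFin \o wt g 1).
  by apply: integrableS (integrable_wt g ltr01).
pose I1 := \int[mu]_(y in ~` tail c) wt g 1 y.
have I10 : 0 <= I1 by rewrite Rintegral_ge0// => y _; exact: wt_ge0.
pose u y := expi (b * (y - x) ^+ 2) * f y.
have cu y : ccontinuous_at u y.
  by apply: ccontinuous_atM; [exact: phase_continuous|exact: cf].
have Dc y : `[- c, c]%classic y -> `|y| <= c by rewrite /= in_itv/= ler_norml.
have bu y : `[- c, c]%classic y -> modulus (u y) <= A * (expR (c ^+ 2) * wt g 1 y).
  move=> Dy; rewrite modulusM modulus_expi mul1r (le_trans (bf y))// ler_wpM2l//.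
  exact: wt0_le_gauss (Dc _ Dy).
have iuc : cintegrable `[- c, c] u.
  apply: (@cintegrable_le _ _ _ (fun y => A * (expR (c ^+ 2) * wt g 1 y))) => //.
    by apply: ccontinuous_measurable => // y _; exact: cu.
  apply: integrable_cmul => //; apply: integrable_cmul => //.
  by apply: integrableS (integrable_wt g ltr01).
have iu : cintegrable (~` tail c) u.
  by apply: cintegrableS iuc => //; exact: setC_tail_sub.
rewrite -(cintegral_setC_tail iuc).
pose K := 2 * (c ^+ 2 * (A * (expR (c ^+ 2) * I1))).
have K0 : 0 <= K.
  apply: mulr_ge0 => //; apply: mulr_ge0; first exact: sqr_ge0.
  by apply: mulr_ge0 => //; apply: mulr_ge0 => //; exact: expR_ge0.
apply/ler_addgt0Pl => eta eta0.
apply: (modulus_lim_le (osc0_cvg gn b0 A0 hf)).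
have e0' : 0 < Num.min 1 (eta / (K + 1)).
  by rewrite lt_min ltr01 divr_gt0// ltr_wpDl.
apply: filterS (lt_near_right0 e0') => e [e0]; rewrite le_min => /andP[e1 eK].
have iT := osc_integrand_integrable b x e0 cf bf.
rewrite /osc (cintegral_split c0 iT) -addrA (le_trans (modulusD _ _))//.
rewrite [leRHS]addrC lerD//.
  have -> : osc_integrand e b x f = (fun y => expi (b * (y - x) ^+ 2) *
      ((gauss e y)%:C * f y)).
    by apply/funext => y; rewrite /osc_integrand; ring.
  have hg : Cbound (tail c) n (fun y => 2 ^+ n * C2 * A * wt g (e / 2) y)
      (fun y => (gauss e y)%:C * f y).
    apply: (@Cbound_subset _ setT _ _ (fun y => 2 ^+ n * (C2 * wt 0 (e / 2) y * (A * wt g 0 y)))) => //.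
      move=> y _; have <- : wt 0 (e / 2) y * wt g 0 y = wt g (e / 2) y.
        by rewrite wtM add0r addr0.
      by rewrite le_eqVlt; apply/orP; left; apply/eqP; ring.
    exact: CboundM (h2 e e0 e1) hf.
  have A'0 : 0 <= 2 ^+ n * C2 * A.
    by apply: mulr_ge0 => //; apply: mulr_ge0 => //; exact: exprn_ge0.
  have e20 : 0 < e / 2 by rewrite divr_gt0.
  have := h1 x b _ (e / 2) _ (lexx _) b1 A'0 e20 hg.
  by rewrite n0 expr1 => /le_trans; apply; rewrite le_eqVlt; apply/orP; left; apply/eqP; ring.
have io : cintegrable (~` tail c) (osc_integrand e b x f).
  exact: cintegrableS iT.
rewrite -cintegralB//.
have : modulus (cintegral (~` tail c) (fun y => osc_integrand e b x f y - u y)) <=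
   2 * \int[mu]_(y in ~` tail c) (e * c ^+ 2 * A * expR (c ^+ 2) * wt g 1 y).
  apply: modulus_cintegral_le => //.
  - have -> : (fun y => osc_integrand e b x f y - u y) =
        (fun y => osc_integrand e b x f y + (-1) * u y).
      by apply/funext => y; rewrite mulN1r.
    by apply: cintegrableD => //; exact: cintegrableZ.
  - exact: integrable_cmul.
  - move=> y Dy; have -> : osc_integrand e b x f y - u y = (gauss e y - 1)%:C * u y.
      by rewrite rmorphB rmorph1 /osc_integrand /u; ring.
    rewrite modulusM modulus_real.
    have -> : e * c ^+ 2 * A * expR (c ^+ 2) * wt g 1 y =
        e * c ^+ 2 * (A * (expR (c ^+ 2) * wt g 1 y)) by ring.
    apply: ler_pM; [exact: normr_ge0|exact: modulus_ge0| |].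
      exact: gauss_near1 (Dc _ (setC_tail_sub Dy)).
    exact: bu (setC_tail_sub Dy).
move=> /le_trans; apply; rewrite RintegralZl// -/I1.
have -> : 2 * (e * c ^+ 2 * A * expR (c ^+ 2) * I1) = e * K by rewrite /K; ring.
apply: (@le_trans _ _ (e * (K + 1))); first by rewrite ler_pM2l// lerDl.
by rewrite -ler_pdivlMr// ltr_wpDl.
Qed.

Lemma C1_segment_Cn n a b (F : R -> R[i]) : (1 < n)%N -> Cn n F -> C1_segment a b F.
Proof.
move=> n1 [dF _].
have d1 y : is_cderive F y (cderive F y).
  by apply/is_cderiveP; split => //; exact: (dF 0%N y (ltnW n1)).
have d2 y : is_cderive (cderive F) y (cderive (cderive F) y).
  by apply/is_cderiveP; split => //; exact: (dF 1%N y n1).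
exists (cderive F); split.
  move=> y _; have /is_cderive_quotient h := d1 y.
  by apply: cvg_trans h; apply: cvg_app; exact: cvg_within.
apply: continuous_subspaceT => y; apply/ccontinuous_atP.
exact: is_cderive_continuous (d2 y).
Qed.

End initial_condition.

(** * The wave function *)

Section green_function.
Context {R : realType}.
Notation mu := (@lebesgue_measure R).

Lemma Cfamily_norm (P : set R) n (al : R) (U : R -> R -> R[i]) :
  (forall p, P p -> Cn_weighted n al (U p)) ->
  (exists M, forall p, P p -> `|Cn_norm n al (U p)| <= M) ->
  Cfamily P n al U.
Proof.
move=> hU [M hM]; exists `|M| => // p Pp.
apply: Cbound_le (Cbound_Cn_norm (hU p Pp)) => y _.
rewrite wt0r ler_wpM2r ?powR_ge0//.
by rewrite (le_trans (ler_norm _))// (le_trans (hM p Pp))// ler_norm.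
Qed.

Context (T : \bar R) (V : R -> R -> R[i]) (alpha beta : R) (n : nat).
Context (beta_lt : beta < n%:R - alpha - 3).
Context (F : R -> R[i]) (MF : R) (MF0 : 0 <= MF).
Context (F_bound : Cbound setT n (fun y => MF * wt beta 0 y) F).
Context (G Gt Gx Gxx Gs : R -> R -> R -> R[i]) (a : R -> R).
Context (a_AC : loc_AC (times T) (fun t => (a t)%:C)).
Context (a_gt0 : forall t, times T t -> 0 < a t).
Context (GE : forall t x y, times T t ->
  G t x y = expi (a t * (y - x) ^+ 2) * Gt t x y).
Context (dGx : forall t x y, times T t ->
  is_cderive (fun x => Gt t x y) x (Gx t x y)).
Context (dGxx : forall t x y, times T t ->
  is_cderive (fun x => Gx t x y) x (Gxx t x y)).
Context (dGs : forall t x y, times T t ->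
  is_cderive (fun t => Gt t x y) t (Gs t x y)).
Context (Gt_x : forall t X : R, times T t ->
  Cfamily [set x | `|x| <= X] n alpha (Gt t)).
Context (Gx_x : forall t X : R, times T t ->
  Cfamily [set x | `|x| <= X] n (alpha + 1) (Gx t)).
Context (Gxx_x : forall t X : R, times T t ->
  Cfamily [set x | `|x| <= X] n (alpha + 2) (Gxx t)).
Context (Gt_t : forall x p q, times T p -> times T q ->
  Cfamily [set t | p <= t <= q] n alpha (fun t => Gt t x)).
Context (Gs_t : forall x p q, times T p -> times T q ->
  Cfamily [set t | p <= t <= q] n (alpha + 2) (fun t => Gs t x)).

(** Two space derivatives, or one time derivative, cost two powers of the
    weight, so this is the largest weight that occurs. *)
Let g := alpha + beta + 2.

Let gn : g < n%:R - 1.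
Proof. by rewrite /g; move: beta_lt; lra. Qed.

Let F_family (P : set R) : Cfamily P n beta (fun=> F).
Proof. exact: Cfamily_cst F_bound. Qed.

(** The amplitudes, that is the factors of [expi (a t * (y - x) ^+ 2)], of the
    integrands of [Psi] and of its first two derivatives in [x]. *)
Let Q t x y : R[i] := Gt t x y * F y.
Let Qx t x y : R[i] := Gx t x y * F y.
Let Q1 t : R -> R -> R[i] := amplitude_x (Q t) (Qx t) (a t).
Let Q1x t x y : R[i] := Gxx t x y * F y +
  (- 2%:R * 'i%C * (a t)%:C) * ((y - x)%:C * Qx t x y - Q t x y).
Let Q2 t : R -> R -> R[i] := amplitude_x (Q1 t) (Q1x t) (a t).

Let Psi := wave_function G F.

Lemma regularized_integralE t x eps : times T t ->
  regularized_integral G F t x eps = osc eps (a t) x (Q t x).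
Proof.
move=> Tt; rewrite /regularized_integral /osc; congr cintegral.
apply/funext => y; rewrite /regularized_integrand /osc_integrand GE// /gauss /Q.
by ring.
Qed.

Lemma PsiE t x : times T t -> Psi t x = osc0 (a t) x (Q t x).
Proof.
move=> Tt; have E : regularized_integral G F t x = fun eps => osc eps (a t) x (Q t x).
  by apply/funext => eps; exact: regularized_integralE.
by rewrite /Psi /wave_function E.
Qed.

Let Q_fam t X : times T t -> Cfamily [set x | `|x| <= X] n (alpha + beta) (Q t).
Proof. by move=> Tt; apply: CfamilyM; [exact: Gt_x|exact: F_family]. Qed.

Let Qx_fam t X : times T t -> Cfamily [set x | `|x| <= X] n (alpha + beta + 1) (Qx t).
Proof.
move=> Tt; have -> : alpha + beta + 1 = alpha + 1 + beta by ring.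
by apply: CfamilyM; [exact: Gx_x|exact: F_family].
Qed.

Let Q1_fam t X : times T t -> Cfamily [set x | `|x| <= X] n (alpha + beta + 1) (Q1 t).
Proof.
by move=> Tt; apply: (@Cfamily_amplitude_x _ _ _ _ X) => //; [exact: Q_fam|exact: Qx_fam].
Qed.

Let Q1x_fam t X : times T t ->
  Cfamily [set x | `|x| <= X] n (alpha + beta + 1 + 1) (Q1x t).
Proof.
move=> Tt; have -> : alpha + beta + 1 + 1 = alpha + 2 + beta by ring.
apply: CfamilyD.
  by apply: CfamilyM; [exact: Gxx_x|exact: F_family].
apply: (@CfamilyZ _ _ _ _ (fun=> - 2%:R * 'i%C * (a t)%:C)
  (modulus (- 2%:R * 'i%C * (a t)%:C))) => //.
have -> : (fun x y => (y - x)%:C * Qx t x y - Q t x y) =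
    (fun x y => (y - x)%:C * Qx t x y + (-1) * Q t x y).
  by apply/funext => x; apply/funext => y; rewrite mulN1r.
apply: CfamilyD.
  have -> : alpha + 2 + beta = 1 + (alpha + beta + 1) by ring.
  by apply: CfamilyM; [exact: (@Cfamily_subr _ _ n X id)|exact: Qx_fam].
apply: (@CfamilyZ _ _ _ _ (fun=> -1) (modulus (-1))) => //.
by apply: Cfamily_le (Q_fam X Tt); lra.
Qed.

Let Q2_fam t X : times T t -> Cfamily [set x | `|x| <= X] n g (Q2 t).
Proof.
move=> Tt; have -> : g = alpha + beta + 1 + 1 by rewrite /g; ring.
by apply: (@Cfamily_amplitude_x _ _ _ _ X) => //; [exact: Q1_fam|exact: Q1x_fam].
Qed.

Let Q_famg t X : times T t -> Cfamily [set x | `|x| <= X] n g (Q t).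
Proof. by move=> Tt; apply: Cfamily_le (Q_fam X Tt); rewrite /g; lra. Qed.

Let Q1_famg t X : times T t -> Cfamily [set x | `|x| <= X] n g (Q1 t).
Proof. by move=> Tt; apply: Cfamily_le (Q1_fam X Tt); rewrite /g; lra. Qed.

Lemma wave_function_well_defined t x : times T t ->
  (forall eps, 0 < eps -> cintegrable setT (regularized_integrand G F t x eps)) /\
  cvg (regularized_integral G F t x eps @[eps --> 0^'+]).
Proof.
move=> Tt; have [A A0 hA] := Q_famg `|x| Tt.
have hQ := hA x (lexx _).
split.
  move=> eps eps0; have -> : regularized_integrand G F t x eps =
      osc_integrand eps (a t) x (Q t x).
    apply/funext => y; rewrite /regularized_integrand /osc_integrand GE// /gauss /Q.
    by ring.
  exact: (osc_integrand_integrable _ _ eps0 (fun y => Cbound_continuous hQ I)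
    (fun y => Cbound_bound hQ I)).
apply/cvg_ex; exists (osc0 (a t) x (Q t x)).
have -> : (fun eps => regularized_integral G F t x eps) =
    (fun eps => osc eps (a t) x (Q t x)).
  by apply/funext => eps; exact: regularized_integralE.
exact: osc0_cvg gn (a_gt0 Tt) A0 hQ.
Qed.

Lemma wave_function_x t x : times T t ->
  is_cderive (Psi t) x (osc0 (a t) x (Q1 t x)).
Proof.
move=> Tt; have -> : Psi t = fun x => osc0 (a t) x (Q t x).
  by apply/funext => z; exact: PsiE.
apply: (@is_cderive_osc0_x _ n g (a t) (Q t) (Qx t) x gn (a_gt0 Tt)).
- by move=> X; exact: Q_famg.
- by move=> X; exact: Q1_famg.
- by move=> z y; have := is_cderiveM (dGx z y Tt) (is_cderive_cst (F y) z);
    rewrite mulr0 addr0.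
Qed.

Lemma deriv_x_wave_function t : times T t ->
  deriv_x Psi t = fun x => osc0 (a t) x (Q1 t x).
Proof.
by move=> Tt; apply/funext => x; have /is_cderiveP[] := wave_function_x x Tt.
Qed.

Lemma wave_function_xx t x : times T t ->
  is_cderive (deriv_x Psi t) x (osc0 (a t) x (Q2 t x)).
Proof.
move=> Tt; rewrite deriv_x_wave_function//.
apply: (@is_cderive_osc0_x _ n g (a t) (Q1 t) (Q1x t) x gn (a_gt0 Tt)).
- by move=> X; exact: Q1_famg.
- by move=> X; exact: Q2_fam.
- move=> z y; rewrite /Q1 /amplitude_x /Qx /Q.
  have dz : is_cderive (fun x => (y - x)%:C) z (-1)%:C.
    apply: is_cderive_real.
    by apply: (is_derive_eq (is_deriveB (is_derive_cst y z 1)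
      (is_derive_id z 1))); rewrite sub0r.
  have dF := is_cderive_cst (F y) z.
  have := is_cderiveD (is_cderiveM (dGxx z y Tt) dF)
    (is_cderiveZ (- 2%:R * 'i%C * (a t)%:C)
      (is_cderiveM dz (is_cderiveM (dGx z y Tt) dF))).
  set u := (X in is_cderive _ _ X -> _); set v := (X in _ -> is_cderive _ _ X).
  suff -> : u = v by []; rewrite /u /v /Q1x /Qx /Q rmorphN rmorph1.
  by ring.
Qed.

Lemma wave_function_AC_x t : times T t ->
  [/\ loc_AC setT (Psi t), forall x, cderivable (Psi t) x
    & loc_AC setT (deriv_x Psi t)].
Proof.
move=> Tt; have iT : is_interval [set: R] by [].
split.
- apply: (loc_AC_bounded_derivative openT iT (fun x _ => wave_function_x x Tt)).
  move=> p q _ _; apply: (osc0_bounded p q gn (a_gt0 Tt)) => X.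
  exact: Q1_famg.
- by move=> x; have /is_cderiveP[] := wave_function_x x Tt.
- apply: (loc_AC_bounded_derivative openT iT (fun x _ => wave_function_xx x Tt)).
  move=> p q _ _; apply: (osc0_bounded p q gn (a_gt0 Tt)) => X.
  exact: Q2_fam.
Qed.

Let Qb x t y : R[i] := 'i%C * ((y - x)%:C * ((y - x)%:C * Q t x y)).
Let Qs x t y : R[i] := Gs t x y * F y.

Let Qt_fam x p q : times T p -> times T q ->
  Cfamily [set t | p <= t <= q] n (alpha + beta) (fun t => Q t x).
Proof. by move=> Tp Tq; apply: CfamilyM; [exact: Gt_t|exact: F_family]. Qed.

Let Qt_famg x p q : times T p -> times T q ->
  Cfamily [set t | p <= t <= q] n g (fun t => Q t x).
Proof. by move=> Tp Tq; apply: Cfamily_le (Qt_fam x Tp Tq); rewrite /g; lra. Qed.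

Let Qb_fam x p q : times T p -> times T q ->
  Cfamily [set t | p <= t <= q] n g (Qb x).
Proof.
move=> Tp Tq; apply: (@CfamilyZ _ _ _ _ (fun=> 'i%C) (modulus 'i%C)) => //.
have -> : g = 1 + (1 + (alpha + beta)) by rewrite /g; ring.
have cx : Cfamily [set t | p <= t <= q] n 1 (fun t y => (y - x)%:C).
  exact: (@Cfamily_subr _ _ n `|x| (fun=> x)).
by apply: CfamilyM => //; apply: CfamilyM => //; exact: Qt_fam.
Qed.

Let Qs_fam x p q : times T p -> times T q ->
  Cfamily [set t | p <= t <= q] n g (Qs x).
Proof.
move=> Tp Tq; have -> : g = alpha + 2 + beta by rewrite /g; ring.
by apply: CfamilyM; [exact: Gs_t|exact: F_family].
Qed.

Let dQs x t y : times T t -> is_cderive (fun t => Q t x y) t (Qs x t y).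
Proof.
move=> Tt; have := is_cderiveM (dGs x y Tt) (is_cderive_cst (F y) t).
by rewrite mulr0 addr0.
Qed.

Lemma wave_function_t t x a' : times T t -> is_derive t 1 a a' ->
  is_cderive (Psi ^~ x) t
    (a'%:C * osc0 (a t) x (Qb x t) + osc0 (a t) x (Qs x t)).
Proof.
move=> Tt da.
have h := @is_cderive_osc0_time _ _ (@times_open _ T) (@times_interval _ T) n g x gn
  (fun t => Q t x) (Qs x) (Qt_famg x) (Qb_fam x) (Qs_fam x)
  (fun t y => @dQs x t y) t a a' Tt (a_gt0 Tt) da.
apply: is_cderive_near h.
have : \forall s \near t, times T s by exact: (open_nbhs_nbhs (conj (@times_open _ T) Tt)).
by apply: filterS => s Ts; rewrite PsiE.
Qed.

Let a_density : exists2 ga : R -> R, locally_integrable (times T) ga &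
  forall s1 s2, times T s1 -> times T s2 -> s1 < s2 ->
    a s2 - a s1 = \int[mu]_(y in `[s1, s2]) ga y.
Proof.
have [ga [[lg _] h]] := a_AC; exists (fun s => complex.Re (ga s)) => //.
by move=> s1 s2 T1 T2 s12; have := h s1 s2 T1 T2 s12;
  rewrite -rmorphB => -[].
Qed.

Lemma a_continuous t : times T t -> {for t, continuous a}.
Proof.
have [ga lg h] := a_density.
exact: (AC_continuous (@times_open _ T) (@times_interval _ T) lg h).
Qed.

Lemma a_derivable : {ae mu, forall t, times T t -> derivable a t 1}.
Proof.
have [ga lg h] := a_density.
exact: (AC_derivable (@times_open _ T) (@times_interval _ T) lg h).
Qed.

(** The constant depends on [a] only through its minimum on [[p, q]], which is
    positive by continuity. *)
Lemma wave_function_lipschitz x p q : times T p -> times T q -> p < q ->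
  exists2 C : R, 0 <= C & forall s s', p <= s -> s <= s' -> s' <= q ->
    modulus (Psi s' x - Psi s x) <= C * (`|a s' - a s| + (s' - s)).
Proof.
move=> Tp Tq pq.
have Tt t : p <= t <= q -> times T t by exact: times_interval.
have ca : {within `[p, q], continuous a}.
  apply: continuous_in_subspaceT => t /set_mem /=; rewrite in_itv/= => /Tt.
  exact: a_continuous.
have [c cpq hc] := EVT_min (ltW pq) ca.
have ac0 : 0 < a c by apply: a_gt0; apply: Tt; move: cpq; rewrite in_itv.
have ha t : p <= t <= q -> a c <= a t by move=> tpq; apply: hc; rewrite in_itv.
have [C C0 h] := @osc0_time_lipschitz _ _ (@times_open _ T) (@times_interval _ T)
  n g x gn (fun t => Q t x) (Qs x) (Qt_famg x) (Qb_fam x) (Qs_fam x)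
  (fun t y => @dQs x t y) p q a (a c) Tp Tq ac0 ha.
exists C; first exact: C0.
move=> s s' ps ss sq.
have Ts : times T s by apply: Tt; rewrite ps (le_trans ss).
have Ts' : times T s' by apply: Tt; rewrite sq (le_trans ps).
rewrite (PsiE x Ts) (PsiE x Ts'); exact: (h s s' ps ss sq).
Qed.

(** The increments of [Psi] are dominated by those of a primitive of
    [`|a'| + 1], and [Psi] is differentiable wherever [a] is. *)
Lemma wave_function_AC_t x : loc_AC (times T) (Psi ^~ x).
Proof.
have oT := @times_open _ T; have iT := @times_interval _ T.
have [ga lg hga] := a_density.
apply: loc_AC_dominated => //.
- move=> p q Tp Tq pq; have [C C0 h] := wave_function_lipschitz x Tp Tq pq.
  have ig := locally_integrable_segment iT Tp Tq lg.
  have ign : mu.-integrable `[p, q] (EFin \o (fun s => `|ga s|)).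
    exact: integrable_norm.
  have i1 (u v : R) : mu.-integrable `[u, v] (EFin \o (fun=> 1)).
    apply: continuous_compact_integrable; first exact: segment_compact.
    by apply: continuous_subspaceT => y; exact: cvg_cst.
  exists (fun s => C * (`|ga s| + 1)).
    apply: integrable_cmul => //.
    by apply: eq_integrable (integrableD _ ign (i1 p q)) => //.
  move=> s s' ps ss sq; rewrite (le_trans (h s s' ps (ltW ss) sq))//.
  have sub : `[s, s'] `<=` `[p, q].
    by move=> y; rewrite /= !in_itv/= => /andP[sy ys]; rewrite (le_trans ps sy) (le_trans ys sq).
  have igs : mu.-integrable `[s, s'] (EFin \o (fun s => `|ga s|)).
    by apply: integrableS ign.
  rewrite RintegralZl//; last first.
    by apply: eq_integrable (integrableD _ igs (i1 s s')) => //.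
  rewrite ler_wpM2l// RintegralD// Rintegral_itv_cst ?(ltW ss)// mul1r lerD2r.
  rewrite hga//.
  + by apply: le_normr_Rintegral => //; apply: integrableS ig.
  + by apply: (iT p q) => //; rewrite ps (le_trans (ltW ss)).
  + by apply: (iT p q) => //; rewrite sq andbT (le_trans ps)// ltW.
- move=> s Ts; apply/ccontinuous_atP/cvg_modulus.
  have [p Tp ps] := open_left oT Ts; have [q Tq sq] := open_right oT Ts.
  have [C C0 h] := wave_function_lipschitz x Tp Tq (lt_trans ps sq).
  have h2 : C * (`|a t - a s| + `|t - s|) @[t --> s] --> C * (0 + 0).
    apply: cvgM; first exact: cvg_cst.
    apply: cvgD; apply/norm_cvg0P/subr_cvg0; [exact: a_continuous|exact: cvg_id].
  rewrite addr0 mulr0 in h2.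
  apply: (squeeze_cvgr _ (cvg_cst (0 : R)) h2).
  have nt : \forall t \near s, p < t < q.
    have : s \in `]p, q[ by rewrite in_itv/= ps sq.
    by move=> /near_in_itvoo; apply: filterS => t; rewrite in_itv.
  apply: filterS nt => t /andP[pt tq]; rewrite modulus_ge0.
  have [st|st] := leP s t.
    rewrite (ger0_norm (_ : 0 <= t - s)) ?subr_ge0//.
    by apply: h => //; exact: ltW.
  rewrite modulus_distC [X in C * (X + _)]distrC (ltr0_norm (_ : t - s < 0)) ?subr_lt0//.
  by rewrite (opprB t s); apply: h => //; exact: ltW.
- apply: (@filterS _ _ (ae_filter_ringOfSetsType mu) _ _ _ a_derivable).
  by move=> s h /[dup] Ts /h/derivableP/(wave_function_t x Ts)/is_cderiveP[].
Qed.

Lemma wave_function_AC12 : AC12 T Psi.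
Proof.
split; first exact: wave_function_AC_t.
by move=> t Tt; exact: wave_function_AC_x.
Qed.

Context (G_eq : forall y, schrodinger_solution T V (fun t x => G t x y)).

Let L1 t : R -> R -> R[i] := amplitude_x (Gt t) (Gx t) (a t).
Let L1x t x y : R[i] := Gxx t x y +
  (- 2%:R * 'i%C * (a t)%:C) * ((y - x)%:C * Gx t x y - Gt t x y).
Let L2 t : R -> R -> R[i] := amplitude_x (L1 t) (L1x t) (a t).

Let Q2E t x y : Q2 t x y = L2 t x y * F y.
Proof.
by rewrite /Q2 /L2 /amplitude_x /Q1 /L1 /Q1x /L1x /amplitude_x /Qx /Q; ring.
Qed.

Let green_equation_at t x y : Prop :=
  [/\ cderivable (fun s => G s x y) t,
      cderivable (deriv_x (fun t x => G t x y) t) x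
    & 'i%C * deriv_t (fun t x => G t x y) t x =
      - deriv_x (deriv_x (fun t x => G t x y)) t x + V t x * G t x y].

Let phase_neq0 (u : R) : expi u != 0.
Proof.
apply/eqP => h; have := @modulus_expi R u; rewrite h modulus0 => /esym/eqP.
by rewrite oner_eq0.
Qed.

Let G_x t x y : times T t ->
  deriv_x (fun t x => G t x y) t x = expi (a t * (y - x) ^+ 2) * L1 t x y.
Proof.
move=> Tt; have GtE : (fun x => G t x y) = fun x => expi (a t * (y - x) ^+ 2) * Gt t x y.
  by apply/funext => z; exact: GE.
have h := is_cderiveM (is_cderive_phase_x (a t) x y) (dGx x y Tt).
by have /is_cderiveP[_ hE] := h; rewrite /deriv_x GtE hE /L1 /amplitude_x; ring.
Qed.

Let G_xx t x y : times T t ->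
  deriv_x (deriv_x (fun t x => G t x y)) t x =
  expi (a t * (y - x) ^+ 2) * L2 t x y.
Proof.
move=> Tt; rewrite {1}/deriv_x.
have -> : deriv_x (fun t x => G t x y) t =
    fun x => expi (a t * (y - x) ^+ 2) * L1 t x y.
  by apply/funext => z; exact: G_x.
have dz : is_cderive (fun x => (y - x)%:C) x (-1)%:C.
  apply: is_cderive_real.
  by apply: (is_derive_eq (is_deriveB (is_derive_cst y x 1)
    (is_derive_id x 1))); rewrite sub0r.
have dL1 := is_cderiveD (dGxx x y Tt) (is_cderiveZ (- 2%:R * 'i%C * (a t)%:C)
    (is_cderiveM dz (dGx x y Tt))).
have h := is_cderiveM (is_cderive_phase_x (a t) x y) dL1.
have /is_cderiveP[_ hE] := h; rewrite [LHS]hE.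
by rewrite /L2 /L1x /L1 /amplitude_x rmorphN rmorph1; ring.
Qed.

Let G_t t x y a' : times T t -> is_derive t 1 a a' ->
  deriv_t (fun t x => G t x y) t x = expi (a t * (y - x) ^+ 2) *
    (a'%:C * ('i%C * ((y - x)%:C * ((y - x)%:C * Gt t x y))) + Gs t x y).
Proof.
move=> Tt da.
have dph : is_derive t 1 (fun s => a s * (y - x) ^+ 2) (a' * (y - x) ^+ 2).
  have -> : (fun s => a s * (y - x) ^+ 2) = (y - x) ^+ 2 \*: a.
    by apply/funext => s; rewrite /GRing.scale/= mulrC.
  by apply: (is_derive_eq (is_deriveZ _ da)); rewrite /GRing.scale/= mulrC.
have h := is_cderiveM (is_cderive_comp (is_cderive_expi _) dph) (dGs x y Tt).
have hn : \forall s \near t, expi (a s * (y - x) ^+ 2) * Gt s x y = G s x y.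
  have : \forall s \near t, times T s.
    exact: (open_nbhs_nbhs (conj (@times_open _ T) Tt)).
  by apply: filterS => s Ts; rewrite GE.
have /is_cderiveP[_ hE] := is_cderive_near hn h.
rewrite /deriv_t hE rmorphM rmorphXn/=.
by ring.
Qed.

(** The exceptional null set in the equation of the Green function depends on
    [y]; outside the union of those of rational [y] the equation, divided by
    the phase, extends to all [y] because the amplitudes are continuous. *)
Lemma green_equation_all t x a' : times T t -> is_derive t 1 a a' ->
  (forall r : rat, green_equation_at t x (ratr r)) -> forall y,
  'i%C * (a'%:C * ('i%C * ((y - x)%:C * ((y - x)%:C * Gt t x y))) + Gs t x y) =
  (-1) * L2 t x y + V t x * Gt t x y.
Proof.
move=> Tt da hr y; apply/eqP; rewrite -subr_eq0; apply/eqP; move: y.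
have [A1 _ hGt] := @Gt_x t `|x| Tt; have [A2 _ hGx] := @Gx_x t `|x| Tt.
have [A3 _ hGxx] := @Gxx_x t `|x| Tt; have [A4 _ hGs] := @Gs_t x t t Tt Tt.
have cGt y := Cbound_continuous (hGt x (lexx _)) (y := y) Logic.I.
have cGx y := Cbound_continuous (hGx x (lexx _)) (y := y) Logic.I.
have cGxx y := Cbound_continuous (hGxx x (lexx _)) (y := y) Logic.I.
have tt : t <= t <= t by rewrite lexx.
have cGs y := Cbound_continuous (hGs t tt) (y := y) Logic.I.
have cz y : ccontinuous_at (fun y => (y - x)%:C) y.
  exact: is_cderive_continuous (is_cderive_real (is_derive_sub x y)).
have cc (c : R[i]) y : ccontinuous_at (fun=> c) y by split; exact: cvg_cst.
apply: ccontinuous_rat_eq0.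
  have cM := @ccontinuous_atM R.
  have cD := @ccontinuous_atD R.
  have cN (f : R -> R[i]) y : ccontinuous_at f y -> ccontinuous_at (fun y => - f y) y.
    move=> cf; have -> : (fun y => - f y) = (fun y => -1 * f y).
      by apply/funext => z; rewrite mulN1r.
    exact: cM (cc _ y) cf.
  have cL1 y : ccontinuous_at (L1 t x) y.
    exact: cD (cGx y) (cM _ _ _ (cc _ y) (cM _ _ _ (cz y) (cGt y))).
  have cL1x y : ccontinuous_at (L1x t x) y.
    exact: cD (cGxx y) (cM _ _ _ (cc _ y)
      (cD _ _ _ (cM _ _ _ (cz y) (cGx y)) (cN _ y (cGt y)))).
  have cL2 y : ccontinuous_at (L2 t x) y.
    exact: cD (cL1x y) (cM _ _ _ (cc _ y) (cM _ _ _ (cz y) (cL1 y))).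
  move=> y; apply: (cD _ _ y).
    exact: cM (cc _ y) (cD _ _ _ (cM _ _ _ (cc _ y) (cM _ _ _ (cc _ y)
      (cM _ _ _ (cz y) (cM _ _ _ (cz y) (cGt y))))) (cGs y)).
  exact: cN (cD _ _ _ (cM _ _ _ (cc _ y) (cL2 y)) (cM _ _ _ (cc _ y) (cGt y))).
move=> r; have [_ _] := hr r; rewrite (G_t x (ratr r) Tt da) G_xx// GE//.
set e := expi _ => h; apply/eqP; rewrite subr_eq0; apply/eqP.
apply: (mulfI (phase_neq0 (a t * (ratr r - x) ^+ 2))); rewrite -/e.
by rewrite mulrCA h; ring.
Qed.

(** The equation between the amplitudes, multiplied by [F y] and integrated:
    the operator [osc0] is linear on the amplitudes of weight [g], and [V] does
    not depend on [y]. *)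
Lemma wave_function_equation t x a' : times T t -> is_derive t 1 a a' ->
  (forall r : rat, green_equation_at t x (ratr r)) ->
  'i%C * deriv_t Psi t x = - deriv_x (deriv_x Psi) t x + V t x * Psi t x.
Proof.
move=> Tt da hr.
have /is_cderiveP[_ ht] := wave_function_t x Tt da.
have /is_cderiveP[_ hxx] := wave_function_xx x Tt.
rewrite -[deriv_t Psi t x]/(cderive (Psi ^~ x) t) ht.
rewrite -[deriv_x (deriv_x Psi) t x]/(cderive (deriv_x Psi t) x) hxx.
rewrite PsiE//.
have [A1 A10 h1] := Qb_fam x Tt Tt; have [A2 A20 h2] := Qs_fam x Tt Tt.
have tt : t <= t <= t by rewrite lexx.
have {}h1 := h1 t tt; have {}h2 := h2 t tt.
have [A3 A30 h3] := @Q2_fam t `|x| Tt; have [A4 A40 h4] := @Q_famg t `|x| Tt.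
have {}h3 := h3 x (lexx _); have {}h4 := h4 x (lexx _).
have at0 := a_gt0 Tt.
have cb (c : R[i]) A f : Cbound setT n (fun y => A * wt g 0 y) f ->
    Cbound setT n (fun y => (modulus c * A) * wt g 0 y) (fun y => c * f y).
  by move=> hf; apply: Cbound_le (CboundZ c hf) => y _; rewrite mulrA.
have m0 (c : R[i]) A : 0 <= A -> 0 <= modulus c * A.
  by move=> A0; rewrite mulr_ge0 ?modulus_ge0.
rewrite -(osc0Z x _ gn at0 A10 h1).
rewrite -(osc0D x gn at0 (m0 _ _ A10) A20 (cb _ _ _ h1) h2).
have h12 := CboundD (cb a'%:C _ _ h1) h2.
have {}h12 : Cbound setT n (fun y => (modulus a'%:C * A1 + A2) * wt g 0 y)
    (fun y => a'%:C * Qb x t y + Qs x t y).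
  by apply: Cbound_le h12 => y _; rewrite mulrDl.
rewrite -(osc0Z x _ gn at0 (addr_ge0 (m0 _ _ A10) A20) h12).
rewrite -mulN1r -(osc0Z x _ gn at0 A30 h3) -(osc0Z x _ gn at0 A40 h4).
rewrite -(osc0D x gn at0 (m0 _ _ A30) (m0 _ _ A40) (cb _ _ _ h3) (cb _ _ _ h4)).
congr osc0; apply/funext => y; rewrite Q2E.
have h := green_equation_all Tt da hr y.
transitivity (('i%C * (a'%:C * ('i%C * ((y - x)%:C * ((y - x)%:C * Gt t x y)))
    + Gs t x y)) * F y); first by rewrite /Qb /Qs /Q; ring.
by rewrite h /Q; ring.
Qed.

Lemma wave_function_solution : schrodinger_solution T V Psi.
Proof.
have h1 : {ae lebesgue2 R, forall p : R * R, times T p.1 -> derivable a p.1 1}.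
  have [A [mA A0 sA]] := a_derivable.
  exists (A `*` setT); split.
  - exact: measurableX.
  - transitivity (mu A * mu setT)%E; last by rewrite [X in (X * _)%E](_ : _ = 0)%E ?mul0e.
    exact: (product_measure1E mu mu mA measurableT).
  - by move=> [t x] /= h; split => //; apply: sA => /= h'; exact: h.
have h2 : {ae lebesgue2 R, forall p : R * R, forall r : rat, times T p.1 ->
    green_equation_at p.1 p.2 (ratr r)}.
  apply: ae_forall_countable => r.
  apply: (@filterS _ _ (ae_filter_ringOfSetsType _) _ _ _ (G_eq (ratr r))).
  by move=> [t x] h Tt; exact: h.
apply: (@filterS2 _ _ (ae_filter_ringOfSetsType _) _ _ _ _ h1 h2).
move=> [t x] /= k1 k2 Tt; have da := derivableP (k1 Tt); split.
- by have /is_cderiveP[] := wave_function_t x Tt da.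
- by have /is_cderiveP[] := wave_function_xx x Tt.
- by apply: (wave_function_equation Tt da) => r; exact: k2.
Qed.

Context (T_gt0 : (0 < T)%E) (n_gt1 : (1 < n)%N) (F_Cn : Cn n F).
Context (G_init : green_initial G) (a_y : a t @[t --> 0^'+] --> +oo).
Context (Gt_Cn : forall t x, times T t -> Cn_weighted n alpha (Gt t x)).
Context (Gt_small : forall x,
  Cn_norm n alpha (Gt t x) / a t @[t --> 0^'+] --> (0 : R)).

Let near0_times : \forall t \near (0 : R)^'+, times T t.
Proof.
have [e e0 eT] : exists2 e : R, 0 < e & (e%:E <= T)%E.
  move: T_gt0; case: (T) => [r| |]//; first by rewrite lte_fin => r0; exists r.
  by move=> _; exists 1 => //; rewrite leey.
apply: filterS (lt_near_right0 (_ : 0 < e / 2)); last by rewrite divr_gt0.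
move=> t [t0 te]; split => //; apply: lt_le_trans eT; rewrite lte_fin.
by rewrite (le_lt_trans te)// ltr_pdivrMr// ltr_pMr// ltr1n.
Qed.

(** On a bounded interval around [x] the Green function acts on [F] as an
    approximate identity by hypothesis; the rest is of the order of the
    quotient of the norm of [Gt t x] by [a t]. *)
Lemma wave_function_initial x : Psi t x @[t --> 0^'+] --> F x.
Proof.
have gn' : alpha + beta < n%:R - 1 by move: beta_lt; lra.
have [C C0 h] := @osc0_localized R n (alpha + beta) x (ltnW n_gt1) gn'.
pose c := `|x| + 1; have c0 : 0 < c by rewrite /c ltr_wpDl.
have xc : - c < x < c by rewrite -ltr_norml /c ltrDl.
have /cvg_modulus hI := G_init c0 (C1_segment_Cn (- c) c n_gt1 F_Cn) xc.
pose D := C * (2 ^+ n * MF).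
have hb : modulus (cintegral `[- c, c] (fun y => G t x y * F y) - F x) +
    D * (Cn_norm n alpha (Gt t x) / a t) @[t --> 0^'+] --> 0 + D * 0.
  by apply: cvgD; [exact: hI|apply: cvgM; [exact: cvg_cst|exact: Gt_small]].
rewrite mulr0 addr0 in hb.
apply/cvg_modulus; apply: (squeeze_cvgr _ (cvg_cst (0 : R)) hb).
have na : \forall t \near (0 : R)^'+, 1 <= a t by move/cvgryPge : a_y; apply.
apply: filterS2 near0_times na => t Tt a1; rewrite modulus_ge0/=.
have IE : cintegral `[- c, c] (fun y => G t x y * F y) =
    cintegral `[- c, c] (fun y => expi (a t * (y - x) ^+ 2) * Q t x y).
  by congr cintegral; apply/funext => y; rewrite GE// /Q mulrA.
pose N := Cn_norm n alpha (Gt t x).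
have N0 : 0 <= N by exact: Cn_norm_ge0.
have hQ : Cbound setT n (fun y => 2 ^+ n * (N * MF) * wt (alpha + beta) 0 y) (Q t x).
  apply: Cbound_le (CboundM (Cbound_Cn_norm (Gt_Cn x Tt)) F_bound) => y _.
  have <- : weight y `^ alpha * wt beta 0 y = wt (alpha + beta) 0 y.
    by rewrite -wt0r wtM addr0.
  by rewrite -/N le_eqVlt; apply/orP; left; apply/eqP; ring.
have A0 : 0 <= 2 ^+ n * (N * MF).
  by apply: mulr_ge0; [exact: exprn_ge0|exact: mulr_ge0].
have hP := h _ _ _ a1 A0 hQ.
rewrite (PsiE x Tt) -(subrK (cintegral `[- c, c] (fun y => G t x y * F y)) (osc0 _ _ _)).
rewrite -addrA addrC (le_trans (modulusD _ _))// lerD2l IE.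
apply: (le_trans hP); rewrite le_eqVlt; apply/orP; left; apply/eqP.
by rewrite /D -/N; ring.
Qed.

End green_function.

Theorem theorem4p2 (R : realType) (T : \bar R) (T_gt0 : (0 < T)%E)
    (V : R -> R -> R[i]) (V_meas : measurable_potential T V)
    (alpha : R) (n : nat) (alpha_ge0 : 0 <= alpha) (n_gt : alpha + 3 < n%:R)
    (G : R -> R -> R -> R[i]) (G_green : green_assumption T V alpha n G)
    (beta : R) (beta_ge0 : 0 <= beta) (beta_lt : beta < n%:R - alpha - 3)
    (F : R -> R[i]) (F_Cn : Cn_weighted n beta F) :
  (forall t x, times T t ->
     (forall eps, 0 < eps ->
        cintegrable setT (regularized_integrand G F t x eps)) /\
     cvg (regularized_integral G F t x eps @[eps --> 0^'+])) /\
  [/\ AC12 T (wave_function G F),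
      schrodinger_solution T V (wave_function G F)
    & forall x, wave_function G F t x @[t --> 0^'+] --> F x].
Proof.
have [G_eq G_init [a [Gt [[a_AC [a_gt0 a_y]] [GE [Gd [GC [Glb G_small]]]]]]]] := G_green.
have [F_n [MF [MF0 hF]]] := F_Cn.
have F_bound : Cbound setT n (fun y => MF * wt beta 0 y) F.
  by apply: Cbound_le (Cbound_cderiven F_n hF) => y _; rewrite wt0r.
pose Gx t x y := deriv_x (fun t x => Gt t x y) t x.
pose Gxx t x y := deriv_x (deriv_x (fun t x => Gt t x y)) t x.
pose Gs t x y := deriv_t (fun t x => Gt t x y) t x.
have [lb0 lb1 lb2 lbs] := Glb.
have dGx t x y : times T t -> is_cderive (fun x => Gt t x y) x (Gx t x y).
  by move=> Tt; have [h _ _] := Gd t x y Tt; apply/is_cderiveP.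
have dGxx t x y : times T t -> is_cderive (fun x => Gx t x y) x (Gxx t x y).
  by move=> Tt; have [_ h _] := Gd t x y Tt; apply/is_cderiveP.
have dGs t x y : times T t -> is_cderive (fun t => Gt t x y) t (Gs t x y).
  by move=> Tt; have [_ _ h] := Gd t x y Tt; apply/is_cderiveP.
have C0 t x : times T t -> Cn_weighted n alpha (Gt t x) by move=> /(GC t x)[].
have C1 t x : times T t -> Cn_weighted n (alpha + 1) (Gx t x) by move=> /(GC t x)[].
have C2 t x : times T t -> Cn_weighted n (alpha + 2) (Gxx t x) by move=> /(GC t x)[].
have Cs t x : times T t -> Cn_weighted n (alpha + 2) (Gs t x) by move=> /(GC t x)[].
have fam_x al (U : R -> R -> R -> R[i]) :
    (forall t x, times T t -> Cn_weighted n al (U t x)) ->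
    locally_bounded T (fun t x => Cn_norm n al (U t x)) ->
    forall t X, times T t -> Cfamily [set x | `|x| <= X] n al (U t).
  move=> hU lb t X Tt; apply: Cfamily_norm; first by move=> x _; exact: hU.
  by have [M hM] := locally_bounded_x X lb Tt; exists M.
have fam_t al (U : R -> R -> R -> R[i]) :
    (forall t x, times T t -> Cn_weighted n al (U t x)) ->
    locally_bounded T (fun t x => Cn_norm n al (U t x)) ->
    forall x p q, times T p -> times T q ->
    Cfamily [set t | p <= t <= q] n al (fun t => U t x).
  move=> hU lb x p q Tp Tq; apply: Cfamily_norm.
    by move=> t /= pq; apply: hU; exact: times_interval pq.
  by have [M hM] := locally_bounded_t x lb Tp Tq; exists M.
have n_gt1 : (1 < n)%N by rewrite -(ltr_nat R); move: n_gt alpha_ge0; lra.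
split.
  move=> t x Tt; exact: (wave_function_well_defined beta_lt MF0 F_bound a_gt0 GE
    (fam_x _ _ C0 lb0) x Tt).
have f0 := fam_x _ _ C0 lb0; have f1 := fam_x _ _ C1 lb1.
have f2 := fam_x _ _ C2 lb2; have g0 := fam_t _ _ C0 lb0.
have gs := fam_t _ _ Cs lbs.
split.
- exact: (wave_function_AC12 beta_lt MF0 F_bound a_AC a_gt0 GE dGx dGxx dGs f0 f1 f2 g0 gs).
- exact: (wave_function_solution beta_lt MF0 F_bound a_AC a_gt0 GE dGx dGxx dGs
    f0 f1 f2 g0 gs (fun y => (G_eq y).2)).
- move=> x; exact: (wave_function_initial beta_lt MF0 F_bound GE T_gt0
    n_gt1 F_n G_init a_y C0 G_small).
Qed.
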